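(* Let $G$ be a compact, simple, simply-connected Lie group. On the basic gerbe $(PG\times\widehat{\Omega G},PG)$ on $G$, the pair $(\nabla,B)$ with $$\nabla=\mathrm{pr}_2^*\mu-\pi^*\epsilon,\quad \epsilon_{(p,\gamma)}=2\int_0^{2\pi}\mathrm d\theta\,\langle\Theta_p,\widehat\phi_\gamma\rangle,\qquad B_p=\int_0^{2\pi}\mathrm d\theta\,\langle\Theta_p,\partial\Theta_p\rangle,$$ forms a bundle gerbe connection and curving, with 3-form curvature identical to that of the Murray--Stevenson connection and curving on the basic gerbe, namely the standard 3-form $\omega=\frac16\langle[\Theta,\Theta],\Theta\rangle\in\Omega^3(G)$.
   Context: For a surjective submersion $Y\to X$ of smooth Fréchet manifolds, $Y^{[k]}$ is the $k$-fold fibre product, $d_i\colon Y^{[k]}\to Y^{[k-1]}$ omits the $(i+1)$-th factor, $\delta\omega=\sum(-1)^id_i^*\omega$ for forms, and $\delta E=d_0^*E\otimes d_1^*E^*\otimes d_2^*E\otimes\cdots$ for principal $U(1)$-bundles (with induced sections and connections). A bundle gerbe $(E,Y)$ on $X$ is a $U(1)$-bundle $E\to Y^{[2]}$ with a section $m$ of $\delta E\to Y^{[3]}$ such that $\delta(m)$ is the canonical section of $\delta^2E$. A bundle gerbe connection is a connection $\nabla$ on $E$ with $m^*\delta\nabla=0$; a curving for it is $b\in\Omega^2(Y)$ with $\delta b=\mathrm{curv}(\nabla)$; the 3-form curvature is the unique 3-form on $X$ pulling back to $db$. Forms are evaluated in the Kobayashi--Nomizu convention: $\alpha\wedge\beta(X,Y)=\frac12(\alpha(X)\beta(Y)-\alpha(Y)\beta(X))$,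 $d\alpha(X,Y)=\frac12(X\alpha(Y)-Y\alpha(X)-\alpha([X,Y]))$ for 1-forms. $\mathrm{Lie}(U(1))=i\mathbb R$ is identified with $\mathbb R$ by division by $i$, so connections are real-valued 1-forms. $\langle-,-\rangle$ is the basic inner product on $\mathfrak g$ (normalised so that coroots of long roots have length squared $2$) divided by $4\pi$. $PG=\{p\in C^\infty([0,2\pi],G):p(0)=1\}$ with submersion $\mathrm{ev}_{2\pi}\colon PG\to G$, $\Omega G=\ker(\mathrm{ev}_{2\pi})$, $\theta$ is the coordinate on $[0,2\pi]$, $\partial=\partial/\partial\theta$ applied pointwise, $\Theta_g=g^{-1}dg$ the left-invariant Maurer--Cartan form (of $G$, or pointwise on $PG$, $\Omega G$), $\widehat\phi_p=\partial p\,p^{-1}$. $\pi\colon\widehat{\Omega G}\to\Omega G$ is the level 1 central extension by $U(1)$, with connection $\mu$ whose curvature is $R_\gamma=\int_0^{2\pi}\mathrm d\theta\,\langle\Theta_\gamma,\partial\Theta_\gamma\rangle$ and such that $\mathrm{pr}_1^*\mu+\mathrm{pr}_2^*\mu-\mathrm{mult}^*\mu$ on $\widehat{\Omega G}^2$ is the pullback of $\nu_{(\gamma,\eta)}=2\int_0^{2\pi}\mathrm d\theta\,\langle\Theta_\gamma,\widehat\phi_\eta\rangle$. The basic gerbe on $G$ has submersion $PG\to G$, and $U(1)$-bundle $\pi\colon PG\times\widehat{\Omega G}\to PG\times\Omega G\simeq PG^{[2]}$, where $(p,\gamma)\leftrightarrow(p,p\gamma)$ (so $d_0(p,\gamma)=p\gamma$,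 $d_1(p,\gamma)=p$), with multiplication given by the group multiplication of $\widehat{\Omega G}$: $\hat\eta\otimes\hat\gamma\mapsto\hat\gamma\hat\eta$ for $\hat\gamma$ over $(p,\gamma)$ and $\hat\eta$ over $(p\gamma,\eta)$. *)

(* Defs.v *)
From HB Require Import structures.
From mathcomp Require Import all_boot all_order all_algebra all_fingroup.
From mathcomp Require Import all_classical all_reals all_analysis.
From mathcomp Require Import complex.

Set Implicit Arguments.
Unset Strict Implicit.
Unset Printing Implicit Defensive.

Import Order.TTheory GRing.Theory Num.Theory.
Import numFieldNormedType.Exports.
Local Open Scope classical_set_scope.
Local Open Scope ring_scope.

(** A manifold M is handled through its smooth maps P : R^n -> M ("plots"):
    f : M -> N is smooth iff it sends plots to plots, and a differential form
    on M is the family of its pullbacks along plots.  On Frechet manifolds this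
    loses nothing: they form a full subcategory of the spaces with plots
    (diffeological spaces), with the same differential forms and the same fibre
    products along submersions.  Being a manifold (finite dimensional or
    Frechet) is then the existence of charts.

    Plots are defined on all of R^n; statements about open subsets of R^n are
    phrased with germs. *)

Section Calculus.
Context {R : realType}.

Fixpoint Ck (k : nat) (V W : normedModType R) (f : V -> W) : Prop :=
  continuous f /\
  if k is k'.+1 then
    (forall x v, derivable f x v) /\ (forall v, Ck k' (fun x => 'D_v f x))
  else True.

Definition smooth (V W : normedModType R) (f : V -> W) := forall k, Ck k f.

(* The library's [derive] wants a normed target; a Frechet space is not normed. *)
Definition tvs_quotient (V : normedModType R) (E : tvsType R) (f : V -> E)
  (x v : V) : R -> E := fun h => h^-1 *: (f (x + h *: v) - f x).

Fixpoint tvs_Ck (k : nat) (V : normedModType R) (E : tvsType R) (f : V -> E)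
    : Prop :=
  continuous f /\
  if k is k'.+1 then
    forall v, exists2 df : V -> E,
      (forall x, tvs_quotient f x v @ 0^' --> df x) & tvs_Ck k' df
  else True.

Definition tvs_smooth (V : normedModType R) (E : tvsType R) (f : V -> E) :=
  forall k, tvs_Ck k f.

Definition frechet_space (E : tvsType R) : Prop :=
  [/\ hausdorff_space E, countable_uniformity E &
      forall F : set_system E, ProperFilter F -> cauchy F ->
        exists x : E, F --> x].

End Calculus.

Record pspace (R : realType) := PSpace {
  carrier :> Type;
  plot : forall n, set ('rV[R]_n -> carrier) }.

Arguments plot {R} p {n}.

Section SmoothSpaces.
Context {R : realType}.
Implicit Types X Y Z M : pspace R.

(* A space may live on a proper subset of its carrier: only the points through
   which there is a constant plot count. *)
Definition pts X : set X := [set x | plot X (fun _ : 'rV[R]_0 => x)].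

Definition diffeology X : Prop :=
  [/\ forall n x, pts x -> plot X (fun _ : 'rV[R]_n => x),
      forall m n (P : 'rV[R]_n -> X) (h : 'rV[R]_m -> 'rV[R]_n),
        plot X P -> smooth h -> plot X (P \o h) &
      forall n (P : 'rV[R]_n -> X),
        (forall u : 'rV[R]_n,
           exists2 Q, plot X Q & \forall u' \near u, P u' = Q u') ->
        plot X P].

Definition smooth_map X Y (f : X -> Y) : Prop :=
  forall n (P : 'rV[R]_n -> X), plot X P -> plot Y (f \o P).

Definition smooth_on X Y (O : set X) (f : X -> Y) : Prop :=
  forall n (P : 'rV[R]_n -> X) u, plot X P -> O (P u) ->
    exists2 Q : 'rV[R]_n -> Y, plot Y Q & \forall u' \near u, f (P u') = Q u'.

(* Smoothness on a subset of R^n, possibly with boundary: local smooth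
   extendability. *)
Definition smooth_within X n (S : set 'rV[R]_n) (f : 'rV[R]_n -> X) : Prop :=
  forall x, S x ->
    exists2 Q, plot X Q & \forall x' \near x, S x' -> f x' = Q x'.

Definition prod_space X Y : pspace R :=
  @PSpace R (X * Y)%type
    (fun n => [set P : 'rV[R]_n -> X * Y |
                 plot X (fst \o P) /\ plot Y (snd \o P)]).

(* The topology in which A is open iff its preimage under every plot is; for a
   manifold it is the manifold topology. *)
Definition dtop X : Type := carrier X.

HB.instance Definition _ X := gen_eqMixin (dtop X).
HB.instance Definition _ X := gen_choiceMixin (dtop X).

Definition dopen X (A : set (dtop X)) : Prop :=
  forall n (P : 'rV[R]_n -> X), plot X P -> open (P @^-1` A).

Lemma dopenT X : dopen (setT : set (dtop X)).
Proof. by move=> n P _; rewrite preimage_setT; exact: openT. Qed.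

Lemma dopenI X (A B : set (dtop X)) : dopen A -> dopen B -> dopen (A `&` B).
Proof.
by move=> oA oB n P plP; rewrite preimage_setI; apply: openI; [exact: oA|exact: oB].
Qed.

Lemma dopen_bigU X (I : Type) (f : I -> set (dtop X)) :
  (forall i, dopen (f i)) -> dopen (\bigcup_i f i).
Proof.
by move=> of_ n P plP; rewrite preimage_bigcup; apply: bigcup_open => i _; exact: of_.
Qed.

HB.instance Definition _ X :=
  isOpenTopological.Build (dtop X) (@dopenT X) (@dopenI X) (@dopen_bigU X).

(* A diffeomorphism from R^d onto an open subset of X. *)
Definition chart X d (phi : 'rV[R]_d -> X) : Prop :=
  [/\ plot X phi, injective phi &
      forall n (Q : 'rV[R]_n -> X) u, plot X Q -> range phi (Q u) ->
        exists2 h : 'rV[R]_n -> 'rV[R]_d, smooth h &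
          \forall u' \near u, Q u' = phi (h u')].

Definition manifold d X : Prop :=
  [/\ diffeology X, hausdorff_space (dtop X) &
      forall x : X, pts x -> exists2 phi, @chart X d phi & phi 0 = x].

(* A diffeomorphism from the open subset U of E onto an open subset of X. *)
Definition frechet_chart X (E : tvsType R) (U : set E) (phi : E -> X) : Prop :=
  [/\ open U, {in U &, injective phi},
      forall n (h : 'rV[R]_n -> E),
        tvs_smooth h -> (forall u, U (h u)) -> plot X (phi \o h) &
      forall n (Q : 'rV[R]_n -> X) u, plot X Q -> (phi @` U) (Q u) ->
        exists2 h : 'rV[R]_n -> E, tvs_smooth h &
          \forall u' \near u, U (h u') /\ Q u' = phi (h u')].

Definition frechet_manifold X : Prop :=
  [/\ diffeology X, hausdorff_space (dtop X) &
      forall x : X, pts x -> exists (E : tvsType R) (U : set E) (phi : E -> X),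
        [/\ frechet_space E, frechet_chart U phi & (phi @` U) x]].

(* Submersions are given by smooth local sections through every point. *)
Definition submersion X Y (p : Y -> X) : Prop :=
  smooth_map p /\
  forall y, pts y -> exists (O : set (dtop X)) (s : X -> Y),
    [/\ open O, O (p y), smooth_on O s,
        forall x, pts x -> O x -> p (s x) = x & s (p y) = y].

Definition surjective_submersion X Y (p : Y -> X) : Prop :=
  submersion p /\ (forall x, pts x -> exists2 y, pts y & p y = x).

(* [w n P u v] is the value of (P^* w) at u on the tangent vectors v. *)
Definition diff_form (k : nat) X : Type :=
  forall n, ('rV[R]_n -> X) -> 'rV[R]_n -> ('I_k -> 'rV[R]_n) -> R.

Definition upd (I : eqType) (T : Type) (v : I -> T) (i : I) (x : T) : I -> T :=
  fun j => if j == i then x else v j.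

(* [form_local] is the sheaf condition that restricting plots to open subsets of
   R^n would give. *)
Record is_form k X (w : diff_form k X) : Prop := IsForm {
  form_smooth : forall n (P : 'rV[R]_n -> X) v,
    plot X P -> smooth (fun u => w n P u v);
  form_local : forall n (P Q : 'rV[R]_n -> X) u v, plot X P -> plot X Q ->
    (\forall u' \near u, P u' = Q u') -> w n P u v = w n Q u v;
  form_comp : forall m n (P : 'rV[R]_n -> X) (h : 'rV[R]_m -> 'rV[R]_n) u v,
    plot X P -> smooth h ->
    w m (P \o h) u v = w n P (h u) (fun i => 'D_(v i) h u);
  form_linear : forall n (P : 'rV[R]_n -> X) u v i a x y, plot X P ->
    w n P u (upd v i (a *: x + y)) =
    a * w n P u (upd v i x) + w n P u (upd v i y);
  form_alternating : forall n (P : 'rV[R]_n -> X) u v i j, plot X P ->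
    i != j -> v i = v j -> w n P u v = 0 }.

Definition form_eq k X (w w' : diff_form k X) : Prop :=
  forall n (P : 'rV[R]_n -> X) u v, plot X P -> w n P u v = w' n P u v.

Definition zero_form k X : diff_form k X := fun _ _ _ _ => 0.
Definition add_form k X (w w' : diff_form k X) : diff_form k X :=
  fun n P u v => w n P u v + w' n P u v.
Definition sub_form k X (w w' : diff_form k X) : diff_form k X :=
  fun n P u v => w n P u v - w' n P u v.

Definition pullback k X Y (f : X -> Y) (w : diff_form k Y) : diff_form k X :=
  fun n P => w n (f \o P).

(* The exterior derivative in the Kobayashi-Nomizu convention, whence the factor
   1/(k+1); the bracket terms vanish since the v i are constant fields on R^n. *)
Definition ext_d k X (w : diff_form k X) : diff_form k.+1 X :=
  fun n P u v => k.+1%:R^-1 *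
    \sum_(i < k.+1) (-1) ^+ i *
      'D_(v i) (fun u' => w n P u' (fun j => v (lift i j)) : R) u.

(* Antisymmetrisation with the factor 1/k!: in the Kobayashi-Nomizu convention a
   wedge product is the antisymmetrised tensor product. *)
Definition alt (k : nat) (V : Type) (f : ('I_k -> V) -> R) (v : 'I_k -> V) : R :=
  k`!%:R^-1 * \sum_(s : 'S_k) (-1) ^+ s * f (fun i => v (s i)).

Definition fibre_power X Y (p : Y -> X) (k : nat) : pspace R :=
  @PSpace R ('I_k -> Y)
    (fun n => [set P : 'rV[R]_n -> ('I_k -> Y) |
                 (forall i, plot Y (fun u => P u i)) /\
                 (forall u i j, p (P u i) = p (P u j))]).

Definition face (T : Type) k (i : 'I_k.+1) (y : 'I_k.+1 -> T) : 'I_k -> T :=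
  fun j => y (lift i j).

Definition delta_form k X Y (p : Y -> X) m (w : diff_form k (fibre_power p m)) :
    diff_form k (fibre_power p m.+1) :=
  fun n P u v => \sum_(i < m.+1) (-1) ^+ i * w n (fun u' => face i (P u')) u v.

Definition U1 : pspace R :=
  @PSpace R R[i]
    (fun n => [set z : 'rV[R]_n -> R[i] |
                 [/\ forall u, `|z u| = 1,
                     smooth (fun u => complex.Re (z u) : R) &
                     smooth (fun u => complex.Im (z u) : R)]]).

Definition expi (t : R) : U1 := (cos t +i* sin t)%C.

Record u1_bundle M := U1Bundle {
  total : pspace R;
  bproj : total -> M;
  bact : total -> U1 -> total }.

Arguments bproj {M} u _.
Arguments bact {M} u _ _.

Record principal M (E : u1_bundle M) : Prop := Principal {
  principal_proj : smooth_map (bproj E);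
  principal_act : @smooth_map (prod_space (total E) U1) (total E)
    (fun ez => bact E ez.1 ez.2);
  principal_fibre : forall (e : total E) (z : U1), pts e -> pts z ->
    bproj E (bact E e z) = bproj E e;
  principal_act1 : forall e : total E, pts e -> bact E e (1 : R[i]) = e;
  principal_actM : forall (e : total E) (z w : U1), pts e -> pts z -> pts w ->
    bact E (bact E e z) w = bact E e ((z : R[i]) * w);
  principal_free : forall (e : total E) (z : U1), pts e -> pts z ->
    bact E e z = e -> z = (1 : R[i]);
  principal_trivial : forall x : M, pts x ->
    exists (O : set (dtop M)) (s : M -> total E) (c : total E -> U1),
      [/\ open O, O x, smooth_on O s /\ smooth_on (bproj E @^-1` O) c,
          forall y, pts y -> O y -> bproj E (s y) = y &
          forall e, pts e -> O (bproj E e) -> bact E (s (bproj E e)) (c e) = e] }.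

(* Lie(U(1)) = iR is identified with R by division by i: the connection takes
   the value 1 on the generator of the flow of multiplication by e^(it). *)
Record is_connection M (E : u1_bundle M) (A : diff_form 1 (total E)) : Prop :=
  IsConnection {
  connection_form : is_form A;
  connection_invariant : forall z : U1, pts z ->
    form_eq (pullback (fun e => bact E e z) A) A;
  connection_vertical : forall e : total E, pts e ->
    A 1%N (fun t : 'rV[R]_1 => bact E e (expi (t 0 0))) 0 (fun=> const_mx 1) = 1 }.

Definition is_curvature M (E : u1_bundle M) (A : diff_form 1 (total E))
    (F : diff_form 2 M) : Prop :=
  is_form F /\ form_eq (pullback (bproj E) F) (ext_d A).

(** The bundle [delta E] = d_0^*E (x) d_1^*E^* (x) d_2^*E (x) ... over the
    (m+1)-st fibre power.  A point over y is a tuple (e_i) with e_i in E over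
    d_i y, modulo the (z_i) in U(1)^(m+1) with z_0 z_1^-1 z_2 ... = 1 (the dual
    of E being E with the inverse action); it is represented by y and the
    equivalence class of (e_i). *)

Section DeltaBundle.
Context X Y (p : Y -> X) (m : nat) (E : u1_bundle (fibre_power p m)).

Definition tuple_space : pspace R :=
  @PSpace R (('I_m.+1 -> Y) * ('I_m.+1 -> total E))%type
    (fun n => [set P : 'rV[R]_n -> ('I_m.+1 -> Y) * ('I_m.+1 -> total E) |
    [/\ plot (fibre_power p m.+1) (fst \o P),
       forall i, plot (total E) (fun u => (P u).2 i) &
       forall u i, bproj E ((P u).2 i) = face i (P u).1]]).

Definition tensor_class (e : 'I_m.+1 -> total E) : set ('I_m.+1 -> total E) :=
  [set e' | exists z : 'I_m.+1 -> U1,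
    [/\ forall i, pts (z i),
        \prod_(i < m.+1) (if odd i then (z i : R[i])^-1 else z i) = 1 &
        e' = fun i => bact E (e i) (z i)]].

Definition delta_total : pspace R :=
  @PSpace R (('I_m.+1 -> Y) * set ('I_m.+1 -> total E))%type
    (fun n => [set P : 'rV[R]_n -> ('I_m.+1 -> Y) * set ('I_m.+1 -> total E) |
       forall u : 'rV[R]_n, exists2 Q, plot tuple_space Q &
       \forall u' \near u, P u' = ((Q u').1, tensor_class (Q u').2)]).

Definition tensor_quotient (ye : tuple_space) : delta_total :=
  (ye.1, tensor_class ye.2).

Definition delta_bundle : u1_bundle (fibre_power p m.+1) :=
  @U1Bundle (fibre_power p m.+1) delta_total fst
    (fun c z => (c.1, [set upd e ord0 (bact E (e ord0) z) | e in c.2])).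

Definition delta_section (s : fibre_power p m -> total E) :
    fibre_power p m.+1 -> total delta_bundle :=
  fun y => tensor_quotient (y, fun i => s (face i y)).

Definition delta_connection (A : diff_form 1 (total E))
    (A' : diff_form 1 (total delta_bundle)) : Prop :=
  is_connection A' /\
  form_eq (pullback tensor_quotient A' : diff_form 1 tuple_space)
    (fun n P u v => \sum_(i < m.+1) (-1) ^+ i * A n (fun u' => (P u').2 i) u v).

End DeltaBundle.

Record gerbe := Gerbe {
  gerbe_base : pspace R;
  gerbe_space : pspace R;
  gerbe_proj : gerbe_space -> gerbe_base;
  gerbe_bundle : u1_bundle (fibre_power gerbe_proj 2);
  gerbe_mult : fibre_power gerbe_proj 3 -> total (delta_bundle gerbe_bundle) }.

Arguments gerbe_proj : clear implicits.
Arguments gerbe_bundle : clear implicits.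
Arguments gerbe_mult : clear implicits.

(* The last clause is "delta (m) is the canonical section of delta^2 E": in
   delta^2 E every factor occurs together with its dual, and the canonical
   section is [delta (delta s)] for an arbitrary (set-theoretic) section s of
   E. *)
Record bundle_gerbe (B : gerbe) : Prop := BundleGerbe {
  bundle_gerbe_submersion : surjective_submersion (gerbe_proj B);
  bundle_gerbe_principal : principal (gerbe_bundle B);
  bundle_gerbe_smooth : smooth_map (gerbe_mult B);
  bundle_gerbe_section : forall y : fibre_power (gerbe_proj B) 3, pts y ->
    bproj (delta_bundle (gerbe_bundle B)) (gerbe_mult B y) = y;
  bundle_gerbe_canonical :
    forall s : fibre_power (gerbe_proj B) 2 -> total (gerbe_bundle B),
    (forall y, pts y -> pts (s y) /\ bproj (gerbe_bundle B) (s y) = y) ->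
    forall y : fibre_power (gerbe_proj B) 4, pts y ->
      delta_section (gerbe_mult B) y = delta_section (delta_section s) y }.

Definition gerbe_connection (B : gerbe) (A : diff_form 1 (total (gerbe_bundle B))) :
    Prop :=
  is_connection A /\
  exists2 A' : diff_form 1 (total (delta_bundle (gerbe_bundle B))),
    delta_connection A A' &
    form_eq (pullback (gerbe_mult B) A') (@zero_form 1 _).

Definition gerbe_curving (B : gerbe) (A : diff_form 1 (total (gerbe_bundle B)))
    (b : diff_form 2 (gerbe_space B)) : Prop :=
  is_form b /\
  is_curvature A (delta_form
    (pullback (fun y : fibre_power (gerbe_proj B) 1 => y ord0) b)).

Definition three_form_curvature (B : gerbe) (b : diff_form 2 (gerbe_space B))
    (H : diff_form 3 (gerbe_base B)) : Prop :=
  [/\ is_form H, form_eq (pullback (gerbe_proj B) H) (ext_d b) &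
      forall H' : diff_form 3 (gerbe_base B), is_form H' ->
        form_eq (pullback (gerbe_proj B) H') (ext_d b) -> form_eq H' H].

End SmoothSpaces.

Arguments pts {R} X _.

Record smooth_group (R : realType) := SmoothGroup {
  group_of :> groupType;
  group_plot : forall n, set ('rV[R]_n -> group_of);
  group_space := @PSpace R group_of group_plot;
  group_pts : forall x, pts group_space x;
  group_mul_smooth : @smooth_map R (prod_space group_space group_space)
    group_space (fun xy => xy.1 * xy.2)%g;
  group_inv_smooth : @smooth_map R group_space group_space
    (fun x : group_of => x^-1)%g }.

Section Topology.
Context {R : realType} (T : topologicalType).

Definition simply_connected : Prop :=
  (forall x y : T, exists f : R -> T,
     [/\ {within `[0, 1], continuous f}, f 0 = x & f 1 = y]) /\
  (forall f : R -> T, {within `[0, 1], continuous f} -> f 0 = f 1 ->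
     exists H : R * R -> T,
       [/\ {within `[0, 1] `*` `[0, 1], continuous H},
           forall t, t \in `[0, 1] -> H (0, t) = f t,
           forall t, t \in `[0, 1] -> H (1, t) = f 0 &
           forall s, s \in `[0, 1] -> H (s, 0) = f 0 /\ H (s, 1) = f 0]).

End Topology.

Arguments simply_connected R T : clear implicits.

(** The Lie algebra g = T_1 G is identified with R^d by means of a chart [phi]
    with [phi 0 = 1]. *)

Section LieGroup.
Context {R : realType} (G : smooth_group R) (d : nat) (phi : 'rV[R]_d -> G).

Definition coord (g : G) : 'rV[R]_d := xget 0 [set x | phi x = g].

Definition Ad (g : G) (y : 'rV[R]_d) : 'rV[R]_d :=
  'D_y (fun b => coord (g * phi b * g^-1)%g) 0.

Definition bracket (x y : 'rV[R]_d) : 'rV[R]_d :=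
  'D_x (fun a => Ad (phi a) y) 0.

Definition simple_lie_algebra : Prop :=
  (exists x y, bracket x y != 0) /\
  (forall I : {vspace 'rV[R]_d},
     (forall x y, y \in I -> bracket x y \in I) -> I = 0%VS \/ I = fullv).

Section BasicInnerProduct.
Variable ip : 'rV[R]_d -> 'rV[R]_d -> R.

Definition cartan (t : {vspace 'rV[R]_d}) : Prop :=
  forall x, x \in t <-> (forall y, y \in t -> bracket x y = 0).

(* [a] in t represents the root h |-> ip a h, with root vector x + iy in the
   complexification: [h, x + iy] = i (ip a h) (x + iy). *)
Definition root_of (t : {vspace 'rV[R]_d}) (a : 'rV[R]_d) : Prop :=
  [/\ a \in t, a != 0 &
      exists x y, (x, y) <> (0, 0) /\
        forall h, h \in t ->
          bracket h x = - (ip a h *: y) /\ bracket h y = ip a h *: x].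

Definition long_root_of (t : {vspace 'rV[R]_d}) (a : 'rV[R]_d) : Prop :=
  root_of t a /\ forall b, root_of t b -> ip b b <= ip a a.

Definition coroot (a : 'rV[R]_d) : 'rV[R]_d := (2 / ip a a) *: a.

Record basic_inner_product : Prop := BasicInnerProduct {
  ip_sym : forall x y, ip x y = ip y x;
  ip_linear : forall a x y z, ip (a *: x + y) z = a * ip x z + ip y z;
  ip_pos : forall x, x != 0 -> 0 < ip x x;
  ip_Ad : forall g x y, ip (Ad g x) (Ad g y) = ip x y;
  ip_norm : forall t a, cartan t -> long_root_of t a ->
    ip (coroot a) (coroot a) = 2 }.

End BasicInnerProduct.

(** An element of C^oo([0,2pi], G) is represented by its extension to R that is
    constant on both sides of [0,2pi].  The smooth maps R^n -> PG for the
    Frechet manifold structure of PG are the maps that are smooth as maps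
    R^n x [0,2pi] -> G (exponential law); likewise for OmegaG. *)

Definition clamp (t : R) : R := Num.max 0 (Num.min t (2 * pi)).

Definition path_plot n : set ('rV[R]_n -> (R -> G)) :=
  [set P : 'rV[R]_n -> (R -> G) |
    [/\ forall u, P u 0 = 1%g,
     forall u t, P u t = P u (clamp t) &
     smooth_within (X := group_space G)
       [set x : 'rV[R]_(n + 1) | 0 <= rsubmx x 0 0 <= 2 * pi]
       (fun x => P (lsubmx x) (rsubmx x 0 0))]].

Definition PG : pspace R := PSpace path_plot.

Definition OmegaG : pspace R :=
  @PSpace R (R -> G) (fun n =>
    [set P : 'rV[R]_n -> (R -> G) | path_plot P /\ forall u, P u (2 * pi) = 1%g]).

Definition ev (p : PG) : group_space G := p (2 * pi).

Definition path_mul (p q : R -> G) : R -> G := fun t => (p t * q t)%g.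

Variable ip : 'rV[R]_d -> 'rV[R]_d -> R.

Definition pairing (x y : 'rV[R]_d) : R := ip x y / (4 * pi).

Definition path_integral (f : R -> R) : R :=
  \int[lebesgue_measure]_(t in `[0, 2 * pi]) f t.

Definition Theta n (Q : 'rV[R]_n -> G) (u v : 'rV[R]_n) : 'rV[R]_d :=
  'D_v (fun u' => coord ((Q u)^-1 * Q u')%g) u.

Definition Theta_Theta n (Q : 'rV[R]_n -> G) (u v w : 'rV[R]_n) : 'rV[R]_d :=
  2^-1 *: (bracket (Theta Q u v) (Theta Q u w) -
           bracket (Theta Q u w) (Theta Q u v)).

Definition path_Theta n (P : 'rV[R]_n -> (R -> G)) (u v : 'rV[R]_n) (t : R) :
  'rV[R]_d := Theta (fun u' => P u' t) u v.

(* The value at the end points of [0,2pi] is irrelevant: [hat_phi] and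
   [derive1] are only used under the integral. *)
Definition hat_phi (p : R -> G) (t : R) : 'rV[R]_d :=
  derive1 (fun s => coord (p s * (p t)^-1)%g) t.

Definition path_two_form n (P : 'rV[R]_n -> (R -> G)) (u : 'rV[R]_n)
    (v : 'I_2 -> 'rV[R]_n) : R :=
  alt (fun w : 'I_2 -> 'rV[R]_n => path_integral (fun t =>
    pairing (path_Theta P u (w ord0) t)
            (derive1 (path_Theta P u (w ord_max)) t))) v.

Definition curvature_R : diff_form 2 OmegaG := path_two_form.

Definition curving_B : diff_form 2 PG := path_two_form.

Definition nu : diff_form 1 (prod_space OmegaG OmegaG) :=
  fun n P u v => 2 * path_integral (fun t =>
    pairing (path_Theta (fun u' => (P u').1) u (v ord0) t)
            (hat_phi (P u).2 t)).

Definition epsilon : diff_form 1 (prod_space PG OmegaG) :=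
  fun n P u v => 2 * path_integral (fun t =>
    pairing (path_Theta (fun u' => (P u').1) u (v ord0) t)
            (hat_phi (P u).2 t)).

Definition omega : diff_form 3 (group_space G) :=
  fun n Q u v => 6^-1 *
    alt (fun w : 'I_3 -> 'rV[R]_n =>
      pairing (Theta_Theta Q u (w ord0) (w (inord 1)))
              (Theta Q u (w ord_max))) v.

Section Extension.
Context (H : smooth_group R) (proj : H -> (R -> G)) (iota : @U1 R -> H).

Definition extension_bundle : u1_bundle OmegaG :=
  @U1Bundle R OmegaG (group_space H) proj (fun a z => (a * iota z)%g).

Record central_extension : Prop := CentralExtension {
  extension_frechet : frechet_manifold (group_space H);
  extension_projM : forall a b, proj (a * b)%g = path_mul (proj a) (proj b);
  extension_iotaM : forall z w : @U1 R, pts (@U1 R) z -> pts (@U1 R) w ->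
    iota ((z : R[i]) * w) = (iota z * iota w)%g;
  extension_central : forall (z : @U1 R) a, pts (@U1 R) z ->
    (iota z * a)%g = (a * iota z)%g;
  extension_principal : principal extension_bundle }.

Definition extension_square : pspace R :=
  prod_space (group_space H) (group_space H).
Definition extension_fst (ab : extension_square) : group_space H := ab.1.
Definition extension_snd (ab : extension_square) : group_space H := ab.2.
Definition extension_mul (ab : extension_square) : group_space H :=
  (ab.1 * ab.2)%g.
Definition extension_proj2 (ab : extension_square) : prod_space OmegaG OmegaG :=
  (proj ab.1, proj ab.2).

(* The level is not a separate hypothesis: the curvature of mu contains the Lie
   algebra cocycle of the extension, with [ip] the basic inner product. *)
Record extension_connection (mu : diff_form 1 (group_space H)) : Prop :=
  ExtensionConnection {
  extension_is_connection : is_connection (E := extension_bundle) mu;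
  extension_curvature : is_curvature (E := extension_bundle) mu curvature_R;
  extension_nu : form_eq
    (sub_form (add_form (pullback extension_fst mu) (pullback extension_snd mu))
              (pullback extension_mul mu))
    (pullback extension_proj2 nu) }.

Definition basic_bundle : u1_bundle (fibre_power ev 2) :=
  @U1Bundle R (fibre_power ev 2) (prod_space PG (group_space H))
    (fun e i => tnth [tuple e.1; path_mul e.1 (proj e.2)] i)
    (fun e z => (e.1, (e.2 * iota z)%g)).

(* The section of delta E corresponding to
   hat_eta (x) hat_gamma |-> hat_gamma hat_eta. *)
Definition basic_mult (y : fibre_power ev 3) :
    total (delta_bundle basic_bundle) :=
  (y, [set e | exists hat_gamma hat_eta : H,
    [/\ y (inord 1) = path_mul (y ord0) (proj hat_gamma),
        y ord_max = path_mul (y (inord 1)) (proj hat_eta) &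
        tensor_class (E := basic_bundle)
          (fun i => tnth [tuple (y (inord 1), hat_eta);
                                (y ord0, (hat_gamma * hat_eta)%g);
                                (y ord0, hat_gamma)] i) e]]).

Definition basic_gerbe : @gerbe R := Gerbe (gerbe_bundle := basic_bundle) basic_mult.

Definition basic_pr2 (e : total basic_bundle) : group_space H := e.2.
Definition basic_pi (e : total basic_bundle) : prod_space PG OmegaG :=
  (e.1, proj e.2).

Definition nabla (mu : diff_form 1 (group_space H)) :
    diff_form 1 (total basic_bundle) :=
  sub_form (pullback basic_pr2 mu) (pullback basic_pi epsilon).

End Extension.

End LieGroup.

Arguments nabla {R G d} phi ip {H} proj iota mu [n] _ _ _.

(* Main.v *)
Require Import Defs.
From HB Require Import structures.
From mathcomp Require Import all_boot all_order all_algebra all_fingroup.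
From mathcomp Require Import all_classical all_reals all_analysis.
From mathcomp Require Import complex.
From mathcomp Require Import measurable_realfun ring lra.

Set Implicit Arguments.
Unset Strict Implicit.
Unset Printing Implicit Defensive.

Import Order.TTheory GRing.Theory Num.Theory.
Import numFieldNormedType.Exports.
Local Open Scope classical_set_scope.
Local Open Scope ring_scope.

(** The forms in the statement are integrals over the time interval [0, 2 pi],
    and the proof rests on three identities between them.  Let p be a path, and
    let g and h be loops.

    - delta epsilon = nu, that is, epsilon (p g, h) - epsilon (p, g h) +
      epsilon (p, g) = nu (g, h) ([epsilon_cocycle]).  At each time this is the
      product rule for Theta and [hat_phi], together with the invariance of the
      inner product.
    - delta B = R - d epsilon ([curving_gauge]).  The densities of the two sides
      differ by a time derivative ([gauge_skew]) of a function that vanishes at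
      both ends, because g is a loop.
    - ev^* omega = dB ([curving_omega]).  By the Maurer--Cartan equation and the
      invariance, the density of dB is the time derivative of the trilinear form
      of [Theta, Theta] and Theta ([skew_cyclic]); the path starts at 1, so that
      only the value at the end point of the path remains.

    These give the theorem.  The multiplication over (p, p g, p g h) is
    represented by lifts at the pairs (p g, h), (p, g h) and (p, g), so the
    pullback of delta nabla is nu - delta epsilon = 0, where the first term comes
    from mu ([nabla_mult_data]).  The curvature of nabla is R - d epsilon, which is
    delta B.  Finally dB is the pullback of omega, and no other form has this
    pullback since plots of G lift locally to PG.

    The identities need some calculus.  Families of paths are smooth in the
    parameters and the time jointly, up to the end points ([adm]); their
    integrals are smooth in the parameters, with derivatives computed under the
    integral sign ([adm_integral_derive]).  The Lie algebra is treated in a chart at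
    the unit, where the bracket is the antisymmetrised second derivative of the
    group law ([bracket_mixed]); this yields the Maurer--Cartan equation
    ([maurer_cartan]).

    The connection that nabla induces on delta E is the alternating sum of its
    values on the factors.  It does not depend on the representing tuple
    ([tuple_form_lift]), because a connection changes by the logarithmic derivative
    of a gauge transformation ([gauge_plot]), which is proved along curves from the
    existence of logarithms of curves in U(1) ([circle_log]).

    As for the gerbe itself, the evaluation of paths is a surjective submersion
    since G is connected ([ev_surjective_submersion]), the bundle is a pullback of
    the central extension ([basic_principal]), and the multiplication is
    associative, which is its compatibility with the canonical section
    ([basic_canonical]), because the central extension is a group. *)

(** * Functions of class C^k *)

Section Calculus.
Context {R : realType}.
Implicit Types V W : normedModType R.

(** Derivatives are directional and no differential is assumed to exist, so
    homogeneity in the direction has to be read off the difference quotient. *)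
Lemma derivable_scale_dir V W (f : V -> W) x v a :
  derivable f x v ->
  derivable f x (a *: v) /\ 'D_(a *: v) f x = a *: 'D_v f x.
Proof.
move=> fv.
have [->|a0] := eqVneq a 0.
  by rewrite !scale0r derive0; split => //; exact: derivable0.
have key : h^-1 *: ((f \o shift x) (h *: (a *: v)) - f x) @[h --> 0^']
    --> a *: 'D_v f x.
  have h1 : (fun h : R => h^-1 *: ((f \o shift x) (h *: (a *: v)) - f x)) =
     (fun h => a *: ((h * a)^-1 *: ((f \o shift x) ((h * a) *: v) - f x))).
    apply/funext => h; rewrite [in RHS]scalerA invfM mulrCA divff// mulr1.
    by rewrite scalerA.
  rewrite h1; apply: cvgZr.
  have : (fun h : R => h * a) @ 0^' --> (0 : R)^'.
    move=> A /= [e /= e0 eA].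
    exists (e / `|a|) => /=; first by rewrite divr_gt0// normr_gt0.
    move=> h /=; rewrite sub0r normrN => he h0; apply: eA => /=.
      rewrite sub0r normrN normrM -ltr_pdivlMr ?normr_gt0//.
    by rewrite mulf_neq0.
  by move=> hc; exact: (cvg_comp _ _ hc fv).
split; first by apply/cvg_ex; eexists; exact: key.
exact: cvg_lim key.
Qed.

Lemma Ck_cont k V W (f : V -> W) : Ck k f -> continuous f.
Proof. by case: k => [|k] []. Qed.

Lemma CkW k V W (f : V -> W) : Ck k.+1 f -> Ck k f.
Proof.
elim: k f => [|k IH] f [cf [df Df]]; split => //; split => // v.
by apply: IH; exact: Df.
Qed.

Lemma smooth_derivable V W (f : V -> W) x v : smooth f -> derivable f x v.
Proof. by move=> sf; case: (sf 1%N) => _ [df _]; exact: df. Qed.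

Lemma smooth_continuous V W (f : V -> W) : smooth f -> continuous f.
Proof. by move=> /(_ 0%N)/Ck_cont. Qed.

Lemma smooth_derive V W (f : V -> W) v : smooth f -> smooth (fun x => 'D_v f x).
Proof. by move=> sf k; case: (sf k.+1) => _ [_ /(_ v)]. Qed.

Lemma Ck_ext k V W (f g : V -> W) : (forall x, f x = g x) -> Ck k f -> Ck k g.
Proof. by move=> /funext ->. Qed.

Lemma Ck_cst k V W (w : W) : Ck k (fun _ : V => w).
Proof.
elim: k w => [|k IH] w; split => //; try exact: cst_continuous.
split => [x v|v]; first exact: derivable_cst.
by apply: (Ck_ext _ (IH 0)) => x; rewrite derive_cst.
Qed.

Lemma Ck_add k V W (f g : V -> W) :
  Ck k f -> Ck k g -> Ck k (fun x => f x + g x).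
Proof.
elim: k f g => [|k IH] f g [cf df] [cg dg]; split.
- by move=> x; apply: cvgD; [exact: cf|exact: cg].
- by [].
- by move=> x; apply: cvgD; [exact: cf|exact: cg].
- case: df => df Df; case: dg => dg Dg; split => [x v|v].
    exact: derivableD.
  apply: (@Ck_ext _ _ _ (fun x => 'D_v f x + 'D_v g x)); last exact: IH (Df v) (Dg v).
  by move=> x; rewrite deriveD.
Qed.

Lemma Ck_scale k V W (f : V -> W) a : Ck k f -> Ck k (fun x => a *: f x).
Proof.
elim: k f => [|k IH] f [cf df]; split.
- by move=> x; apply: cvgZr; exact: cf.
- by [].
- by move=> x; apply: cvgZr; exact: cf.
- case: df => df Df; split => [x v|v]; first exact: derivableZ.
  apply: (@Ck_ext _ _ _ (fun x => a *: 'D_v f x)); last exact: IH (Df v).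
  by move=> x; rewrite deriveZ.
Qed.

Lemma Ck_sum k V W (I : Type) (r : seq I) (f : I -> V -> W) :
  (forall i, Ck k (f i)) -> Ck k (fun x => \sum_(i <- r) f i x).
Proof.
move=> cf; elim: r => [|i r IH].
  by apply: (Ck_ext _ (Ck_cst k V 0)) => x; rewrite big_nil.
apply: (@Ck_ext _ _ _ (fun x => f i x + \sum_(j <- r) f j x)).
  by move=> x; rewrite big_cons.
exact: Ck_add.
Qed.

Lemma Ck_mul k V (f g : V -> R) :
  Ck k f -> Ck k g -> Ck k (fun x => f x * g x).
Proof.
elim: k f g => [|k IH] f g Cf Cg; move: (Cf) (Cg) => [cf df] [cg dg].
  by split=> // x; apply: cvgM; [exact: cf|exact: cg].
split; first by move=> x; apply: cvgM; [exact: cf|exact: cg].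
case: df => df Df; case: dg => dg Dg; split => [x v|v]; first exact: derivableM.
apply: (@Ck_ext _ _ _ (fun x => f x * 'D_v g x + g x * 'D_v f x)).
  by move=> x; rewrite deriveM.
by apply: Ck_add; [exact: IH (CkW Cf) (Dg v)|exact: IH (CkW Cg) (Df v)].
Qed.

Lemma Ck_mx k V m n (f : V -> 'M[R]_(m, n)) :
  (forall i j, Ck k (fun x => f x i j)) <-> Ck k f.
Proof.
have cont (g : V -> 'M[R]_(m, n)) :
    (forall i j, continuous (fun x => g x i j)) <-> continuous g.
  split=> [cg x|cg i j x].
    apply/cvgrPdist_le => /= e e0; near=> y.
    rewrite /Num.Def.normr/= mx_normrE (bigmax_le _ (ltW e0))//= => i _.
    rewrite !mxE/=.
    move: i; near: y; apply: filter_forall => /= i.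
    exact: ((cvgrPdist_le _ _).1 (cg i.1 i.2 x)).
  apply: (@continuous_comp _ _ _ g (fun M : 'M[R]_(m, n) => M i j)); first exact: cg.
  exact: coord_continuous.
elim: k f => [|k IH] f; split.
- by move=> cf; split => //; apply/cont => i j; case: (cf i j).
- by case=> /cont cf _ i j; split => //; exact: cf.
- move=> cf; split; first by apply/cont => i j; case: (cf i j).
  have df x v : derivable f x v.
    by apply/derivable_mxP => i j; case: (cf i j) => _ [].
  split=> // v; apply/IH => i j.
  apply: (@Ck_ext _ _ _ (fun x => 'D_v (fun y => f y i j) x)).
    by move=> x; rewrite derive_mx// mxE.
  by case: (cf i j) => _ [_]; exact.
- case=> /cont cf [df Df] i j; split; first exact: cf.
  split=> [x v|v]; first by have /derivable_mxP := df x v.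
  apply: (@Ck_ext _ _ _ (fun x => 'D_v f x i j)).
    by move=> x; rewrite derive_mx// mxE.
  by move/IH : (Df v).
Unshelve. all: by end_near. Qed.

Lemma is_derive_line V W (f : V -> W) x v (s : R) :
  derivable f (x + s *: v) v ->
  is_derive s (1 : R) (fun s : R => f (x + s *: v)) ('D_v f (x + s *: v)).
Proof.
move=> dfs.
set g := fun s : R => _.
have key : h^-1 *: ((g \o shift s) (h *: (1 : R)) - g s) @[h --> 0^']
    --> 'D_v f (x + s *: v).
  rewrite /g /= (_ : (fun h => _) = fun h : R =>
     h^-1 *: ((f \o shift (x + s *: v)) (h *: v) - f (x + s *: v))).
    exact: dfs.
  apply/funext => h /=; congr (_ *: (f _ - f _)).
  by rewrite scalerDl [h *: 1]mulr1 addrCA.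
apply: DeriveDef; first by apply/cvg_ex; eexists; exact: key.
exact: cvg_lim key.
Qed.

(** The tool by which directional derivatives control increments. *)
Lemma mvt_line V (f : V -> R) x v : (forall y, derivable f y v) ->
  exists2 s, 0 <= s <= 1 & f (x + v) - f x = 'D_v f (x + s *: v).
Proof.
move=> df.
have dg (s : R) := is_derive_line (df (x + s *: v)).
have [|s s01 gE] := @MVT_segment R _ _ 0 1 ler01 (fun s _ => dg s).
  apply: continuous_subspaceT => s.
  by apply: differentiable_continuous; apply/derivable1_diffP; case: (dg s).
exists s; first by rewrite in_itv in s01.
by move: gE; rewrite scale1r scale0r addr0 subr0 mulr1.
Qed.

Lemma near_forallI (T : Type) (I : finType) (F : set_system T) {FF : Filter F}
    (P : I -> T -> Prop) :
  (forall i, \forall y \near F, P i y) -> \forall y \near F, forall i, P i y.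
Proof. exact: filter_forall. Qed.

Lemma delta_rV_norm n (i : 'I_n) (h : 'rV[R]_n) : `|h 0 i| <= `|h|.
Proof.
rewrite [leRHS]/Num.Def.normr/= mx_normrE.
exact: (le_trans _ (@le_bigmax _ _ _ _ (fun ij => `|h ij.1 ij.2|) (0, i))).
Qed.

(** The class C^1 is given by directional derivatives only.  The increment of [f]
    is telescoped along the coordinate axes; each step is an instance of the mean
    value theorem, and continuity of the partial derivatives bounds the error. *)
Lemma C1_differentiable n (f : 'rV[R]_n -> R) x : Ck 1 f -> differentiable f x.
Proof.
move=> [cf [df Df]].
have cDf v : continuous (fun x => 'D_v f x) by case: (Df v).
pose e i : 'rV[R]_n := delta_mx 0 i.
pose L (h : 'rV[R]_n) : R := \sum_(i < n) h 0 i * 'D_(e i) f x.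
have linL : linear L.
  move=> a u w; rewrite /L scaler_sumr -big_split; apply: eq_bigr => i _ /=.
  by rewrite !mxE mulrDl scalerAl.
pose Lm : {linear 'rV[R]_n -> R} :=
  HB.pack L (GRing.isLinear.Build _ _ _ _ L linL).
have cL : continuous Lm.
  suff : Ck 0 L by case.
  apply: Ck_sum => i; apply: Ck_mul; last exact: Ck_cst.
  by split=> // y; exact: coord_continuous.
(* The first [k] coordinates of [h]. *)
pose tr k (h : 'rV[R]_n) : 'rV[R]_n := \row_i (if (i < k)%N then h 0 i else 0).
have tr0 h : tr 0%N h = 0 by apply/rowP => i; rewrite !mxE.
have trn h : tr n h = h by apply/rowP => i; rewrite !mxE ltn_ord.
have trS (k : 'I_n) h : tr k.+1 h = tr k h + h 0 k *: e k.
  apply/rowP => i; rewrite !mxE eqxx/= ltnS leq_eqVlt.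
  have [->|ik] := eqVneq i k; first by rewrite eqxx ltnn mulr1 add0r.
  by rewrite (negbTE (_ : (i : nat) != k)) ?mulr0 ?addr0.
have step (k : 'I_n) h : exists2 s, 0 <= s <= 1 &
    f (x + tr k.+1 h) - f (x + tr k h) =
    h 0 k * 'D_(e k) f (x + (tr k h + s *: (h 0 k *: e k))).
  have dk y : derivable f y (h 0 k *: e k) by exact: df.
  have [s s01 sE] := mvt_line (x + tr k h) dk.
  exists s => //; rewrite trS !addrA sE.
  by have [_ ->] := derivable_scale_dir (h 0 k) (df (x + tr k h + s *: (h 0 k *: e k)) (e k)).
have bnd (k : 'I_n) h s : 0 <= s <= 1 ->
    `|tr k h + s *: (h 0 k *: e k)| <= `|h|.
  move=> /andP[s0 s1]; rewrite [leLHS]/Num.Def.normr/= mx_normrE.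
  apply: bigmax_le => //= -[i0 i] _ /=.
  rewrite !mxE (ord1 i0) eqxx /=; have [->|ik] := eqVneq i k.
    rewrite ltnn add0r mulr1 normrM ger0_norm//.
    by rewrite (le_trans _ (delta_rV_norm k h))// ler_piMl.
  by rewrite mulr0 mulr0 addr0; case: ifP => _; rewrite ?normr0 ?delta_rV_norm.
have tele h : f (x + h) - f x = \sum_(k < n) (f (x + tr k.+1 h) - f (x + tr k h)).
  rewrite -(big_mkord xpredT (fun k => f (x + tr k.+1 h) - f (x + tr k h))).
  by rewrite telescope_sumr// tr0 trn addr0.
have key : f \o shift x = cst (f x) + L +o_ (0 : 'rV[R]_n) id.
  apply/eqaddoP => _/posnumP[eps].
  have : \forall y \near x, forall k : 'I_n,
      `|'D_(e k) f x - 'D_(e k) f y| <= eps%:num / (n.+1)%:R.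
    refine (near_forallI (F := nbhs x) (P := fun k y =>
      `|'D_(e k) f x - 'D_(e k) f y| <= eps%:num / (n.+1)%:R) _) => k.
    by move/cvgrPdist_le : (cDf (e k) x); apply; rewrite divr_gt0.
  move=> /nbhs_ballP[d /= d0 dP].
  apply/nbhs_ballP; exists d => //= h; rewrite -ball_normE /= sub0r normrN => hd.
  rewrite !fctE /= opprD addrA [h + x]addrC tele /L -sumrB.
  apply: (@le_trans _ _ (\sum_(k < n) (eps%:num / n.+1%:R * `|h|))).
    apply: le_trans (ler_norm_sum _ _ _) _; apply: ler_sum => k _.
    have [s s01 ->] := step k h.
    rewrite -mulrBr normrM mulrC ler_pM ?delta_rV_norm// distrC.
    apply: dP; rewrite -ball_normE /= opprD addNKr normrN.
    exact: le_lt_trans (bnd k h s s01) hd.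
  rewrite sumr_const card_ord -[leLHS]mulr_natl mulrA ler_wpM2r// mulrCA.
  by rewrite ler_piMr// ler_pdivrMr// mul1r ler_nat.
have dL := @diff_unique R _ _ f Lm x cL key.
apply/diff_locallyP; rewrite dL; split => //.
Qed.

End Calculus.
Arguments smooth_derivable {R V W f} x v _.
Arguments smooth_continuous {R V W f} _ x.
Arguments Ck_cont {R k V W f} _ x.

(** * The chain rule and the symmetry of second derivatives *)

Section ChainRule.
Context {R : realType}.
Implicit Types V W : normedModType R.

Lemma C1_differentiable_mx n p q (f : 'rV[R]_n -> 'M[R]_(p, q)) x :
  Ck 1 f -> differentiable f x.
Proof.
move=> /Ck_mx Cf.
have -> : f = fun y => \sum_(ij : 'I_p * 'I_q) f y ij.1 ij.2 *: delta_mx ij.1 ij.2.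
  apply/funext => y; rewrite [LHS]matrix_sum_delta.
  by rewrite (pair_big xpredT xpredT (fun i j => f y i j *: delta_mx i j)).
rewrite (_ : (fun y => _) = \sum_(ij : 'I_p * 'I_q)
    (fun y => f y ij.1 ij.2 *: (delta_mx ij.1 ij.2 : 'M[R]_(p, q)))); last first.
  by apply/funext => y; rewrite fct_sumE.
apply: (big_ind (fun g => differentiable g x)).
- exact: differentiable_cst.
- by move=> g h dg dh; exact: differentiableD.
- by move=> ij _; apply: differentiableZl; exact: C1_differentiable (Cf _ _).
Qed.

(** A directional derivative is the derivative of the restriction to a line, so
    this reduces to the composition of differentiable functions. *)
Lemma is_derive_chain V V' W (f : V' -> W) (g : V -> V') x v dg :
  differentiable f (g x) -> is_derive x v g dg ->
  is_derive x v (f \o g) ('d f (g x) dg).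
Proof.
move=> df Dg.
have g1 : derivable g x v by case: Dg.
have D0 : derivable (fun s : R => g (x + s *: v)) 0 1.
  have := @is_derive_line R _ _ g x v 0; rewrite scale0r addr0 => /(_ g1).
  by case.
have E0 : 'D_1 (fun s : R => g (x + s *: v)) 0 = dg.
  have := @is_derive_line R _ _ g x v 0; rewrite scale0r addr0 => /(_ g1).
  by case=> _ ->; case: Dg.
have dG : differentiable (fun s : R => g (x + s *: v)) 0.
  exact/derivable1_diffP.
have df' : differentiable f (g (x + 0 *: v)) by rewrite scale0r addr0.
have dfg : differentiable (f \o (fun s : R => g (x + s *: v))) 0.
  exact: differentiable_comp.
have key : is_derive (0 : R) (1 : R) (f \o (fun s : R => g (x + s *: v)))
   ('d f (g x) dg).
  apply: DeriveDef; first exact: diff_derivable.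
  rewrite (deriveE _ dfg) (diff_comp dG df') /= -(deriveE _ dG) E0.
  by rewrite scale0r addr0.
have qE : (fun h : R => h^-1 *: (((f \o (fun s : R => g (x + s *: v))) \o shift 0) (h *: (1 : R)) - (f \o (fun s : R => g (x + s *: v))) 0)) =
   (fun h : R => h^-1 *: (((f \o g) \o shift x) (h *: v) - (f \o g) x)).
  apply/funext => h /=; rewrite scale0r !addr0.
  by rewrite [h *: 1]mulr1 [x + _]addrC.
case: key => k1 k2.
apply: DeriveDef; first by rewrite /derivable -qE.
by rewrite /derive -qE.
Qed.

Lemma derive_chain V n W (f : 'rV[R]_n -> W) (g : V -> 'rV[R]_n) x v :
  differentiable f (g x) -> derivable g x v ->
  'D_v (fun y => f (g y)) x = 'D_('D_v g x) f (g x).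
Proof.
move=> df dg.
have [_ ->] := is_derive_chain df (derivableP dg).
by rewrite (deriveE _ df).
Qed.

Lemma derive_dirD V W (f : V -> W) x u w a : differentiable f x ->
  'D_(a *: u + w) f x = a *: 'D_u f x + 'D_w f x.
Proof. by move=> df; rewrite !(deriveE _ df) linearP. Qed.

Lemma derive_dir_sum n W (f : 'rV[R]_n -> W) x v : differentiable f x ->
  'D_v f x = \sum_(i < n) v 0 i *: 'D_(delta_mx 0 i) f x.
Proof.
move=> df; rewrite (deriveE _ df) {1}(row_sum_delta v) linear_sum.
by apply: eq_bigr => i _; rewrite linearZ/= (deriveE _ df).
Qed.

Lemma derive_coord V m n (f : V -> 'M[R]_(m, n)) x v i j :
  derivable f x v -> 'D_v f x i j = 'D_v (fun y => f y i j) x.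
Proof. by move=> df; rewrite derive_mx// mxE. Qed.

Lemma Ck_coord k m n i j : Ck k (fun x : 'M[R]_(m, n) => x i j).
Proof.
case: k => [|k]; first by split => // x; exact: coord_continuous.
split; first by move=> x; exact: coord_continuous.
split=> [x v|v].
  by have /derivable_mxP := @derivable_id _ 'M[R]_(m, n) x v; exact.
apply: (Ck_ext _ (Ck_cst k _ (v i j))) => x.
by rewrite -(derive_coord _ _ (@derivable_id _ _ x v)) derive_id.
Qed.

(** By induction on [k]: the derivative of the composition is the sum of the
    products of [(D_v g)_i] and [(D_i f) \o g], all of class C^k. *)
Lemma Ck_comp k n V (f : 'rV[R]_n -> R) (g : V -> 'rV[R]_n) :
  Ck k f -> Ck k g -> Ck k (fun x => f (g x)).
Proof.
elim: k f g => [|k IH] f g Cf Cg.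
  split => // x; apply: continuous_comp; first exact: (Ck_cont Cg).
  exact: (Ck_cont Cf).
have C1f : Ck 1 f by elim: (k) Cf => // k' IHk /CkW.
have df y : differentiable f y := C1_differentiable y C1f.
case: (Cg) => _ [dg Dg].
split.
  by move=> x; apply: continuous_comp; [exact: (Ck_cont Cg)|exact: (Ck_cont Cf)].
split=> [x v|v].
  by have [] := is_derive_chain (df (g x)) (derivableP (dg x v)).
apply: (@Ck_ext _ _ _ _ (fun x => \sum_(i < n) 'D_v g x 0 i * 'D_(delta_mx 0 i) f (g x))).
  by move=> x; rewrite derive_chain// derive_dir_sum.
apply: Ck_sum => i; apply: Ck_mul.
  by have /Ck_mx := Dg v; exact.
case: Cf => _ [_ Df].
exact: (IH (fun y => 'D_(delta_mx 0 i) f y) g (Df _) (CkW Cg)).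
Qed.

Lemma Ck_comp_mx k n V p q (f : 'rV[R]_n -> 'M[R]_(p, q)) (g : V -> 'rV[R]_n) :
  Ck k f -> Ck k g -> Ck k (fun x => f (g x)).
Proof.
move=> /Ck_mx Cf Cg; apply/Ck_mx => i j.
exact: (Ck_comp (Cf i j) Cg).
Qed.

Lemma Ck_row_mx k V p q1 q2 (f : V -> 'M[R]_(p, q1)) (g : V -> 'M[R]_(p, q2)) :
  Ck k f -> Ck k g -> Ck k (fun x => row_mx (f x) (g x)).
Proof.
move=> /Ck_mx Cf /Ck_mx Cg; apply/Ck_mx => i j.
case: (split_ordP j) => j' ->.
  by apply: (Ck_ext _ (Cf i j')) => x; rewrite row_mxEl.
by apply: (Ck_ext _ (Cg i j')) => x; rewrite row_mxEr.
Qed.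

Lemma Ck_linear k n p q (f : {linear 'rV[R]_n -> 'M[R]_(p, q)}) : Ck k f.
Proof.
apply/Ck_mx => i j.
apply: (@Ck_ext _ _ _ _ (fun x : 'rV[R]_n => \sum_(l < n) x 0 l * f (delta_mx 0 l) i j)).
  move=> x; rewrite {2}(row_sum_delta x) linear_sum summxE.
  by apply: eq_bigr => l _; rewrite linearZ mxE.
by apply: Ck_sum => l; apply: Ck_mul; [exact: Ck_coord|exact: Ck_cst].
Qed.

Lemma near_near (T : topologicalType) (x : T) (P : T -> Prop) :
  (\forall y \near x, P y) -> \forall y \near x, \forall z \near y, P z.
Proof. by move=> /nbhs_interior. Qed.

Lemma near_continuous (T U : topologicalType) (f g : T -> U) x :
  (\forall y \near x, f y = g y) -> continuous_at x g -> continuous_at x f.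
Proof.
move=> fg cg; rewrite /continuous_at (nbhs_singleton fg).
apply: cvg_trans cg; apply: near_eq_cvg.
by near=> y; apply/esym; near: y.
Unshelve. all: by end_near. Qed.

Lemma Ck_local k V W (f : V -> W) :
  (forall x : V, exists2 g : V -> W, Ck k g & \forall y \near x, f y = g y) -> Ck k f.
Proof.
elim: k f => [|k IH] f fg.
  split => // x; have [g Cg xfg] := fg x.
  exact: near_continuous xfg (Ck_cont Cg x).
split.
  move=> x; have [g Cg xfg] := fg x.
  exact: near_continuous xfg (Ck_cont Cg x).
split=> [x v|v].
  have [g [_ [Cg _]] xfg] := fg x; apply: near_eq_derivable (Cg x v).
  by near=> y; apply/esym; near: y.
apply: IH => x; have [g [_ [_ Dg]] xfg] := fg x.
exists (fun y => 'D_v g y); first exact: Dg.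
by near=> y; apply: near_eq_derive; near: y; exact: near_near.
Unshelve. all: by end_near. Qed.

Lemma is_derive_shift V W (f : V -> W) (x c u : V) : derivable f (x + c) u ->
  is_derive x u (fun y => f (y + c)) ('D_u f (x + c)).
Proof.
move=> dfu.
have E : (fun k : R => k^-1 *: (((fun y => f (y + c)) \o shift x) (k *: u) - f (x + c))) =
    (fun k : R => k^-1 *: ((f \o shift (x + c)) (k *: u) - f (x + c))).
  by apply/funext => k /=; rewrite addrA.
by apply: DeriveDef; rewrite ?/derivable ?/derive E.
Qed.

Lemma subrBBCA (a b c e : R) : (a - b) - (c - e) = (a - c) - (b - e).
Proof. by ring. Qed.

(** Two applications of the mean value theorem identify the second difference of
    [f] along [w] and [v], divided by h^2, with a mixed second derivative at a
    nearby point; this can be done in either order. *)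
Lemma Ck2_schwarz V (f : V -> R) x v w :
  Ck 2 f -> 'D_v (fun y => 'D_w f y) x = 'D_w (fun y => 'D_v f y) x.
Proof.
move=> [cf [df Df]].
have dD u y z : derivable (fun y => 'D_u f y) y z by case: (Df u) => _ [].
have cDD u z : continuous (fun y => 'D_z (fun y => 'D_u f y) y).
  by case: (Df u) => _ [_ /(_ z)[]].
(* the second difference is a second derivative at an intermediate point *)
have sd a b (h : R) : h != 0 -> exists s t, [/\ 0 <= s <= 1, 0 <= t <= 1 &
    (f (x + h *: a + h *: b) - f (x + h *: a)) - (f (x + h *: b) - f x) =
    h ^+ 2 * 'D_b (fun y => 'D_a f y) (x + s *: (h *: a) + t *: (h *: b))].
  move=> h0.
  pose g y := f (y + h *: b) - f y.
  have dshift y u : is_derive y u (fun y => f (y + h *: b)) ('D_u f (y + h *: b)).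
    exact: is_derive_shift (df _ _).
  have dg y u : is_derive y u g ('D_u f (y + h *: b) - 'D_u f y).
    by apply: is_deriveB.
  have dg' y : derivable g y (h *: a) by case: (dg y (h *: a)).
  have [s s01 sE] := mvt_line x dg'.
  have dk y : derivable (fun y => 'D_a f y) y (h *: b) by exact: dD.
  have [t t01 tE] := mvt_line (x + s *: (h *: a)) dk.
  exists s, t; split => //.
  rewrite -/(g (x + h *: a)) -/(g x) sE.
  have [_ ->] := derivable_scale_dir h (@ex_derive _ _ _ _ _ _ _ (dg (x + s *: (h *: a)) a)).
  have [_ ->] := dg (x + s *: (h *: a)) a.
  rewrite tE; have [_ ->] := derivable_scale_dir h (dD a (x + s *: (h *: a) + t *: (h *: b)) b).
  by rewrite /GRing.scale/= expr2 mulrA.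
have lim_ a b (e : R) : 0 < e -> \forall h \near (0 : R), forall s t, 0 <= s <= 1 -> 0 <= t <= 1 ->
    `|'D_b (fun y => 'D_a f y) x - 'D_b (fun y => 'D_a f y) (x + s *: (h *: a) + t *: (h *: b))| <= e.
  move=> e0; have /cvgrPdist_le/(_ _ e0)/nbhs_ballP[r /= r0 rP] := @cDD a b x.
  have M0 : 0 < `|a| + `|b| + 1 by rewrite ltr_wpDl// addr_ge0.
  apply/nbhs_ballP; exists (r / (`|a| + `|b| + 1)) => /=; first by rewrite divr_gt0.
  move=> h; rewrite -ball_normE /= sub0r normrN ltr_pdivlMr// => hr s t /andP[s0 s1] /andP[t0 t1].
  apply: rP; rewrite -ball_normE /= -addrA opprD addNKr normrN.
  apply: le_lt_trans hr; apply: le_trans (ler_normD _ _) _.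
  rewrite !normrZ (ger0_norm s0) (ger0_norm t0) !mulrDr mulr1.
  rewrite -addrA lerD//; first by rewrite ler_piMl// mulr_ge0.
  by rewrite ler_wpDr// ler_piMl// mulr_ge0.
have close a b (e : R) : 0 < e -> \forall h \near (0 : R)^', exists d : R,
    (f (x + h *: a + h *: b) - f (x + h *: a)) - (f (x + h *: b) - f x) =
      h ^+ 2 * d /\ `|'D_b (fun y => 'D_a f y) x - d| <= e.
  move=> e0; near=> h.
  have h0 : h != 0 by near: h; exact: nbhs_dnbhs_neq.
  have [s [t [s01 t01 E1]]] := sd a b h h0.
  eexists; split; first exact: E1.
  move: s t s01 t01 {E1}; near: h; apply: nbhs_dnbhs; exact: lim_.
move: (close w v) (close v w).
move: ('D_v (fun y => 'D_w f y) x) ('D_w (fun y => 'D_v f y) x) => D1 D2 cl1 cl2.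
apply/eqP; rewrite -subr_eq0 -normr_le0; apply/ler_addgt0Pl => e e0.
have e2 : 0 < e / 2 by rewrite divr_gt0.
rewrite addr0.
have : \forall h \near (0 : R)^', `|D1 - D2| <= e.
  near=> h.
  have h0 : h != 0 by near: h; exact: nbhs_dnbhs_neq.
  have [d1 [E1 L1]] : exists d : R,
      (f (x + h *: w + h *: v) - f (x + h *: w)) - (f (x + h *: v) - f x) =
      h ^+ 2 * d /\ `|D1 - d| <= e / 2 by near: h; exact: cl1.
  have [d2 [E2 L2]] : exists d : R,
      (f (x + h *: v + h *: w) - f (x + h *: v)) - (f (x + h *: w) - f x) =
      h ^+ 2 * d /\ `|D2 - d| <= e / 2 by near: h; exact: cl2.
  have EE : d1 = d2.
    apply: (@mulfI _ (h ^+ 2)); first by rewrite expf_neq0.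
    by rewrite -E1 -E2 (addrAC x) subrBBCA.
  rewrite EE in L1; rewrite distrC in L2.
  rewrite (splitr e) -(subrKA d2).
  by apply: le_trans (ler_normD _ _) _; rewrite lerD.
by move=> /filter_ex[].
Unshelve. all: by end_near. Qed.

End ChainRule.

(** * Smooth maps and the Leibniz rule *)

Section Smooth.
Context {R : realType}.
Implicit Types V W : normedModType R.

Lemma smooth_cst V W (w : W) : smooth (fun _ : V => w).
Proof. by move=> k; exact: Ck_cst. Qed.
Lemma smooth_add V W (f g : V -> W) :
  smooth f -> smooth g -> smooth (fun x => f x + g x).
Proof. by move=> sf sg k; exact: Ck_add. Qed.
Lemma smooth_opp V W (f : V -> W) : smooth f -> smooth (fun x => - f x).
Proof.
move=> sf k; apply: (Ck_ext _ (Ck_scale (-1) (sf k))) => x.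
by rewrite scaleN1r.
Qed.
Lemma smooth_mul V (f g : V -> R) :
  smooth f -> smooth g -> smooth (fun x => f x * g x).
Proof. by move=> sf sg k; exact: Ck_mul. Qed.
Lemma smooth_sum V W (I : Type) (r : seq I) (f : I -> V -> W) :
  (forall i, smooth (f i)) -> smooth (fun x => \sum_(i <- r) f i x).
Proof. by move=> sf k; apply: Ck_sum => i; exact: sf. Qed.
Lemma smooth_mx V m n (f : V -> 'M[R]_(m, n)) :
  smooth f <-> (forall i j, smooth (fun x => f x i j)).
Proof.
split=> [sf i j k|sf k]; last by apply/Ck_mx => i j; exact: sf.
by have /Ck_mx := sf k; exact.
Qed.
Lemma smooth_coord m n i j : smooth (fun x : 'M[R]_(m, n) => x i j).
Proof. by move=> k; exact: Ck_coord. Qed.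
Lemma smooth_id m n : smooth (fun x : 'M[R]_(m, n) => x).
Proof. by apply/smooth_mx => i j; exact: smooth_coord. Qed.
Lemma smooth_comp n V (f : 'rV[R]_n -> R) (g : V -> 'rV[R]_n) :
  smooth f -> smooth g -> smooth (fun x => f (g x)).
Proof. by move=> sf sg k; exact: Ck_comp. Qed.
Lemma smooth_comp_mx n V p q (f : 'rV[R]_n -> 'M[R]_(p, q)) (g : V -> 'rV[R]_n) :
  smooth f -> smooth g -> smooth (fun x => f (g x)).
Proof. by move=> sf sg k; exact: Ck_comp_mx. Qed.
Lemma smooth_row_mx V p q1 q2 (f : V -> 'M[R]_(p, q1)) (g : V -> 'M[R]_(p, q2)) :
  smooth f -> smooth g -> smooth (fun x => row_mx (f x) (g x)).
Proof. by move=> sf sg k; exact: Ck_row_mx. Qed.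
Lemma smooth_linear n p q (f : {linear 'rV[R]_n -> 'M[R]_(p, q)}) : smooth f.
Proof. by move=> k; exact: Ck_linear. Qed.
Lemma smooth_lsubmx n m : smooth (fun x : 'rV[R]_(n + m) => lsubmx x).
Proof. exact: smooth_linear. Qed.
Lemma smooth_rsubmx n m : smooth (fun x : 'rV[R]_(n + m) => rsubmx x).
Proof. exact: smooth_linear. Qed.
Lemma smooth_local V W (f : V -> W) :
  (forall x : V, exists2 g : V -> W, smooth g & \forall y \near x, f y = g y) ->
  smooth f.
Proof.
by move=> fg k; apply: Ck_local => x; have [g sg ?] := fg x; exists g.
Qed.
Lemma smooth_diff n (f : 'rV[R]_n -> R) x : smooth f -> differentiable f x.
Proof. by move=> sf; exact: C1_differentiable. Qed.
Lemma smooth_diff_mx n p q (f : 'rV[R]_n -> 'M[R]_(p, q)) x :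
  smooth f -> differentiable f x.
Proof. by move=> sf; exact: C1_differentiable_mx. Qed.

Lemma derive_row_mx V q1 q2 (f : V -> 'rV[R]_q1) (g : V -> 'rV[R]_q2) x v :
  derivable f x v -> derivable g x v ->
  derivable (fun y => row_mx (f y) (g y)) x v /\
  'D_v (fun y => row_mx (f y) (g y)) x = row_mx ('D_v f x) ('D_v g x).
Proof.
move=> df dg.
have d : derivable (fun y => row_mx (f y) (g y)) x v.
  apply/derivable_mxP => i j; case: (split_ordP j) => j' ->.
    rewrite (_ : (fun y => _) = fun y => f y i j').
      by move/derivable_mxP : df; exact.
    by apply/funext => y; rewrite row_mxEl.
  rewrite (_ : (fun y => _) = fun y => g y i j').
    by move/derivable_mxP : dg; exact.
  by apply/funext => y; rewrite row_mxEr.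
split=> //; apply/rowP => j; rewrite derive_coord//.
case: (split_ordP j) => j' ->; rewrite ?row_mxEl ?row_mxEr derive_coord//;
  by congr ('D_v _ x); apply/funext => y; rewrite ?row_mxEl ?row_mxEr.
Qed.

Lemma smooth_schwarz V n m (f : V -> 'M[R]_(n, m)) x v w : smooth f ->
  'D_v (fun y => 'D_w f y) x = 'D_w (fun y => 'D_v f y) x.
Proof.
move=> sf; apply/matrixP => i j.
have sD u : smooth (fun y => 'D_u f y) := smooth_derive u sf.
have E u : (fun y => 'D_u f y i j) = (fun y => 'D_u (fun z => f z i j) y).
  by apply/funext => y; exact: derive_coord (smooth_derivable y u sf).
have E2 u u' : ('D_u (fun y => 'D_u' f y) x) i j =
    'D_u (fun y => 'D_u' (fun z => f z i j) y) x.
  by rewrite -(E u'); exact: derive_coord (smooth_derivable x u (sD u')).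
transitivity ('D_v (fun y => 'D_w (fun z => f z i j) y) x); first exact: E2.
transitivity ('D_w (fun y => 'D_v (fun z => f z i j) y) x); last exact/esym/E2.
apply: Ck2_schwarz.
by have /smooth_mx := sf; exact.
Qed.

(** A bilinear expression [G y (z y)], linear in [z y], is expanded in the
    coordinates of [z y]; the Leibniz rule then needs no topology on the space of
    linear maps. *)
Lemma bilin_expand n p q (L : 'rV[R]_n -> 'M[R]_(p, q)) (z : 'rV[R]_n) :
  linear L -> L z = \sum_(i < n) z 0 i *: L (delta_mx 0 i).
Proof.
move=> linL.
pose Lm : {linear 'rV[R]_n -> 'M[R]_(p, q)} :=
  HB.pack L (GRing.isLinear.Build _ _ _ _ L linL).
rewrite -[L]/(Lm : _ -> _) {1}(row_sum_delta z) linear_sum.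
by apply: eq_bigr => i _; rewrite linearZ.
Qed.

Lemma derivable_coord V p q (f : V -> 'M[R]_(p, q)) x v i j :
  derivable f x v -> derivable (fun y => f y i j) x v.
Proof. by move=> /derivable_mxP /(_ i j). Qed.
Arguments derivable_coord {V p q f x v} i j _.

Lemma is_derive_scale_mx V p q (k : V -> R) (f : V -> 'M[R]_(p, q)) x v dk df :
  is_derive x v k dk -> is_derive x v f df ->
  is_derive x v (fun y => k y *: f y) (dk *: f x + k x *: df).
Proof.
move=> [k1 k2] [f1 f2].
have E i j : (fun y => (k y *: f y) i j) = fun y => k y * f y i j.
  by apply/funext => y; rewrite mxE.
have dE i j : derivable (fun y => k y * f y i j) x v.
  by apply: derivableM; [exact: k1|exact: (derivable_coord i j f1)].
have d : derivable (fun y => k y *: f y) x v.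
  by apply/derivable_mxP => i j; rewrite E; exact: dE.
apply: DeriveDef; first exact: d.
apply/matrixP => i j; rewrite (derive_coord i j d) E.
rewrite (deriveM k1 (derivable_coord i j f1)) k2 -(derive_coord i j f1) f2.
by rewrite !mxE [RHS]addrC; congr (_ + _); exact: mulrC.
Qed.

Lemma is_derive_sum_mx V p q n (f : 'I_n -> V -> 'M[R]_(p, q)) x v df :
  (forall i, is_derive x v (f i) (df i)) ->
  is_derive x v (fun y => \sum_(i < n) f i y) (\sum_(i < n) df i).
Proof.
move=> Df.
rewrite (_ : (fun y => _) = \sum_(i < n) f i); last first.
  by apply/funext => y; rewrite fct_sumE.
have d i : derivable (f i) x v by case: (Df i).
apply: DeriveDef; first exact: derivable_sum.
by rewrite derive_sum//; apply: eq_bigr => i _; case: (Df i).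
Qed.

Lemma is_derive_bilin V n p q (G : V -> 'rV[R]_n -> 'M[R]_(p, q))
    (z : V -> 'rV[R]_n) x v :
  (forall y, linear (G y)) -> (forall e, derivable (fun y => G y e) x v) ->
  derivable z x v ->
  is_derive x v (fun y => G y (z y))
    ('D_v (fun y => G y (z x)) x + G x ('D_v z x)).
Proof.
move=> linG dG dz.
have E w : (fun y => G y (w y)) =
    fun y => \sum_(i < n) w y 0 i *: G y (delta_mx 0 i).
  by apply/funext => y; exact: bilin_expand.
have D1 : 'D_v (fun y => G y (z x)) x =
    \sum_(i < n) z x 0 i *: 'D_v (fun y => G y (delta_mx 0 i)) x.
  rewrite (E (fun=> z x)); apply: derive_val; apply: is_derive_sum_mx => i.
  exact: is_deriveZ (derivableP (dG _)).
rewrite E D1 (bilin_expand _ (linG x)) -big_split.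
apply: is_derive_sum_mx => i /=; rewrite addrC.
apply: is_derive_scale_mx; last exact/derivableP.
rewrite derive_coord//; apply/derivableP.
by move/derivable_mxP : dz; exact.
Qed.

Lemma smooth_bilin V n p q (G : V -> 'rV[R]_n -> 'M[R]_(p, q))
    (z : V -> 'rV[R]_n) :
  (forall y, linear (G y)) -> (forall e, smooth (fun y => G y e)) ->
  smooth z -> smooth (fun y => G y (z y)).
Proof.
move=> linG sG sz; apply/smooth_mx => i j k.
apply: (@Ck_ext _ _ _ _ (fun y => \sum_(l < n) z y 0 l * G y (delta_mx 0 l) i j)).
  move=> y; rewrite [in RHS](bilin_expand _ (linG y)) summxE.
  by apply: eq_bigr => l _; rewrite mxE.
apply: Ck_sum => l; apply: Ck_mul.
  by have /smooth_mx := sz; apply.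
by have /smooth_mx := sG (delta_mx 0 l); apply.
Qed.

End Smooth.
Arguments derivable_coord {R V p q f x v} i j _.

(** * Functions of parameters and of a time between 0 and 2 pi *)

Section Strip.
Context {R : realType}.
Implicit Types V W : normedModType R.

(** A family of paths with n parameters is a map on R^(n+1), with the time as the
    last coordinate. *)
Definition strip n (u : 'rV[R]_n) (t : R) : 'rV[R]_(n + 1) := row_mx u (const_mx t).
Definition time n (x : 'rV[R]_(n + 1)) : R := rsubmx x 0 0.

Lemma lsubmx_strip n (u : 'rV[R]_n) t : lsubmx (strip u t) = u.
Proof. exact: row_mxKl. Qed.
Lemma time_strip n (u : 'rV[R]_n) t : time (strip u t) = t.
Proof. by rewrite /time row_mxKr mxE. Qed.
Lemma stripK n (x : 'rV[R]_(n + 1)) : strip (lsubmx x) (time x) = x.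
Proof.
rewrite /strip /time -[RHS]hsubmxK; congr row_mx.
by apply/matrixP => i j; rewrite mxE !ord1.
Qed.
Lemma stripD n (u v : 'rV[R]_n) s t : strip u s + strip v t = strip (u + v) (s + t).
Proof.
rewrite /strip add_row_mx; congr row_mx.
by apply/matrixP => i j; rewrite !mxE.
Qed.
Lemma stripZ n (u : 'rV[R]_n) s a : a *: strip u s = strip (a *: u) (a * s).
Proof.
rewrite /strip scale_row_mx; congr row_mx.
by apply/matrixP => i j; rewrite !mxE.
Qed.

Lemma smooth_strip n m (h : 'rV[R]_m -> 'rV[R]_n) (k : 'rV[R]_m -> R) :
  smooth h -> smooth k -> smooth (fun x => strip (h x) (k x)).
Proof.
move=> sh sk; apply: smooth_row_mx => //; apply/smooth_mx => i j.
by move=> l; apply: (Ck_ext _ (sk l)) => x; rewrite mxE.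
Qed.

Lemma smooth_time n : smooth (@time n).
Proof. by have /smooth_mx := @smooth_rsubmx R n 1; exact. Qed.

Lemma near_strip n (u : 'rV[R]_n) t (P : 'rV[R]_(n + 1) -> Prop) :
  (\forall x \near strip u t, P x) ->
  exists2 e : R, 0 < e &
    forall u' t', `|u' - u| < e -> `|t' - t| < e -> P (strip u' t').
Proof.
move=> /nbhs_ballP[d /= d0 dP]; exists (d / 2); first by rewrite divr_gt0.
move=> u' t' ud td; apply: dP; rewrite -ball_normE /= distrC.
apply: (@le_lt_trans _ _ (d / 2)); last by rewrite ltr_pdivrMr// ltr_pMr// ltr1n.
have -> : strip u t = strip u 0 + strip 0 t by rewrite stripD addr0 add0r.
have -> : strip u' t' - (strip u 0 + strip 0 t) = strip (u' - u) (t' - t).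
  rewrite stripD addr0 add0r -[in LHS](scaleN1r (strip u t)) stripZ stripD.
  by rewrite scaleN1r mulN1r.
rewrite [leLHS]/Num.Def.normr/= mx_normrE bigmax_le ?divr_ge0 ?(ltW d0)//.
move=> [i j] _ /=; rewrite (ord1 i); case: (split_ordP j) => j' ->.
  by rewrite row_mxEl (le_trans (delta_rV_norm _ _))// ltW.
by rewrite row_mxEr mxE ltW.
Qed.

Lemma near_strip_u n (u : 'rV[R]_n) t (P : 'rV[R]_(n + 1) -> Prop) :
  (\forall x \near strip u t, P x) -> \forall u' \near u, P (strip u' t).
Proof.
move=> /near_strip[e e0 eP]; apply/nbhs_ballP; exists e => //= u'.
by rewrite -ball_normE /= distrC => ue; apply: eP => //; rewrite subrr normr0.
Qed.

Lemma near_strip_t n (u : 'rV[R]_n) t (P : 'rV[R]_(n + 1) -> Prop) :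
  (\forall x \near strip u t, P x) -> \forall t' \near t, P (strip u t').
Proof.
move=> /near_strip[e e0 eP]; apply/nbhs_ballP; exists e => //= t'.
by rewrite /ball /= distrC => te; apply: eP => //; rewrite subrr normr0.
Qed.

Lemma is_derive_affine V V' W (g : V' -> W) (L : V -> V') x v w :
  (forall h : R, L (h *: v + x) = h *: w + L x) -> derivable g (L x) w ->
  is_derive x v (fun y => g (L y)) ('D_w g (L x)).
Proof.
move=> Lh dg.
have E : (fun h : R => h^-1 *: (((fun y => g (L y)) \o shift x) (h *: v) - g (L x))) =
   (fun h : R => h^-1 *: ((g \o shift (L x)) (h *: w) - g (L x))).
  by apply/funext => h /=; rewrite Lh.
by apply: DeriveDef; rewrite ?/derivable ?/derive E.
Qed.

Lemma is_derive_strip_u n W (g : 'rV[R]_(n + 1) -> W) u t v : smooth g ->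
  is_derive u v (fun u' => g (strip u' t)) ('D_(strip v 0) g (strip u t)).
Proof.
move=> sg; apply: (is_derive_affine (L := fun u' => strip u' t)).
  by move=> h; rewrite stripZ stripD mulr0 add0r.
exact: smooth_derivable.
Qed.

Lemma is_derive_strip_t n W (g : 'rV[R]_(n + 1) -> W) u t : smooth g ->
  is_derive t (1 : R) (fun t' : R => g (strip u t')) ('D_(strip 0 1) g (strip u t)).
Proof.
move=> sg; apply: (is_derive_affine (L := fun t' : R => strip u t')).
  by move=> h; rewrite stripZ stripD scaler0 add0r.
exact: smooth_derivable.
Qed.

(** The regularity of the functions that are integrated over [0, 2 pi]: at the
    times in [I] they agree, near each point, with smooth functions on R^(n+1).
    With [Icl] (defined below) for [I] this is smoothness up to the boundary; with
    [Iop] the values at the end points are arbitrary, as they are for the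
    derivatives in time. *)
Record adm (I : set R) n W (F : 'rV[R]_n -> R -> W) : Prop := Adm {
  admP : forall u t, 0 <= t <= 2 * pi -> exists2 g : 'rV[R]_(n + 1) -> W, smooth g &
    \forall x \near strip u t, I (time x) -> F (lsubmx x) (time x) = g x }.

Definition Icl : set R := [set t | 0 <= t <= 2 * pi].
Definition Iop : set R := [set t | 0 < t < 2 * pi].

Lemma IopW t : Iop t -> Icl t.
Proof. by move=> /andP[a b]; apply/andP; split; exact: ltW. Qed.

Lemma near_Iop t : Iop t -> \forall t' \near t, Iop t'.
Proof.
move=> h; have : t \in `]0, 2 * pi[ by rewrite in_itv.
by move=> /near_in_itvoo; apply: filterS => t'; rewrite in_itv.
Qed.

Lemma tau_gt0 : 0 < 2 * pi :> R.
Proof. by rewrite mulr_gt0// pi_gt0. Qed.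

Lemma adm_op n W (F : 'rV[R]_n -> R -> W) : adm Icl F -> adm Iop F.
Proof.
move=> aF; split=> u t tI; have [g sg gP] := admP aF u tI; exists g => //.
by apply: filterS gP => x gx /IopW.
Qed.

Lemma adm_eq I n W (F G : 'rV[R]_n -> R -> W) :
  (forall u t, I t -> F u t = G u t) -> adm I G -> adm I F.
Proof.
move=> FG aG; split=> u t tI; have [g sg gP] := admP aG u tI; exists g => //.
by apply: filterS gP => x gx Ix; rewrite FG// gx.
Qed.

Lemma adm_ptw I n W1 W2 W (op : W1 -> W2 -> W) (F : 'rV[R]_n -> R -> W1)
    (G : 'rV[R]_n -> R -> W2) :
  (forall f g, smooth f -> smooth g ->
     smooth (fun x : 'rV[R]_(n + 1) => op (f x) (g x))) ->
  adm I F -> adm I G -> adm I (fun u t => op (F u t) (G u t)).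
Proof.
move=> sop aF aG; split=> u t tI.
have [f sf fP] := admP aF u tI; have [g sg gP] := admP aG u tI.
exists (fun x => op (f x) (g x)); first exact: sop.
by apply: filterS2 fP gP => x fx gx Ix; rewrite fx// gx.
Qed.

Lemma adm_smooth I n W (g : 'rV[R]_(n + 1) -> W) :
  smooth g -> adm I (fun u t => g (strip u t)).
Proof.
by move=> sg; split=> u t _; exists g => //; near=> x => _; rewrite stripK.
Unshelve. all: by end_near. Qed.

Lemma adm_cst I n W (w : W) : adm I (fun (_ : 'rV[R]_n) _ => w).
Proof. exact: (@adm_smooth I n W (fun=> w) (smooth_cst _ w)). Qed.

Lemma adm_add I n W (F G : 'rV[R]_n -> R -> W) :
  adm I F -> adm I G -> adm I (fun u t => F u t + G u t).
Proof. by apply: adm_ptw => f g; exact: smooth_add. Qed.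

Lemma adm_opp I n W (F : 'rV[R]_n -> R -> W) :
  adm I F -> adm I (fun u t => - F u t).
Proof.
move=> aF; split=> u t tI; have [g sg gP] := admP aF u tI.
exists (fun x => - g x); first exact: smooth_opp.
by apply: filterS gP => x gx Ix; rewrite gx.
Qed.

Lemma adm_sub I n W (F G : 'rV[R]_n -> R -> W) :
  adm I F -> adm I G -> adm I (fun u t => F u t - G u t).
Proof. by move=> aF aG; apply: adm_add => //; exact: adm_opp. Qed.

Lemma adm_mul I n (F G : 'rV[R]_n -> R -> R) :
  adm I F -> adm I G -> adm I (fun u t => F u t * G u t).
Proof. by apply: adm_ptw => f g; exact: smooth_mul. Qed.

Lemma adm_sum I n W (J : Type) (r : seq J) (F : J -> 'rV[R]_n -> R -> W) :
  (forall j, adm I (F j)) -> adm I (fun u t => \sum_(j <- r) F j u t).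
Proof.
move=> aF; elim: r => [|j r IH].
  by apply: (adm_eq _ (adm_cst _ _ (0 : W))) => u t _; rewrite big_nil.
by apply: (adm_eq _ (adm_add (aF j) IH)) => u t _; rewrite big_cons.
Qed.

Lemma adm_coord I n p q (F : 'rV[R]_n -> R -> 'M[R]_(p, q)) i j :
  adm I F -> adm I (fun u t => F u t i j).
Proof.
move=> aF; split=> u t tI; have [g sg gP] := admP aF u tI.
exists (fun x => g x i j); first by move/smooth_mx : sg; exact.
by apply: filterS gP => x gx Ix; rewrite gx.
Qed.

Lemma adm_bilin I n q p1 p2 (G : 'rV[R]_n -> R -> 'rV[R]_q -> 'M[R]_(p1, p2))
    (z : 'rV[R]_n -> R -> 'rV[R]_q) :
  (forall u t, I t -> linear (G u t)) -> (forall e, adm I (fun u t => G u t e)) ->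
  adm I z -> adm I (fun u t => G u t (z u t)).
Proof.
move=> linG aG az.
apply: (@adm_eq _ _ _ _ (fun u t => \sum_(l < q) z u t 0 l *: G u t (delta_mx 0 l))).
  by move=> u t It; rewrite [LHS](bilin_expand _ (linG u t It)).
apply: adm_sum => l; apply: (adm_ptw (op := fun (a : R) (w : 'M[R]_(p1, p2)) => a *: w)).
- move=> f g sf sg; apply/smooth_mx => i j k.
  apply: (@Ck_ext _ _ _ _ (fun x => f x * g x i j)); first by move=> x; rewrite mxE.
  by move: k; apply: smooth_mul => //; move/smooth_mx : sg; exact.
- exact: adm_coord.
- exact: aG.
Qed.

(** The first hypothesis is the closure of smooth maps into [W] under this
    composition; it holds for scalars and for matrices. *)
Lemma adm_reparam I n m W (F : 'rV[R]_n -> R -> W) (h : 'rV[R]_m -> 'rV[R]_n) :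
  (forall g, smooth g -> smooth (fun x : 'rV[R]_(m + 1) => (g : 'rV[R]_(n + 1) -> W) (strip (h (lsubmx x)) (time x)))) ->
  smooth h -> adm I F -> adm I (fun u t => F (h u) t).
Proof.
move=> scomp sh aF; split=> u t tI; have [g sg gP] := admP aF (h u) tI.
exists (fun x => g (strip (h (lsubmx x)) (time x))); first exact: scomp.
have cs : continuous (fun x : 'rV[R]_(m + 1) => strip (h (lsubmx x)) (time x)).
  apply: smooth_continuous; apply: smooth_strip; last exact: smooth_time.
  by apply: smooth_comp_mx => //; exact: smooth_lsubmx.
have := cs (strip u t); rewrite /continuous_at lsubmx_strip time_strip.
move=> /(_ _ gP) hP.
have {}hP : \forall x \near strip u t,
    I (time (strip (h (lsubmx x)) (time x))) ->
    F (lsubmx (strip (h (lsubmx x)) (time x))) (time (strip (h (lsubmx x)) (time x)))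
    = g (strip (h (lsubmx x)) (time x)) by exact: hP.
by apply: filterS hP => x; rewrite time_strip lsubmx_strip.
Qed.

Lemma adm_D I n W (F : 'rV[R]_n -> R -> W) v :
  adm I F -> adm I (fun u t => 'D_v (F ^~ t) u).
Proof.
move=> aF; split=> u t tI; have [g sg gP] := admP aF u tI.
exists (fun x => 'D_(strip v 0) g x); first exact: smooth_derive.
apply: filterS (near_near gP) => x gx Ix.
have [_ dg] := is_derive_strip_u (lsubmx x) (time x) v sg.
rewrite stripK in dg; rewrite -dg; apply: near_eq_derive.
move: gx; rewrite -{1}(stripK x) => /near_strip_u; apply: filterS => u'.
by rewrite time_strip lsubmx_strip; apply.
Qed.

Lemma adm_dt n W (F : 'rV[R]_n -> R -> W) :
  adm Iop F -> adm Iop (fun u t => derive1 (F u) t).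
Proof.
move=> aF; split=> u t tI; have [g sg gP] := admP aF u tI.
exists (fun x => 'D_(strip 0 1) g x); first exact: smooth_derive.
apply: filterS (near_near gP) => x gx Ix.
have [_ dg] := is_derive_strip_t (lsubmx x) (time x) sg.
rewrite stripK in dg; rewrite -dg derive1E; apply: near_eq_derive.
move: gx; rewrite -{1}(stripK x) => /near_strip_t; move: (near_Iop Ix).
by apply: filterS2 => t' It'; rewrite time_strip lsubmx_strip; apply.
Qed.

(** At an interior time the condition on the time disappears, so that derivatives
    can be computed on the local extension. *)
Lemma adm_int n W (F : 'rV[R]_n -> R -> W) u t : adm Iop F -> Iop t ->
  exists2 g : 'rV[R]_(n + 1) -> W, smooth g &
    \forall x \near strip u t, F (lsubmx x) (time x) = g x.
Proof.
move=> aF It; have [g sg gP] := admP aF u (IopW It); exists g => //.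
have It' : \forall x \near strip u t, Iop (time x).
  have := smooth_continuous (@smooth_time n) (strip u t).
  by rewrite /continuous_at time_strip => /(_ _ (near_Iop It)).
by apply: filterS2 It' gP => x Ix; exact.
Qed.

Lemma adm_derivable_t n W (F : 'rV[R]_n -> R -> W) u t : adm Iop F -> Iop t ->
  derivable (F u) t 1.
Proof.
move=> aF It; have [g sg gP] := adm_int u aF It.
have [dg _] := is_derive_strip_t u t sg.
apply: near_eq_derivable dg; apply: filterS (near_strip_t gP) => t'.
by rewrite time_strip lsubmx_strip.
Qed.

Lemma adm_derivable_u I n W (F : 'rV[R]_n -> R -> W) u t v : adm I F ->
  0 <= t <= 2 * pi -> I t -> derivable (F ^~ t) u v.
Proof.
move=> aF t01 It; have [g sg gP] := admP aF u t01.
have [dg _] := is_derive_strip_u u t v sg.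
apply: near_eq_derivable dg; apply: filterS (near_strip_u gP) => u'.
by rewrite time_strip lsubmx_strip => ->.
Qed.

(** The symmetry of the second derivatives of a local extension. *)
Lemma adm_swap n p q (F : 'rV[R]_n -> R -> 'M[R]_(p, q)) u t v : adm Iop F -> Iop t ->
  'D_v (fun u' => derive1 (F u') t) u = derive1 (fun t' => 'D_v (F ^~ t') u) t.
Proof.
move=> aF It; have [g sg gP] := adm_int u aF It.
have Dt : \forall x \near strip u t, derive1 (F (lsubmx x)) (time x) = 'D_(strip 0 1) g x.
  apply: filterS (near_near gP) => x gx.
  have [_ dg] := is_derive_strip_t (lsubmx x) (time x) sg.
  rewrite stripK in dg; rewrite -dg derive1E; apply: near_eq_derive.
  move: gx; rewrite -{1}(stripK x) => /near_strip_t; apply: filterS => t'.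
  by rewrite time_strip lsubmx_strip.
have Du : \forall x \near strip u t, 'D_v (F ^~ (time x)) (lsubmx x) = 'D_(strip v 0) g x.
  apply: filterS (near_near gP) => x gx.
  have [_ dg] := is_derive_strip_u (lsubmx x) (time x) v sg.
  rewrite stripK in dg; rewrite -dg; apply: near_eq_derive.
  move: gx; rewrite -{1}(stripK x) => /near_strip_u; apply: filterS => u'.
  by rewrite time_strip lsubmx_strip.
have [_ E1] := is_derive_strip_u u t v (smooth_derive (strip 0 1) sg).
have [_ E2] := is_derive_strip_t u t (smooth_derive (strip v 0) sg).
transitivity ('D_(strip v 0) (fun x => 'D_(strip 0 1) g x) (strip u t)).
  rewrite -E1; apply: near_eq_derive; apply: filterS (near_strip_u Dt) => u'.
  by rewrite time_strip lsubmx_strip.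
transitivity ('D_(strip 0 1) (fun x => 'D_(strip v 0) g x) (strip u t)).
  exact: smooth_schwarz.
rewrite -E2 derive1E; apply/esym/near_eq_derive.
apply: filterS (near_strip_t Du) => t'.
by rewrite time_strip lsubmx_strip.
Qed.

End Strip.

(** * Integrals over the time and their derivatives *)

Section PathIntegral.
Context {R : realType}.
Notation tau := (2 * pi : R).
Notation mu := (@lebesgue_measure R).

Lemma Icl_itv : Icl = `[0, tau]%classic :> set R.
Proof. by apply/seteqP; split=> t; rewrite /Icl /= in_itv. Qed.

Lemma adm_within n (F : 'rV[R]_n -> R -> R) u : adm Icl F ->
  {within `[0, tau], continuous (F u)}.
Proof.
move=> aF; apply/subspace_continuousP => t; rewrite -Icl_itv => It.
have [g sg gP] := admP aF u It.
have Eg := nbhs_singleton gP; rewrite time_strip lsubmx_strip in Eg.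
rewrite /from_subspace /= (Eg It).
have [dg _] := is_derive_strip_t u t sg.
have cg : {for t, continuous (fun t' : R => g (strip u t'))}.
  by apply: differentiable_continuous; exact/derivable1_diffP.
have h : (fun t' : R => g (strip u t')) @ within Icl (nbhs t) --> g (strip u t).
  exact: cvg_within_filter.
apply: cvg_trans h; apply: near_eq_cvg; rewrite /within /=.
apply: filterS (near_strip_t gP) => t' e It'.
by rewrite time_strip lsubmx_strip in e; rewrite e.
Qed.

Arguments adm_within {n F} u _.

Lemma within_integrable (f : R -> R) : {within `[0, tau], continuous f} ->
  mu.-integrable `[0, tau] (EFin \o f).
Proof.
by move=> cf; apply: continuous_compact_integrable => //; exact: segment_compact.
Qed.

Lemma adm_integrable n (F : 'rV[R]_n -> R -> R) u : adm Icl F ->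
  mu.-integrable `[0, tau] (EFin \o F u).
Proof. by move=> aF; apply: within_integrable; exact: adm_within. Qed.
Arguments adm_integrable {n F} u _.

(** The end points of [0, 2 pi] form a null set. *)
Lemma path_integral_interior (f g : R -> R) : (forall t, Iop t -> f t = g t) ->
  {within `[0, tau], continuous g} -> path_integral f = path_integral g.
Proof.
move=> fg cg; rewrite /path_integral /Rintegral; congr fine.
have ig : measurable_fun `[0, tau] g.
  apply/measurable_EFinP.
  by have /integrableP[] := within_integrable cg.
have mg : measurable_fun `]0, tau[ g.
  apply: measurable_funS ig => //.
  by move=> t /=; rewrite !in_itv /= => /andP[a b]; rewrite !ltW.
apply: eq_integral_itv_bounded => //.
  apply: eq_measurable_fun mg => t; rewrite inE /= in_itv /= => It.
  by rewrite fg.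
Qed.

Lemma path_integral_bound (f : R -> R) c : {within `[0, tau], continuous f} ->
  (forall t, Icl t -> `|f t| <= c) -> `|path_integral f| <= c * tau.
Proof.
move=> cf fc; have if_ := within_integrable cf.
apply: le_trans (le_normr_Rintegral _ if_) _ => //.
have t0 := ltW (@tau_gt0 R).
have -> : c * tau = \int[mu]_(t in `[0, tau]) c.
  rewrite Rintegral_cst//; congr (_ * _).
  have mE := lebesgue_measure_itv `[0 : R, tau].
  rewrite /= lte_fin tau_gt0 -EFinB subr0 in mE.
  exact/esym/(congr1 fine mE).
apply: le_Rintegral => //.
- by apply/integrable_norm.
by apply: within_integrable => x; exact: cst_continuous.
Qed.

(** The local extensions determine values at the end points: two of them agree at
    the nearby interior times, hence also at the end point by continuity. *)
Lemma adm_close n (F : 'rV[R]_n -> R -> R) : adm Iop F ->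
  exists2 F' : 'rV[R]_n -> R -> R, adm Icl F' &
    forall u t, Iop t -> F u t = F' u t.
Proof.
move=> aF.
pose F' (u : 'rV[R]_n) (t : R) : R := match pselect (0 <= t <= tau) with
  | left h => projT1 (cid2 (admP aF u h)) (strip u t)
  | right _ => 0 end.
exists F'; last first.
  move=> u t It; rewrite /F'; case: pselect => [h|]; last by case; exact: IopW.
  case: cid2 => g sg gP /=; have := nbhs_singleton gP.
  by rewrite time_strip lsubmx_strip; exact.
split=> u t It; have [g sg gP] := admP aF u It; exists g => //.
apply: filterS (near_near gP) => x gx Ix.
rewrite /F'; case: pselect => // h; case: cid2 => g' sg' gP' /=.
rewrite stripK in gP' *.
apply/eqP/negP => /negP neq.
have c1 := smooth_continuous sg x; have c2 := smooth_continuous sg' x.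
have dne : \forall z \near x, g' z - g z != 0.
  have cd : (fun z => g' z - g z) @ x --> g' x - g x.
    exact: (@cvgB _ _ _ (nbhs x) _ _ _ _ _ c2 c1).
  have d0 : g' x - g x != 0 by rewrite subr_eq0.
  exact: (cvgr_neq0 _ cd d0).
have : \forall z \near x, ~ Iop (time z).
  apply: filterS3 gx gP' dne => z e1 e2 + Iz.
  by rewrite -(e1 Iz) -(e2 Iz) subrr eqxx.
rewrite -{1}(stripK x) => /near_strip[e e0 eP].
(* A time in the open interval, on the way from [time x] to the midpoint pi, where
   the two extensions would have to agree. *)
pose s : R := Num.min 1 (e / tau).
have s0 : 0 < s by rewrite lt_min ltr01 divr_gt0// tau_gt0.
have s1 : s <= 1 by rewrite ge_min lexx.
have se : s * tau <= e.
  by rewrite -ler_pdivlMr ?tau_gt0// ge_min lexx orbT.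
have pi0 := @pi_gt0 R.
move: Ix => /andP[x0 x1].
apply: (eP (lsubmx x) (time x + s * (pi - time x))).
- by rewrite subrr normr0.
- rewrite addrAC subrr add0r normrM (gtr0_norm s0).
  apply: (@le_lt_trans _ _ (s * pi)).
    by rewrite ler_wpM2l ?(ltW s0)// ler_norml; apply/andP; split; lra.
  apply: lt_le_trans se; rewrite ltr_pM2l//; lra.
- rewrite time_strip /Iop /=; apply/andP; split.
    have : 0 < s * pi by exact: mulr_gt0.
    have : 0 <= (1 - s) * time x by rewrite mulr_ge0// subr_ge0.
    lra.
  have h1 : 0 < s * pi by exact: mulr_gt0.
  have h2 : 0 <= (1 - s) * (tau - time x) by rewrite mulr_ge0// subr_ge0.
  lra.
Qed.

Lemma adm_integral_eq n (F G : 'rV[R]_n -> R -> R) u : adm Iop G ->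
  (forall t, Iop t -> F u t = G u t) ->
  path_integral (F u) = path_integral (G u).
Proof.
move=> aG FG; have [G' aG' GG'] := adm_close aG.
have cG' := adm_within u aG'.
rewrite (@path_integral_interior (F u) (G' u))// ?(@path_integral_interior (G u) (G' u))//.
- by move=> t It; exact: GG'.
- by move=> t It; rewrite FG// GG'.
Qed.

Lemma adm_integral_lin n (F G : 'rV[R]_n -> R -> R) u a : adm Iop F -> adm Iop G ->
  path_integral (fun t => a * F u t + G u t) =
  a * path_integral (F u) + path_integral (G u).
Proof.
move=> aF aG.
have [F' aF' FF'] := adm_close aF; have [G' aG' GG'] := adm_close aG.
have cF' := adm_within u aF'; have cG' := adm_within u aG'.
rewrite (@path_integral_interior (F u) (F' u))//; last by move=> t; exact: FF'.
rewrite (@path_integral_interior (G u) (G' u))//; last by move=> t; exact: GG'.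
rewrite (@path_integral_interior _ (fun t => a * F' u t + G' u t)).
- have iF := within_integrable cF'; have iG := within_integrable cG'.
  have iaF : mu.-integrable `[0, tau] (EFin \o (fun t => a * F' u t)).
    apply: (adm_integrable (F := fun u t => a * F' u t)).
    by apply: adm_mul => //; exact: adm_cst.
  rewrite /path_integral RintegralD//; congr (_ + _).
  by rewrite RintegralZl.
- by move=> t It; rewrite FF'// GG'.
- apply: (adm_within (F := fun u t => a * F' u t + G' u t)).
  by apply: adm_add => //; apply: adm_mul => //; exact: adm_cst.
Qed.

(** Uniformity in [t] comes from the compactness of [0, 2 pi]. *)
Lemma adm_tube n (F : 'rV[R]_n -> R -> R) u (e : R) : adm Icl F -> 0 < e ->
  \forall u' \near u, forall t, Icl t -> `|F u t - F u' t| <= e.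
Proof.
move=> aF e0.
have /compact_near_coveringP := @segment_compact R 0 tau.
move=> /(_ _ (nbhs u) (fun u' t => Icl t -> `|F u t - F u' t| <= e) _) H.
have {}H : \forall u' \near u, `[0, tau] `<=` (fun t => Icl t -> `|F u t - F u' t| <= e).
  apply: H => t; rewrite -Icl_itv => It.
  have [g sg gP] := admP aF u It.
  have e2 : 0 < e / 2 by rewrite divr_gt0.
  have /cvgrPdist_le/(_ _ e2) cg := smooth_continuous sg (strip u t).
  have [d d0 dP] := near_strip (filterI gP cg).
  have ball_u : \forall u' \near u, `|u' - u| < d.
    apply/nbhs_ballP; exists d => //= u'; rewrite -ball_normE /=.
    by rewrite distrC.
  have ball_t : \forall t' \near t, `|t' - t| < d.
    by apply/nbhs_ballP; exists d => //= t'; rewrite /ball /= distrC.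
  exists ([set t' | `|t' - t| < d], [set u' | `|u' - u| < d]) => //=.
  move=> [t' u'] /= [td ud] It'.
  have [] := dP u t' _ td; first by rewrite subrr normr0.
  rewrite time_strip lsubmx_strip => /(_ It') -> c1.
  have [] := dP u' t' ud td.
  rewrite time_strip lsubmx_strip => /(_ It') -> c2.
  rewrite (splitr e) -(subrKA (g (strip u t))).
  by apply: le_trans (ler_normD _ _) _; rewrite lerD// distrC.
by apply: filterS H => u' h t It; apply: h.
Qed.

(** By the mean value theorem the difference quotient of the integrand is its
    derivative at a nearby parameter, and [adm_tube] bounds the error uniformly
    in time. *)
Lemma adm_integral_derive n (F : 'rV[R]_n -> R -> R) u v : adm Icl F ->
  is_derive u v (fun u => path_integral (F u))
    (path_integral (fun t => 'D_v (F ^~ t) u)).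
Proof.
move=> aF.
pose G (u : 'rV[R]_n) t := 'D_v (F ^~ t) u.
have aG : adm Icl G by exact: adm_D.
have Gt w t : Icl t -> is_derive w v (F ^~ t) (G w t).
  by move=> It; apply: DeriveDef => //; exact: (@adm_derivable_u R Icl n _ F w t v aF It It).
have key : h^-1 *: (((fun u => path_integral (F u)) \o shift u) (h *: v) -
    path_integral (F u)) @[h --> 0^'] --> path_integral (G u).
  apply/cvgrPdist_le => e e0.
  have et : 0 < e / tau by rewrite divr_gt0// tau_gt0.
  have /nbhs_ballP[d /= d0 dP] := adm_tube u aG et.
  have v1 : 0 < `|v| + 1 by rewrite ltr_wpDl.
  near=> h.
  have h0 : h != 0 by near: h; exact: nbhs_dnbhs_neq.
  have hd : `|h| < d / (`|v| + 1).
    by near: h; apply: dnbhs0_lt; rewrite divr_gt0.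
  have E : path_integral (G u) - h^-1 *: (path_integral (F (h *: v + u)) - path_integral (F u))
     = path_integral (fun t => - h^-1 * (F (h *: v + u) t - F u t) + G u t).
    have aH w : adm Icl (fun (_ : 'rV[R]_0) t => F w t).
      apply: (adm_reparam (h := fun=> w)) aF; last exact: smooth_cst.
      move=> g sg; apply: (smooth_comp sg); apply: smooth_strip.
        exact: smooth_cst.
      exact: smooth_time.
    have aK : adm Icl (fun (_ : 'rV[R]_0) t => G u t).
      apply: (adm_reparam (h := fun=> u)) aG; last exact: smooth_cst.
      move=> g sg; apply: (smooth_comp sg); apply: smooth_strip.
        exact: smooth_cst.
      exact: smooth_time.
    rewrite (@adm_integral_lin 0 (fun _ t => F (h *: v + u) t - F u t) (fun _ t => G u t) 0 (- h^-1)).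
    - have := @adm_integral_lin 0 (fun _ t => F u t) (fun _ t => F (h *: v + u) t) 0 (-1)
        (adm_op (aH u)) (adm_op (aH (h *: v + u))).
      rewrite (_ : (fun t => _) = (fun t => F (h *: v + u) t - F u t)); last first.
        by apply/funext => t; rewrite mulN1r addrC.
      move=> ->; rewrite /GRing.scale /=.
      move: (path_integral (F u)) (path_integral (F (h *: v + u))).
      by move: (path_integral (G u)) h^-1 => a b p q; ring.
    - by apply: adm_op; apply: adm_sub.
    - exact: adm_op.
  rewrite E -[leRHS](divfK (lt0r_neq0 (@tau_gt0 R))).
  apply: path_integral_bound.
    apply: (@adm_within 0 (fun _ t => - h^-1 * (F (h *: v + u) t - F u t) + G u t) 0).
    apply: (adm_reparam (F := fun w t => - h^-1 * (F (h *: v + w) t - F w t) + G w t) (h := fun=> u)).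
    - move=> g sg; apply: (smooth_comp sg); apply: smooth_strip.
        exact: smooth_cst.
      exact: smooth_time.
    - exact: smooth_cst.
    apply: adm_add => //; apply: adm_mul; first exact: adm_cst.
    apply: adm_sub => //; apply: (adm_reparam (h := fun w => h *: v + w)) aF.
      move=> g sg; apply: (smooth_comp sg); apply: smooth_strip; last exact: smooth_time.
      by apply: smooth_add; [exact: smooth_cst|exact: smooth_lsubmx].
    by apply: smooth_add; [exact: smooth_cst|exact: smooth_id].
  move=> t It.
  have dF y : derivable (F ^~ t) y (h *: v).
    by have [] := derivable_scale_dir h (@ex_derive _ _ _ _ _ _ _ (Gt y t It)).
  have [s /andP[s0 s1] sE] := mvt_line u dF.
  have [_ sE2] := derivable_scale_dir h (@ex_derive _ _ _ _ _ _ _ (Gt (u + s *: (h *: v)) t It)).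
  rewrite [h *: v + u]addrC sE sE2 -/(G (u + s *: (h *: v)) t).
  rewrite /GRing.scale /= mulNr mulrA mulVf// mul1r addrC.
  apply: dP => //; rewrite -ball_normE /= opprD addNKr normrN !normrZ.
  rewrite (ger0_norm s0); apply: (@le_lt_trans _ _ (`|h| * (`|v| + 1))).
    apply: le_trans (ler_piMl _ s1) _; first by rewrite mulr_ge0.
    by rewrite ler_wpM2l// lerDl.
  by rewrite -ltr_pdivlMr.
apply: DeriveDef; first by apply/cvg_ex; eexists; exact: key.
exact: cvg_lim key.
Unshelve. all: by end_near. Qed.

End PathIntegral.
Arguments adm_within {R n F} u _.
Arguments adm_integrable {R n F} u _.

(** * Smooth dependence of integrals on parameters *)

Section ParameterIntegrals.
Context {R : realType}.
Notation tau := (2 * pi : R).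

Lemma adm_freeze I n (W : normedModType R) (F : 'rV[R]_n -> R -> W) u : adm I F ->
  (forall g : 'rV[R]_(n + 1) -> W, smooth g ->
     smooth (fun x : 'rV[R]_(0 + 1) => g (strip u (time x)))) ->
  adm I (fun (_ : 'rV[R]_0) t => F u t).
Proof.
move=> aF h; apply: (adm_reparam (h := fun=> u)) aF; last exact: smooth_cst.
exact: h.
Qed.

Lemma adm_freezeR I n (F : 'rV[R]_n -> R -> R) u : adm I F ->
  adm I (fun (_ : 'rV[R]_0) t => F u t).
Proof.
move=> aF; apply: adm_freeze => // g sg; apply: (smooth_comp sg).
by apply: smooth_strip; [exact: smooth_cst|exact: smooth_time].
Qed.

Lemma path_integral_sub n m (F : 'rV[R]_n -> R -> R) (G : 'rV[R]_m -> R -> R) u w :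
  adm Iop F -> adm Iop G ->
  path_integral (fun t => F u t - G w t) = path_integral (F u) - path_integral (G w).
Proof.
move=> /(adm_freezeR u) aF /(adm_freezeR w) aG.
have := @adm_integral_lin R 0 (fun _ t => G w t) (fun _ t => F u t) 0 (-1) aG aF.
rewrite (_ : (fun t => _) = (fun t => F u t - G w t)); last first.
  by apply/funext => t; rewrite mulN1r addrC.
by move=> ->; rewrite mulN1r addrC.
Qed.

Lemma adm_integral_cont n (F : 'rV[R]_n -> R -> R) : adm Icl F ->
  continuous (fun u => path_integral (F u)).
Proof.
move=> aF u; apply/(@cvgrPdist_le _ _ _ (nbhs u)) => e e0.
have et : 0 < e / tau by rewrite divr_gt0// tau_gt0.
near=> w.
have h : forall t, Icl t -> `|F u t - F w t| <= e / tau.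
  by near: w; exact: adm_tube.
rewrite -(path_integral_sub u w (adm_op aF) (adm_op aF)).
rewrite -[leRHS](divfK (lt0r_neq0 (@tau_gt0 R))).
apply: path_integral_bound => //.
apply: (@adm_within R 0 (fun _ t => F u t - F w t) 0).
by apply: adm_sub; exact: adm_freezeR.
Unshelve. all: by end_near. Qed.

(** The regularity class is stable under derivatives in the parameters, so
    differentiation under the integral sign can be iterated. *)
Lemma adm_integral_smooth_cl n (F : 'rV[R]_n -> R -> R) : adm Icl F ->
  smooth (fun u => path_integral (F u)).
Proof.
move=> aF k; elim: k F aF => [|k IH] F aF.
  by split=> //; exact: adm_integral_cont.
split; first exact: adm_integral_cont.
split=> [x v|v]; first by have [] := adm_integral_derive x v aF.
apply: (@Ck_ext _ _ _ _ (fun u => path_integral (fun t => 'D_v (F ^~ t) u))).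
  by move=> x; have [_ ->] := adm_integral_derive x v aF.
by apply: (IH (fun u t => 'D_v (F ^~ t) u)); exact: adm_D.
Qed.

Lemma adm_integral_smooth n (F : 'rV[R]_n -> R -> R) : adm Iop F ->
  smooth (fun u => path_integral (F u)).
Proof.
move=> aF; have [F' aF' FF'] := adm_close aF.
rewrite (_ : (fun u => _) = (fun u => path_integral (F' u))).
  exact: adm_integral_smooth_cl.
apply/funext => u; apply: adm_integral_eq => [|t]; last exact: FF'.
exact: adm_op.
Qed.

Lemma adm_integral_deriv n (F : 'rV[R]_n -> R -> R) u v : adm Iop F ->
  'D_v (fun u => path_integral (F u)) u = path_integral (fun t => 'D_v (F ^~ t) u).
Proof.
move=> aF; have [F' aF' FF'] := adm_close aF.
rewrite (_ : (fun u => _) = (fun u => path_integral (F' u))); last first.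
  apply/funext => w; apply: adm_integral_eq => [|t]; last exact: FF'.
  exact: adm_op.
have [_ ->] := adm_integral_derive u v aF'.
apply/esym; apply: (adm_integral_eq (F := fun u t => 'D_v (F ^~ t) u)
   (G := fun u t => 'D_v (F' ^~ t) u)).
  by apply: adm_op; exact: adm_D.
move=> t It; congr ('D_v _ u); apply/funext => w; exact: FF'.
Qed.

Lemma path_integral_ftc n (F : 'rV[R]_n -> R -> R) u : adm Icl F ->
  path_integral (derive1 (F u)) = F u tau - F u 0.
Proof.
move=> aF; have aFo := adm_op aF.
have [G aG FG] := adm_close (adm_dt aFo).
have cF := adm_within u aF.
have cG := adm_within u aG.
rewrite (@path_integral_interior _ _ (G u))//; last by move=> t It; exact: FG.
rewrite /path_integral /Rintegral.
have := @continuous_FTC2 R (G u) (F u) 0 tau (@tau_gt0 R) cG.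
move=> -> //.
  have [_ h0 h1] := (continuous_within_itvP (F u) (@tau_gt0 R)).1 cF.
  split=> // t; rewrite in_itv /= => It.
  exact: (@adm_derivable_t R n _ F u t aFo It).
by move=> t; rewrite in_itv /= => It; exact: FG.
Qed.

End ParameterIntegrals.

(** * Partial derivatives in block coordinates *)

Section BlockCoordinates.
Context {R : realType}.

Lemma near_smooth n m (k : 'rV[R]_n -> 'rV[R]_m) (t : 'rV[R]_n)
    (P : 'rV[R]_m -> Prop) :
  smooth k -> (\forall z \near k t, P z) -> \forall t' \near t, P (k t').
Proof. by move=> sk Pk; exact: (smooth_continuous sk t _ Pk). Qed.

Lemma smooth_row_l p q (y : 'rV[R]_q) : smooth (fun x : 'rV[R]_p => row_mx x y).
Proof. by apply: smooth_row_mx; [exact: smooth_id|exact: smooth_cst]. Qed.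
Lemma smooth_row_r p q (x : 'rV[R]_p) : smooth (fun y : 'rV[R]_q => row_mx x y).
Proof. by apply: smooth_row_mx; [exact: smooth_cst|exact: smooth_id]. Qed.
Lemma smooth_row_diag p : smooth (fun x : 'rV[R]_p => row_mx x x).
Proof. by apply: smooth_row_mx; exact: smooth_id. Qed.

Lemma derive_smooth_chain n m p q (f : 'rV[R]_m -> 'M[R]_(p, q))
    (k : 'rV[R]_n -> 'rV[R]_m) x v : smooth f -> smooth k ->
  'D_v (fun y => f (k y)) x = 'D_('D_v k x) f (k x).
Proof.
move=> sf sk; apply: derive_chain; first exact: smooth_diff_mx.
exact: smooth_derivable.
Qed.

Lemma derive_row_l p q (y : 'rV[R]_q) (x v : 'rV[R]_p) :
  'D_v (fun x => row_mx x y) x = row_mx v 0.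
Proof.
have [_ ->] := derive_row_mx (@derivable_id _ _ x v) (@derivable_cst _ _ _ y x v).
by rewrite derive_id derive_cst.
Qed.
Lemma derive_row_r p q (x : 'rV[R]_p) (y v : 'rV[R]_q) :
  'D_v (fun y => row_mx x y) y = row_mx 0 v.
Proof.
have [_ ->] := derive_row_mx (@derivable_cst _ _ _ x y v) (@derivable_id _ _ y v).
by rewrite derive_id derive_cst.
Qed.

Lemma derive_near n m p (f g : 'rV[R]_n -> 'M[R]_(m, p)) x v :
  (\forall y \near x, f y = g y) -> 'D_v f x = 'D_v g x.
Proof. exact: near_eq_derive. Qed.

Lemma smooth_dir_linear n p q (f : 'rV[R]_n -> 'M[R]_(p, q)) x : smooth f ->
  linear (fun v => 'D_v f x).
Proof. by move=> sf a u w; apply: derive_dirD; exact: smooth_diff_mx. Qed.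

End BlockCoordinates.
Arguments smooth_row_l {R p q} y.
Arguments smooth_row_r {R p q} x.

(** * The Maurer--Cartan form and the adjoint action *)

(** A Lie group with a chart at its unit, in which the Lie algebra and the
    logarithmic derivatives of plots are computed. *)
Record unit_chart (R : realType) (G : smooth_group R) (d : nat)
    (phi : 'rV[R]_d -> G) : Prop := UnitChart {
  unit_chart_diffeology : diffeology (group_space G);
  unit_chart_chart : chart (X := group_space G) phi;
  unit_chart_unit : phi 0 = 1%g }.

Section LieCalculus.
Context {R : realType} (G : smooth_group R) (d : nat) (phi : 'rV[R]_d -> G).
Hypothesis LC : unit_chart phi.
Let dG := unit_chart_diffeology LC.
Let hphi := unit_chart_chart LC.
Let hphi1 := unit_chart_unit LC.
Notation plotG := (@plot R (group_space G) _).

Lemma plotG_comp n m (Q : 'rV[R]_n -> G) (h : 'rV[R]_m -> 'rV[R]_n) :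
  plotG Q -> smooth h -> plotG (fun x => Q (h x)).
Proof. by case: dG => _ H _; exact: H. Qed.
Lemma plotG_mul n (P Q : 'rV[R]_n -> G) :
  plotG P -> plotG Q -> plotG (fun x => P x * Q x)%g.
Proof.
move=> pP pQ.
exact: (@group_mul_smooth R G n (fun x => (P x, Q x)) (conj pP pQ)).
Qed.
Lemma plotG_inv n (P : 'rV[R]_n -> G) : plotG P -> plotG (fun x => (P x)^-1)%g.
Proof. by move=> pP; exact: (@group_inv_smooth R G n P pP). Qed.
Lemma plotG_cst n (g : G) : plotG (fun _ : 'rV[R]_n => g).
Proof. by case: dG => H _ _; apply: H; exact: group_pts. Qed.
Lemma plotG_phi : plotG phi.
Proof. by case: hphi. Qed.

Lemma coordK x : Defs.coord phi (phi x) = x.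
Proof.
rewrite /Defs.coord; case: xgetP => [y -> /=|/(_ x)]; last by case.
by case: hphi => _ phi_inj _ e; apply: phi_inj.
Qed.

Lemma local_coord n (Q : 'rV[R]_n -> G) x : plotG Q -> Q x = 1%g ->
  exists h : 'rV[R]_n -> 'rV[R]_d, [/\ smooth h, h x = 0,
    \forall y \near x, Q y = phi (h y) & \forall y \near x, Defs.coord phi (Q y) = h y].
Proof.
move=> pQ Qx; case: hphi => _ phi_inj /(_ n Q x pQ)[].
  by exists 0 => //; rewrite hphi1 Qx.
move=> h sh hP; exists h; split => //.
  by have e := nbhs_singleton hP; apply: phi_inj; rewrite hphi1 -Qx -e.
by apply: filterS hP => y ->; rewrite coordK.
Qed.

(** Writing [Q = Q x * phi k] near [x] reduces the Maurer--Cartan form at [x] to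
    the ordinary derivative of the vector valued function [k]. *)
Lemma Theta_at n (Q : 'rV[R]_n -> G) x : plotG Q ->
  exists k : 'rV[R]_n -> 'rV[R]_d, [/\ smooth k, k x = 0,
    \forall y \near x, Q y = (Q x * phi (k y))%g &
    forall w, Theta phi Q x w = 'D_w k x].
Proof.
move=> pQ; have pE := plotG_mul (plotG_cst n (Q x)^-1) pQ.
have [|k [sk kx k1 k2]] := local_coord (x := x) pE; first exact: mulVg.
exists k; split => //.
  by apply: filterS k1 => y <-; rewrite mulKVg.
by move=> w; apply: derive_near.
Qed.

(** The base point of these coordinates moves with [x].  So the coordinates of
    [(Q y)^-1 * Q z] are taken jointly in [(y, z)] and differentiated in [z] on
    the diagonal. *)
Lemma Theta_smooth n (Q : 'rV[R]_n -> G) w : plotG Q ->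
  smooth (fun x => Theta phi Q x w).
Proof.
move=> pQ; apply: smooth_local => x.
have pE : plotG (fun z : 'rV[R]_(n + n) => (Q (lsubmx z))^-1 * Q (rsubmx z))%g.
  apply: plotG_mul; first apply: plotG_inv.
    exact: plotG_comp pQ (@smooth_lsubmx R n n).
  exact: plotG_comp pQ (@smooth_rsubmx R n n).
have [|h [sh _ _ h2]] := local_coord (x := row_mx x x) pE.
  by rewrite row_mxKl row_mxKr mulVg.
exists (fun y => 'D_(row_mx 0 w) h (row_mx y y)).
  apply: (smooth_comp_mx (f := fun z => 'D_(row_mx 0 w) h z)).
    exact: smooth_derive.
  exact: smooth_row_diag.
have := near_smooth (k := fun y => row_mx y y) (@smooth_row_diag R n) (near_near h2).
apply: filterS => y hy; rewrite /Theta.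
have := near_smooth (k := fun z => row_mx y z) (smooth_row_r y) hy.
move=> hy2.
transitivity ('D_w (fun z => h (row_mx y z)) y).
  by apply: derive_near; apply: filterS hy2 => z; rewrite row_mxKl row_mxKr.
by rewrite (derive_smooth_chain (k := row_mx y) _ _ sh (smooth_row_r y)) derive_row_r.
Qed.

Lemma Theta_linear n (Q : 'rV[R]_n -> G) x : plotG Q -> linear (Theta phi Q x).
Proof.
move=> pQ a u w; have [k [sk _ _ E]] := Theta_at x pQ.
by rewrite !E; exact: smooth_dir_linear.
Qed.

Lemma Theta_near n (Q Q' : 'rV[R]_n -> G) x w :
  (\forall y \near x, Q y = Q' y) -> Theta phi Q x w = Theta phi Q' x w.
Proof.
move=> QQ; apply: derive_near; rewrite (nbhs_singleton QQ).
by apply: filterS QQ => y ->.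
Qed.

Lemma Theta_left n (g : G) (Q : 'rV[R]_n -> G) x w :
  Theta phi (fun y => g * Q y)%g x w = Theta phi Q x w.
Proof.
rewrite /Theta; congr ('D_w _ x); apply/funext => y.
by rewrite invMg -mulgA mulKg.
Qed.

Lemma Theta_cst n (g : G) (x w : 'rV[R]_n) : Theta phi (fun=> g) x w = 0.
Proof. by rewrite /Theta derive_cst. Qed.

Lemma Theta_comp n m (Q : 'rV[R]_n -> G) (h : 'rV[R]_m -> 'rV[R]_n) x w :
  plotG Q -> smooth h ->
  Theta phi (fun y => Q (h y)) x w = Theta phi Q (h x) ('D_w h x).
Proof.
move=> pQ sh; have [k [sk kx k1 ->]] := Theta_at (h x) pQ.
rewrite -derive_smooth_chain//; apply: derive_near.
have := near_smooth sh k1; apply: filterS => y ->.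
by rewrite mulKg coordK.
Qed.

Lemma Theta_phi0 y : Theta phi phi 0 y = y.
Proof.
rewrite /Theta hphi1 invg1 (_ : (fun u' => _) = id) ?derive_id//.
by apply/funext => z; rewrite mul1g coordK.
Qed.

Lemma Ad_at g : exists c : 'rV[R]_d -> 'rV[R]_d, [/\ smooth c, c 0 = 0,
    \forall b \near (0 : 'rV[R]_d), (g * phi b * g^-1)%g = phi (c b) &
    forall y, Ad phi g y = 'D_y c 0].
Proof.
have pE : plotG (fun b => g * phi b * g^-1)%g.
  apply: plotG_mul; last exact: plotG_cst.
  by apply: plotG_mul; [exact: plotG_cst|exact: plotG_phi].
have [|c [sc c0 c1 c2]] := local_coord (x := 0) pE.
  by rewrite hphi1 mulg1 mulgV.
by exists c; split => // y; exact: derive_near.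
Qed.

Lemma Ad_linear g : linear (Ad phi g).
Proof.
move=> a u w; have [c [sc _ _ E]] := Ad_at g.
by rewrite !E; exact: smooth_dir_linear.
Qed.

Lemma Ad_mul g g' y : Ad phi (g * g')%g y = Ad phi g (Ad phi g' y).
Proof.
have [c [sc c0 c1 E]] := Ad_at g; have [c' [sc' c'0 c'1 E']] := Ad_at g'.
rewrite E E'; transitivity ('D_y (fun b => c (c' b)) 0); last first.
  by rewrite (derive_smooth_chain _ _ sc sc') c'0.
apply: derive_near.
have : \forall b \near (0 : 'rV[R]_d), (g * phi (c' b) * g^-1)%g = phi (c (c' b)).
  by apply: (near_smooth (P := fun z => (g * phi z * g^-1)%g = phi (c z)) sc'); rewrite c'0.
apply: filterS2 c'1 => b e1 e2.
by rewrite -(coordK (c (c' b))) -e2 -e1 invMg !mulgA.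
Qed.

Lemma Ad1 y : Ad phi 1%g y = y.
Proof.
rewrite /Ad (_ : (fun b => _) = id) ?derive_id//.
by apply/funext => z; rewrite mul1g invg1 mulg1 coordK.
Qed.

Lemma AdK g y : Ad phi g^-1%g (Ad phi g y) = y.
Proof. by rewrite -Ad_mul mulVg Ad1. Qed.
Lemma AdVK g y : Ad phi g (Ad phi g^-1%g y) = y.
Proof. by rewrite -Ad_mul mulgV Ad1. Qed.

(** Conjugation is read in the chart jointly in the conjugating and the
    conjugated element, which gives the smooth dependence of Ad on the former. *)
Lemma Ad_repr n (Q : 'rV[R]_n -> G) x : plotG Q ->
  exists h : 'rV[R]_(n + d) -> 'rV[R]_d, [/\ smooth h,
    \forall z \near row_mx x 0, (Q (lsubmx z) * phi (rsubmx z) * (Q (lsubmx z))^-1)%g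
      = phi (h z) &
    \forall y \near x, h (row_mx y 0) = 0 /\
      forall w, Ad phi (Q y) w = 'D_(row_mx 0 w) h (row_mx y 0)].
Proof.
move=> pQ.
have pE : plotG (fun z : 'rV[R]_(n + d) =>
    Q (lsubmx z) * phi (rsubmx z) * (Q (lsubmx z))^-1)%g.
  have pl : plotG (fun z : 'rV[R]_(n + d) => Q (lsubmx z)).
    exact: plotG_comp pQ (@smooth_lsubmx R n d).
  apply: plotG_mul; last exact: plotG_inv.
  apply: plotG_mul => //; exact: plotG_comp plotG_phi (@smooth_rsubmx R n d).
have [|h [sh _ h1 h2]] := local_coord (x := row_mx x 0) pE.
  by rewrite row_mxKl row_mxKr hphi1 mulg1 mulgV.
exists h; split => //.
have := near_smooth (k := fun y => row_mx y 0) (smooth_row_l 0) (near_near h2).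
apply: filterS => y hy; split.
  have := nbhs_singleton hy; rewrite row_mxKl row_mxKr hphi1 mulg1 mulgV => <-.
  by rewrite -hphi1 coordK.
move=> w; have := near_smooth (k := fun z => row_mx y z) (smooth_row_r y) hy.
move=> hy2.
transitivity ('D_w (fun z => h (row_mx y z)) 0).
  by apply: derive_near; apply: filterS hy2 => z; rewrite row_mxKl row_mxKr.
by rewrite (derive_smooth_chain (k := row_mx y) _ _ sh (smooth_row_r y)) derive_row_r.
Qed.

Lemma Ad_smooth n (Q : 'rV[R]_n -> G) w : plotG Q ->
  smooth (fun x => Ad phi (Q x) w).
Proof.
move=> pQ; apply: smooth_local => x; have [h [sh _ hP]] := Ad_repr x pQ.
exists (fun y => 'D_(row_mx 0 w) h (row_mx y 0)).
  apply: (smooth_comp_mx (f := fun z => 'D_(row_mx 0 w) h z)).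
    exact: smooth_derive.
  exact: smooth_row_l.
by apply: filterS hP => y [_].
Qed.

(** [Ad (Q y) = Ad (Q x) (Ad (phi (k y)))], and the derivative of Ad at the unit
    is the bracket by definition. *)
Lemma derive_Ad n (Q : 'rV[R]_n -> G) x v y : plotG Q ->
  'D_v (fun x => Ad phi (Q x) y) x = Ad phi (Q x) (bracket phi (Theta phi Q x v) y).
Proof.
move=> pQ; have [k [sk kx k1 ->]] := Theta_at x pQ.
have sA : smooth (fun b => Ad phi (phi b) y) by exact: Ad_smooth plotG_phi.
have E : bracket phi ('D_v k x) y = 'D_v (fun z => Ad phi (phi (k z)) y) x.
  by rewrite (derive_smooth_chain _ _ sA sk) kx.
rewrite E.
have sAk : smooth (fun z => Ad phi (phi (k z)) y) by exact: smooth_comp_mx sA sk.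
have h := @is_derive_bilin R _ _ _ _ (fun=> Ad phi (Q x)) _ x v
   (fun=> Ad_linear (Q x)) (fun e => @derivable_cst _ _ _ _ _ _)
   (smooth_derivable x v sAk).
have := h; rewrite derive_cst add0r => -[_ <-].
apply: derive_near; apply: filterS k1 => z ->.
by rewrite Ad_mul.
Qed.

(** The group law in the chart; it is determined near the origin only. *)
Definition local_law (m : 'rV[R]_(d + d) -> 'rV[R]_d) :=
  smooth m /\ \forall z \near row_mx 0 0, (phi (lsubmx z) * phi (rsubmx z))%g = phi (m z).

Lemma local_law_ex : exists m, local_law m.
Proof.
have pE : plotG (fun z : 'rV[R]_(d + d) => phi (lsubmx z) * phi (rsubmx z))%g.
  apply: plotG_mul; first exact: plotG_comp plotG_phi (@smooth_lsubmx R d d).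
  exact: plotG_comp plotG_phi (@smooth_rsubmx R d d).
have [|h [sh _ h1 _]] := local_coord (x := row_mx 0 0) pE.
  by rewrite row_mxKl row_mxKr hphi1 mulg1.
by exists h.
Qed.

Lemma local_lawE m : local_law m ->
  \forall z \near row_mx 0 0, Defs.coord phi (phi (lsubmx z) * phi (rsubmx z))%g = m z.
Proof. by case=> _; apply: filterS => z ->; rewrite coordK. Qed.

Lemma local_law_l m : local_law m -> \forall a \near (0 : 'rV[R]_d), m (row_mx a 0) = a.
Proof.
move=> /local_lawE lm.
have := near_smooth (k := fun y => row_mx y 0) (smooth_row_l 0) lm.
by apply: filterS => a; rewrite row_mxKl row_mxKr hphi1 mulg1 coordK.
Qed.

Lemma local_law_r m : local_law m -> \forall a \near (0 : 'rV[R]_d), m (row_mx 0 a) = a.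
Proof.
move=> /local_lawE lm.
have := near_smooth (k := fun y => row_mx 0 y) (smooth_row_r 0) lm.
by apply: filterS => a; rewrite row_mxKl row_mxKr hphi1 mul1g coordK.
Qed.

Lemma local_law_dl m a : local_law m -> 'D_(row_mx a 0) m (row_mx 0 0) = a.
Proof.
move=> lm; have [sm _] := lm.
transitivity ('D_a (fun y => m (row_mx y 0)) 0).
  by rewrite (derive_smooth_chain (k := fun y => row_mx y 0) _ _ sm (smooth_row_l 0)) derive_row_l.
by rewrite (derive_near (g := id)) ?derive_id//; exact: local_law_l.
Qed.

Lemma local_law_dr m a : local_law m -> 'D_(row_mx 0 a) m (row_mx 0 0) = a.
Proof.
move=> lm; have [sm _] := lm.
transitivity ('D_a (fun y => m (row_mx 0 y)) 0).
  by rewrite (derive_smooth_chain (k := fun y => row_mx 0 y) _ _ sm (smooth_row_r 0)) derive_row_r.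
by rewrite (derive_near (g := id)) ?derive_id//; exact: local_law_r.
Qed.

(** Conjugating the increment of [P] by [(Q x)^-1] leaves a product of two
    increments at the unit, where the derivative of the group law is addition. *)
Lemma Theta_mul n (P Q : 'rV[R]_n -> G) x w : plotG P -> plotG Q ->
  Theta phi (fun y => P y * Q y)%g x w =
  Ad phi (Q x)^-1%g (Theta phi P x w) + Theta phi Q x w.
Proof.
move=> pP pQ.
have [k [sk kx k1 ->]] := Theta_at x pP; have [l [sl lx l1 ->]] := Theta_at x pQ.
have [c [sc c0 c1 ->]] := Ad_at (Q x)^-1%g.
have [m lm] := local_law_ex; have [sm m1] := lm.
pose r y := row_mx (c (k y)) (l y).
have sck : smooth (fun y => c (k y)) by exact: smooth_comp_mx sc sk.
have sr : smooth r by exact: smooth_row_mx.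
have rx : r x = row_mx 0 0 by rewrite /r kx c0 lx.
transitivity ('D_w (fun y => m (r y)) x).
  apply: derive_near.
  have m1' : \forall y \near x, (phi (lsubmx (r y)) * phi (rsubmx (r y)))%g = phi (m (r y)).
    by apply: (near_smooth (P := fun z => (phi (lsubmx z) * phi (rsubmx z))%g = phi (m z)) sr); rewrite rx.
  have c1' : \forall y \near x, ((Q x)^-1 * phi (k y) * (Q x)^-1^-1)%g = phi (c (k y)).
    by apply: (near_smooth (P := fun z => ((Q x)^-1 * phi z * (Q x)^-1^-1)%g = phi (c z)) sk); rewrite kx.
  near=> y.
  have e1 : P y = (P x * phi (k y))%g by near: y.
  have e2 : Q y = (Q x * phi (l y))%g by near: y.
  have e3 : ((Q x)^-1 * phi (k y) * (Q x)^-1^-1)%g = phi (c (k y)) by near: y.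
  have e4 : (phi (lsubmx (r y)) * phi (rsubmx (r y)))%g = phi (m (r y)) by near: y.
  rewrite row_mxKl row_mxKr -e3 invgK in e4.
  rewrite -(coordK (m (r y))) -e4 e1 e2 invMg.
  by congr (Defs.coord phi _); rewrite -!mulgA mulKg.
rewrite (derive_smooth_chain _ _ sm sr) rx /r.
have [_ ->] := derive_row_mx (smooth_derivable x w sck) (smooth_derivable x w sl).
rewrite (derive_smooth_chain _ _ sc sk) kx.
set a := 'D_ _ c 0; set b := 'D_w l x.
have -> : row_mx a b = 1 *: row_mx a 0 + row_mx 0 b.
  by rewrite scale1r add_row_mx addr0 add0r.
rewrite (smooth_dir_linear (row_mx 0 0) sm) scale1r.
by rewrite local_law_dl// local_law_dr.
Unshelve. all: by end_near. Qed.

(** The right-invariant logarithmic derivative is Ad of the left-invariant one. *)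
Lemma hat_Ad n (Q : 'rV[R]_n -> G) x w : plotG Q ->
  'D_w (fun y => Defs.coord phi (Q y * (Q x)^-1)%g) x = Ad phi (Q x) (Theta phi Q x w).
Proof.
move=> pQ; have [k [sk kx k1 ->]] := Theta_at x pQ.
have [c [sc c0 c1 ->]] := Ad_at (Q x).
transitivity ('D_w (fun y => c (k y)) x); last first.
  by rewrite (derive_smooth_chain _ _ sc sk) kx.
apply: derive_near.
have c1' : \forall y \near x, (Q x * phi (k y) * (Q x)^-1)%g = phi (c (k y)).
  by apply: (near_smooth (P := fun z => (Q x * phi z * (Q x)^-1)%g = phi (c z)) sk); rewrite kx.
by apply: filterS2 k1 c1' => y -> ->; rewrite coordK.
Qed.

End LieCalculus.

(** * The bracket and the Maurer--Cartan equation *)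

Section LieAlgebra.
Context {R : realType} (G : smooth_group R) (d : nat) (phi : 'rV[R]_d -> G).
Hypothesis LC : unit_chart phi.
Let hphi1 := unit_chart_unit LC.
Notation plotG := (@plot R (group_space G) _).
Notation br := (bracket phi).

Lemma bracket_linear_r x : linear (br x).
Proof.
move=> a u w; rewrite /bracket.
have sA y : smooth (fun b => Ad phi (phi b) y) := Ad_smooth LC y (plotG_phi LC).
have E : (fun b => Ad phi (phi b) (a *: u + w)) =
    (a *: (fun b => Ad phi (phi b) u)) + (fun b => Ad phi (phi b) w).
  by apply/funext => b; exact: (Ad_linear LC).
have h := is_deriveD (is_deriveZ a (derivableP (smooth_derivable 0 x (sA u))))
  (derivableP (smooth_derivable 0 x (sA w))).
exact: etrans (congr1 (fun f => 'D_x f 0) E) (@derive_val _ _ _ _ _ _ _ h).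
Qed.

Lemma bracket_linear_l y : linear (br ^~ y).
Proof.
move=> a u w.
exact: (smooth_dir_linear 0 (Ad_smooth LC y (plotG_phi LC))).
Qed.

(** The mixed second derivative of the group law at the unit; the bracket is its
    antisymmetrisation. *)
Definition mixed_derivative (m : 'rV[R]_(d + d) -> 'rV[R]_d) x y :=
  'D_(row_mx x 0) (fun z => 'D_(row_mx 0 y) m z) (row_mx 0 0).
Notation mixed := mixed_derivative.

Lemma local_law_diff_r (m : 'rV[R]_(d + d) -> 'rV[R]_d) a (f : 'rV[R]_d -> 'rV[R]_d) b y :
  smooth m -> smooth f -> 
  'D_y (fun b => m (row_mx a (f b))) b = 'D_(row_mx 0 ('D_y f b)) m (row_mx a (f b)).
Proof.
move=> sm sf.
have sk : smooth (fun b => row_mx a (f b)) by apply: smooth_row_mx => //; exact: smooth_cst.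
rewrite (derive_smooth_chain b y sm sk).
have [_ ->] := derive_row_mx (@derivable_cst _ _ _ a b y) (smooth_derivable b y sf).
by rewrite derive_cst.
Qed.

Lemma local_law_diff_l (m : 'rV[R]_(d + d) -> 'rV[R]_d) a (f : 'rV[R]_d -> 'rV[R]_d) b y :
  smooth m -> smooth f ->
  'D_y (fun b => m (row_mx (f b) a)) b = 'D_(row_mx ('D_y f b) 0) m (row_mx (f b) a).
Proof.
move=> sm sf.
have sk : smooth (fun b => row_mx (f b) a) by apply: smooth_row_mx => //; exact: smooth_cst.
rewrite (derive_smooth_chain b y sm sk).
have [_ ->] := derive_row_mx (smooth_derivable b y sf) (@derivable_cst _ _ _ a b y).
by rewrite derive_cst.
Qed.

(** Left translation by [phi a] has the derivative [M a] at the unit, and [M a]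
    takes [Theta_a y] to [y]; this identity is differentiated at [a = 0]. *)
Lemma derive_Theta_phi m x y : local_law phi m ->
  'D_x (fun a => Theta phi phi a y) 0 = - mixed m x y.
Proof.
move=> lm; have [sm m1] := lm.
pose M a z := 'D_(row_mx 0 z) m (row_mx a 0).
have sT : smooth (fun a => Theta phi phi a y) := Theta_smooth LC y (plotG_phi LC).
have linM a : linear (M a).
  move=> c u w; rewrite /M.
  have -> : row_mx 0 (c *: u + w) = c *: row_mx 0 u + row_mx 0 w :> 'rV[R]_(d + d).
    by rewrite scale_row_mx add_row_mx scaler0 addr0.
  exact: smooth_dir_linear.
have sM z : smooth (fun a => M a z).
  apply: (smooth_comp_mx (f := fun w => 'D_(row_mx 0 z) m w)).
    exact: smooth_derive.
  exact: smooth_row_l.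
have inv : \forall a \near (0 : 'rV[R]_d), M a (Theta phi phi a y) = y.
  have pE : plotG (fun z : 'rV[R]_(d + d) => (phi (lsubmx z))^-1 * phi (rsubmx z))%g.
    apply: plotG_mul; first apply: plotG_inv.
      exact (plotG_comp LC (plotG_phi LC) (@smooth_lsubmx R d d)).
    exact (plotG_comp LC (plotG_phi LC) (@smooth_rsubmx R d d)).
  have [|L [sL L0 L1 L2]] := local_coord LC (x := row_mx 0 0) pE.
    by rewrite row_mxKl row_mxKr mulVg.
  have sk : smooth (fun z : 'rV[R]_(d + d) => row_mx (lsubmx z) (L z)).
    by apply: smooth_row_mx => //; exact: smooth_lsubmx.
  have m1' : \forall z \near row_mx 0 0,
      (phi (lsubmx (row_mx (lsubmx z) (L z))) * phi (rsubmx (row_mx (lsubmx z) (L z))))%g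
      = phi (m (row_mx (lsubmx z) (L z))).
    apply: (near_smooth (P := fun z => (phi (lsubmx z) * phi (rsubmx z))%g = phi (m z)) sk).
    by rewrite row_mxKl L0.
  have E : \forall z \near row_mx 0 0,
      m (row_mx (lsubmx z) (L z)) = rsubmx z /\
      Defs.coord phi ((phi (lsubmx z))^-1 * phi (rsubmx z))%g = L z.
    near=> z; split; last by near: z.
    have e1 : ((phi (lsubmx z))^-1 * phi (rsubmx z))%g = phi (L z) by near: z.
    have e2 : (phi (lsubmx (row_mx (lsubmx z) (L z))) * phi (rsubmx (row_mx (lsubmx z) (L z))))%g
      = phi (m (row_mx (lsubmx z) (L z))) by near: z.
    rewrite row_mxKl row_mxKr -e1 mulKVg in e2.
    by rewrite -(coordK LC (m _)) -e2 (coordK LC).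
  have := near_smooth (smooth_row_diag d) (near_near E).
  apply: filterS => a Ea.
  have Ea' := near_smooth (smooth_row_r a) Ea.
  have sLa : smooth (fun b => L (row_mx a b)) := smooth_comp_mx sL (smooth_row_r a).
  have La : L (row_mx a a) = 0.
    have [_] := nbhs_singleton Ea; rewrite row_mxKl row_mxKr mulVg => <-.
    by rewrite -hphi1 (coordK LC).
  have -> : Theta phi phi a y = 'D_y (fun b => L (row_mx a b)) a.
    apply: derive_near; apply: filterS Ea' => b [_].
    by rewrite row_mxKl row_mxKr.
  have := local_law_diff_r a a y sm sLa; rewrite La => h.
  rewrite /M -h.
  apply: etrans (derive_near (g := id) _ _) (derive_id _ _).
  by apply: filterS Ea' => b []; rewrite row_mxKl row_mxKr.
have e1 := @derive_val _ _ _ _ _ _ _ (is_derive_bilin linM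
  (fun e => smooth_derivable 0 x (sM e)) (smooth_derivable 0 x sT)).
have e2 : 'D_x (fun a => M a (Theta phi phi a y)) 0 = 0.
  apply: etrans (derive_near (g := fun=> y) x inv) _.
  exact: derive_cst.
have e3 : 'D_x (fun a => M a (Theta phi phi 0 y)) 0 = mixed m x y.
  rewrite (Theta_phi0 LC).
  apply: etrans (derive_smooth_chain (f := fun z => 'D_(row_mx 0 y) m z) (k := fun a => row_mx a 0) 0 x (smooth_derive _ sm) (smooth_row_l 0)) _.
  by rewrite derive_row_l.
have e4 u : M 0 u = u by exact (local_law_dr LC u lm).
have {}e1 := etrans (esym e2) (etrans e1 (congr2 +%R e3 (e4 _))).
by apply/eqP; rewrite -addr_eq0 addrC -e1.
Unshelve. all: by end_near. Qed.

(** The identity [D_2 m (a, 0) y = D_1 m (0, a) (Ad (phi a) y)], which expresses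
    that [a b = (a b a^-1) a], is differentiated at [a = 0]. *)
Lemma bracket_mixed m x y : local_law phi m ->
  br x y = mixed m x y - mixed m y x.
Proof.
move=> lm; have [sm m1] := lm.
pose M1 a z := 'D_(row_mx z 0) m (row_mx 0 a).
pose M2 a z := 'D_(row_mx 0 z) m (row_mx a 0).
have sA : smooth (fun a => Ad phi (phi a) y) := Ad_smooth LC y (plotG_phi LC).
have linM a : linear (M1 a).
  move=> c u w; rewrite /M1.
  have -> : row_mx (c *: u + w) 0 = c *: row_mx u 0 + row_mx w 0 :> 'rV[R]_(d + d).
    by rewrite scale_row_mx add_row_mx scaler0 addr0.
  exact: smooth_dir_linear.
have sM1 z : smooth (fun a => M1 a z).
  apply: (smooth_comp_mx (f := fun w => 'D_(row_mx z 0) m w)).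
    exact: smooth_derive.
  exact: smooth_row_r.
have inv : \forall a \near (0 : 'rV[R]_d), M2 a y = M1 a (Ad phi (phi a) y).
  have [C [sC C1 C2]] := Ad_repr LC 0 (plotG_phi LC).
  have sk : smooth (fun z : 'rV[R]_(d + d) => row_mx (C z) (lsubmx z)).
    by apply: smooth_row_mx => //; exact: smooth_lsubmx.
  have m1' : \forall z \near row_mx 0 0,
      (phi (lsubmx (row_mx (C z) (lsubmx z))) * phi (rsubmx (row_mx (C z) (lsubmx z))))%g
      = phi (m (row_mx (C z) (lsubmx z))).
    apply: (near_smooth (P := fun z => (phi (lsubmx z) * phi (rsubmx z))%g = phi (m z)) sk).
    by have [-> _] := nbhs_singleton C2; rewrite row_mxKl.
  have E : \forall z \near row_mx 0 0,
      m (row_mx (C z) (lsubmx z)) = m z.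
    near=> z.
    have e1 : (phi (lsubmx z) * phi (rsubmx z) * (phi (lsubmx z))^-1)%g = phi (C z) by near: z.
    have e2 : (phi (lsubmx (row_mx (C z) (lsubmx z))) * phi (rsubmx (row_mx (C z) (lsubmx z))))%g
      = phi (m (row_mx (C z) (lsubmx z))) by near: z.
    have e3 : (phi (lsubmx z) * phi (rsubmx z))%g = phi (m z) by near: z.
    rewrite row_mxKl row_mxKr -e1 mulgKV e3 in e2.
    by rewrite -(coordK LC (m (row_mx _ _))) -e2 (coordK LC).
  have := near_smooth (smooth_row_l 0) (near_near E).
  apply: filterS2 C2 => a [C0 CA] Ea.
  have Ea' := near_smooth (smooth_row_r a) Ea.
  have sCa : smooth (fun b => C (row_mx a b)) := smooth_comp_mx sC (smooth_row_r a).
  have CAy : Ad phi (phi a) y = 'D_y (fun b => C (row_mx a b)) 0.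
    by rewrite CA (derive_smooth_chain (k := row_mx a) 0 y sC (smooth_row_r a)) derive_row_r.
  have := local_law_diff_l a 0 y sm sCa; rewrite C0 -CAy /M1 => <-.
  have := local_law_diff_r a 0 y sm (@smooth_id R 1 d); rewrite derive_id /M2 => <-.
  apply: derive_near; apply: filterS Ea' => b.
  by rewrite row_mxKl => ->.
have e1 := @derive_val _ _ _ _ _ _ _ (is_derive_bilin linM
  (fun e => smooth_derivable 0 x (sM1 e)) (smooth_derivable 0 x sA)).
have e2 : 'D_x (fun a => M1 a (Ad phi (phi a) y)) 0 = mixed m x y.
  apply: etrans (esym (derive_near x inv)) _.
  apply: etrans (derive_smooth_chain (f := fun z => 'D_(row_mx 0 y) m z) (k := fun a => row_mx a 0) 0 x (smooth_derive _ sm) (smooth_row_l 0)) _.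
  by rewrite derive_row_l.
have e3 : 'D_x (fun a => M1 a (Ad phi (phi 0) y)) 0 = mixed m y x.
  rewrite hphi1 (Ad1 LC).
  apply: etrans (derive_smooth_chain (f := fun z => 'D_(row_mx y 0) m z) (k := fun a => row_mx 0 a) 0 x (smooth_derive _ sm) (smooth_row_r 0)) _.
  rewrite derive_row_r; exact: smooth_schwarz.
have e4 u : M1 0 u = u by exact (local_law_dl LC u lm).
have {}e1 : mixed m x y = mixed m y x + br x y :=
  etrans (esym e2) (etrans e1 (congr2 +%R e3 (e4 _))).
exact: (etrans (esym (addrK _ _)) (congr1 (fun z => z - mixed m y x)
  (etrans (addrC _ _) (esym e1)))).
Unshelve. all: by end_near. Qed.

Lemma bracket_antisym x y : br x y = - br y x.
Proof.
have [m lm] := local_law_ex LC.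
by rewrite !(bracket_mixed _ _ lm) opprB.
Qed.

Lemma addNBN (V : zmodType) (a b s t : V) : s = t ->
  (- a + s) - (- b + t) = - (a - b).
Proof. by move=> ->; rewrite opprD addrACA subrr addr0 opprB opprK addrC. Qed.

(** In the coordinates [k] centred at the point, the second derivatives of [k]
    cancel by symmetry; what is left are derivatives of the Maurer--Cartan form at
    the unit, that is, mixed derivatives of the group law. *)
Lemma maurer_cartan n (Q : 'rV[R]_n -> G) x v w : plotG Q ->
  'D_v (fun y => Theta phi Q y w) x - 'D_w (fun y => Theta phi Q y v) x =
  - br (Theta phi Q x v) (Theta phi Q x w).
Proof.
move=> pQ; have [m lm] := local_law_ex LC.
have [k [sk kx k1 k2]] := Theta_at LC x pQ.
pose T a z := Theta phi phi a z.
have sT z : smooth (fun a => T a z) := Theta_smooth LC z (plotG_phi LC).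
have linT y : linear (T (k y)) := Theta_linear LC (k y) (plotG_phi LC).
have E v' w' : 'D_v' (fun y => Theta phi Q y w') x =
    - mixed m ('D_v' k x) ('D_w' k x) + 'D_v' (fun y => 'D_w' k y) x.
  transitivity ('D_v' (fun y => T (k y) ('D_w' k y)) x).
    apply: derive_near; apply: filterS (near_near k1) => y ky.
    apply: etrans (@Theta_near R G d phi _ _ (fun z => Q x * phi (k z))%g y w' ky) _.
    apply: etrans (Theta_left phi (Q x) _ y w') _.
    exact (Theta_comp LC y w' (plotG_phi LC) sk).
  have sTk e : smooth (fun y => T (k y) e) := smooth_comp_mx (sT e) sk.
  apply: etrans (@derive_val _ _ _ _ _ _ _ (is_derive_bilin linT
    (fun e => smooth_derivable x v' (sTk e))
    (smooth_derivable x v' (smooth_derive w' sk)))) _.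
  congr (_ + _); last by rewrite kx /T (Theta_phi0 LC).
  apply: etrans (derive_smooth_chain x v' (sT ('D_w' k x)) sk) _.
  by rewrite kx; exact: derive_Theta_phi.
apply: etrans (congr2 (fun a b => a - b) (E v w) (E w v)) _.
rewrite !k2; apply: etrans _ (congr1 -%R (esym (bracket_mixed _ _ lm))).
exact (addNBN _ _ (smooth_schwarz x v w sk)).
Qed.

Section InnerProduct.
Variable ip : 'rV[R]_d -> 'rV[R]_d -> R.
Hypothesis hip : basic_inner_product phi ip.

Lemma ipC x y : ip x y = ip y x.
Proof. by case: hip. Qed.
Lemma ip_lin_l z a x y : ip (a *: x + y) z = a * ip x z + ip y z.
Proof. by case: hip. Qed.
Lemma ip_lin_r z a x y : ip z (a *: x + y) = a * ip z x + ip z y.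
Proof. by rewrite !(ipC z) ip_lin_l. Qed.
Lemma ip0l y : ip 0 y = 0.
Proof. by have := ip_lin_l y (-1) 0 0; rewrite scaler0 addr0 mulN1r addNr. Qed.
Lemma ip0r y : ip y 0 = 0. Proof. by rewrite ipC ip0l. Qed.
Lemma ipDl x y z : ip (x + y) z = ip x z + ip y z.
Proof. by have := ip_lin_l z 1 x y; rewrite scale1r mul1r. Qed.
Lemma ipDr x y z : ip z (x + y) = ip z x + ip z y.
Proof. by rewrite !(ipC z) ipDl. Qed.
Lemma ipZl a x z : ip (a *: x) z = a * ip x z.
Proof. by have := ip_lin_l z a x 0; rewrite ip0l !addr0. Qed.
Lemma ipNl x z : ip (- x) z = - ip x z.
Proof. by rewrite -scaleN1r ipZl mulN1r. Qed.
Lemma ipAd g x y : ip (Ad phi g x) (Ad phi g y) = ip x y.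
Proof. by case: hip. Qed.

(* The inner product as a 1 x 1 matrix, to which the Leibniz rule applies. *)
Let ipm (x y : 'rV[R]_d) : 'M[R]_1 := (ip x y)%:M.
Let ipmE x y : ip x y = ipm x y 0 0.
Proof. by rewrite mxE eqxx. Qed.
Let ipm_linear_r x : linear (ipm x).
Proof.
move=> a u w; rewrite /ipm ip_lin_r; apply/matrixP => i j.
by rewrite !mxE mulrnDl mulrnAr.
Qed.
Let ipm_linear_l x : linear (ipm ^~ x).
Proof.
move=> a u w; rewrite /ipm ip_lin_l; apply/matrixP => i j.
by rewrite !mxE mulrnDl mulrnAr.
Qed.

Lemma is_derive_ip (V : normedModType R) (f g : V -> 'rV[R]_d) x v df dg :
  is_derive x v f df -> is_derive x v g dg ->
  is_derive x v (fun y => ip (f y) (g y)) (ip df (g x) + ip (f x) dg).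
Proof.
move=> [f1 f2] [g1 g2].
have h1 z : is_derive x v (fun y => ipm (f y) z) (ipm df z).
  have := is_derive_bilin (G := fun (_ : V) e => ipm e z) (fun=> ipm_linear_l z)
    (fun e => @derivable_cst _ _ _ (ipm e z) x v) f1.
  by rewrite derive_cst add0r f2.
have h2 := is_derive_bilin (G := fun y e => ipm (f y) e) (fun y => ipm_linear_r (f y))
  (fun e => @ex_derive _ _ _ _ _ _ _ (h1 e)) g1.
have E : (fun y => ip (f y) (g y)) = (fun y => ipm (f y) (g y) 0 0).
  by apply/funext => y; exact: ipmE.
have [k1 k2] := h2; rewrite E; apply: DeriveDef.
  exact: (derivable_coord 0 0 k1).
rewrite -(derive_coord 0 0 k1) k2; have [_ ->] := h1 (g x).
by rewrite g2 !ipmE mxE.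
Qed.

Lemma smooth_ip (V : normedModType R) (f g : V -> 'rV[R]_d) :
  smooth f -> smooth g -> smooth (fun y => ip (f y) (g y)).
Proof.
move=> sf sg.
have h1 z : smooth (fun y => ipm (f y) z).
  apply: (smooth_bilin (G := fun (_ : V) e => ipm e z)) => //.
  by move=> e; exact: smooth_cst.
have h2 : smooth (fun y => ipm (f y) (g y)).
  by apply: (smooth_bilin (G := fun y e => ipm (f y) e)).
move=> k; apply: (Ck_ext (f := fun y => ipm (f y) (g y) 0 0)).
  by move=> y; rewrite -ipmE.
by move/smooth_mx : h2 => /(_ 0 0); exact.
Qed.

(** Infinitesimal form of the Ad-invariance. *)
Lemma ip_bracket x y z : ip (br x y) z = - ip y (br x z).
Proof.
have sA u : smooth (fun b => Ad phi (phi b) u) := Ad_smooth LC u (plotG_phi LC).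
have := is_derive_ip (derivableP (smooth_derivable 0 x (sA y)))
  (derivableP (smooth_derivable 0 x (sA z))).
rewrite (_ : (fun b => _) = fun=> ip y z); last first.
  by apply/funext => b; rewrite ipAd.
move=> [_]; rewrite derive_cst hphi1 !(Ad1 LC) => /esym/eqP.
by rewrite addr_eq0 => /eqP.
Qed.

(** Invariance and antisymmetry together make [ip (br x y) z] cyclic. *)
Lemma ip_bracket_rot x y z : ip (br x y) z = ip (br y z) x.
Proof.
apply: etrans (congr1 (ip^~ z) (bracket_antisym x y)) _.
apply: etrans (ipNl _ _) _; apply: etrans (congr1 -%R (ip_bracket y x z)) _.
exact: etrans (opprK _) (ipC _ _).
Qed.

End InnerProduct.
End LieAlgebra.

(** * Smooth families of paths *)

Section Paths.
Context {R : realType} (G : smooth_group R) (d : nat) (phi : 'rV[R]_d -> G).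
Hypothesis LC : unit_chart phi.
Let dG := unit_chart_diffeology LC.
Notation plotG := (@plot R (group_space G) _).
Notation br := (bracket phi).
Notation pth := (path_plot (G := G)).

Lemma clamp_Icl (t : R) : Icl (clamp t).
Proof.
have t0 := ltW (@tau_gt0 R); rewrite /Icl /clamp /=.
by rewrite le_max lexx /= ge_max t0 /= ge_min lexx orbT.
Qed.

Lemma clamp_id (t : R) : Icl t -> clamp t = t.
Proof. by move=> /andP[a b]; rewrite /clamp (min_idPl b) (max_idPr a). Qed.

Lemma Icl0 : Icl (0 : R).
Proof. by rewrite /Icl /= lexx (ltW (@tau_gt0 R)). Qed.
Lemma Icl_tau : Icl (2 * pi : R).
Proof. by rewrite /Icl /= lexx (ltW (@tau_gt0 R)). Qed.

Lemma path_ext n (P : 'rV[R]_n -> R -> G) u t : pth P -> Icl t ->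
  exists2 Q : 'rV[R]_(n + 1) -> G, plotG Q &
    \forall x \near strip u t, Icl (time x) -> P (lsubmx x) (time x) = Q x.
Proof.
move=> [_ _ sP] It; have [|Q pQ QP] := sP (strip u t).
  by rewrite /= -/(time _) time_strip.
by exists Q.
Qed.

Lemma derive_strip n (u v : 'rV[R]_n) t : 'D_v (fun u => strip u t) u = strip v 0.
Proof.
by rewrite /strip derive_row_l; congr row_mx.
Qed.

Lemma smooth_strip_u n t : smooth (fun u : 'rV[R]_n => strip u t).
Proof. exact: smooth_row_l. Qed.

Lemma path_slice n (P : 'rV[R]_n -> R -> G) t : pth P -> plotG (fun u => P u t).
Proof.
move=> pP; have [_ Pc _] := pP.
have -> : (fun u => P u t) = (fun u => P u (clamp t)).
  by apply/funext => u; exact: Pc.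
case: dG => _ _; apply => u.
have [Q pQ QP] := path_ext u pP (clamp_Icl t).
exists (fun u => Q (strip u (clamp t))).
  exact (plotG_comp LC pQ (@smooth_strip_u n _)).
apply: filterS (near_strip_u QP) => u'.
by rewrite time_strip lsubmx_strip; apply; exact: clamp_Icl.
Qed.

Lemma path_Theta_ext n (P : 'rV[R]_n -> R -> G) (Q : 'rV[R]_(n + 1) -> G)
    (I : set R) v x : plotG Q -> I (time x) ->
  (\forall z \near x, I (time z) -> P (lsubmx z) (time z) = Q z) ->
  path_Theta phi P (lsubmx x) v (time x) = Theta phi Q x (strip v 0).
Proof.
move=> pQ Ix PQ; rewrite /path_Theta.
have h : \forall u' \near lsubmx x, P u' (time x) = Q (strip u' (time x)).
  have := PQ; rewrite -{1}(stripK x) => /near_strip_u.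
  by apply: filterS => u'; rewrite time_strip lsubmx_strip; apply.
apply: etrans (@Theta_near R G d phi _ _ _ (lsubmx x) v h) _.
apply: etrans (Theta_comp LC (lsubmx x) v pQ (@smooth_strip_u n _)) _.
by rewrite stripK derive_strip.
Qed.

Lemma path_Theta_adm n (P : 'rV[R]_n -> R -> G) v : pth P ->
  adm Icl (fun u t => path_Theta phi P u v t).
Proof.
move=> pP; split=> u t It; have [Q pQ QP] := path_ext u pP It.
exists (fun x => Theta phi Q x (strip v 0)); first exact: (Theta_smooth LC).
by apply: filterS (near_near QP) => x hx Ix; exact: path_Theta_ext hx.
Qed.

Lemma path_AdV_adm n (P : 'rV[R]_n -> R -> G) y : pth P ->
  adm Icl (fun u t => Ad phi (P u t)^-1%g y).
Proof.
move=> pP; split=> u t It; have [Q pQ QP] := path_ext u pP It.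
exists (fun x => Ad phi (Q x)^-1%g y).
  by apply: (Ad_smooth LC) (plotG_inv pQ).
by apply: filterS QP => x hx Ix; rewrite hx.
Qed.

Lemma path_int n (P : 'rV[R]_n -> R -> G) u t : pth P -> Iop t ->
  exists2 Q : 'rV[R]_(n + 1) -> G, plotG Q &
    \forall x \near strip u t, P (lsubmx x) (time x) = Q x /\ Iop (time x).
Proof.
move=> pP It; have [Q pQ QP] := path_ext u pP (IopW It); exists Q => //.
have It' : \forall x \near strip u t, Iop (time x).
  have := smooth_continuous (@smooth_time R n) (strip u t).
  by rewrite /continuous_at time_strip => /(_ _ (near_Iop It)).
by apply: filterS2 It' QP => x Ix hx; split => //; apply: hx; exact: IopW.
Qed.

Lemma path_Theta_int n (P : 'rV[R]_n -> R -> G) (Q : 'rV[R]_(n + 1) -> G) v x :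
  plotG Q -> (\forall z \near x, P (lsubmx z) (time z) = Q z) ->
  path_Theta phi P (lsubmx x) v (time x) = Theta phi Q x (strip v 0).
Proof.
by move=> pQ h; apply: (path_Theta_ext (I := setT)) => //; apply: filterS h.
Qed.

Lemma hat_phi_int n (P : 'rV[R]_n -> R -> G) (Q : 'rV[R]_(n + 1) -> G) x :
  plotG Q -> (\forall z \near x, P (lsubmx z) (time z) = Q z) ->
  hat_phi phi (P (lsubmx x)) (time x) = Ad phi (Q x) (Theta phi Q x (strip 0 1)).
Proof.
move=> pQ PQ; apply: etrans _ (hat_Ad LC x (strip 0 1) pQ).
have pE : plotG (fun y => Q y * (Q x)^-1)%g.
  by apply: plotG_mul => //; exact: (plotG_cst LC).
have [|h [sh _ _ h2]] := local_coord LC (x := x) pE; first exact: mulgV.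
apply: etrans _ (esym (derive_near (strip 0 1) h2)).
have [_ E] := is_derive_strip_t (lsubmx x) (time x) sh.
rewrite stripK in E; rewrite -E /hat_phi derive1E; apply: near_eq_derive.
have Px : P (lsubmx x) (time x) = Q x by exact: nbhs_singleton PQ.
have : \forall z \near strip (lsubmx x) (time x), P (lsubmx z) (time z) = Q z /\
    Defs.coord phi (Q z * (Q x)^-1)%g = h z.
  by rewrite stripK; apply: filterS2 PQ h2 => z.
move=> /near_strip_t.
by apply: filterS => t'; rewrite time_strip lsubmx_strip Px => -[-> <-].
Qed.

Lemma Ad_Theta_smooth n (Q : 'rV[R]_n -> G) w : plotG Q ->
  smooth (fun x => Ad phi (Q x) (Theta phi Q x w)).
Proof.
move=> pQ; apply: (smooth_bilin (G := fun x e => Ad phi (Q x) e)).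
- by move=> y; exact: (Ad_linear LC).
- by move=> e; exact: (Ad_smooth LC).
- exact: (Theta_smooth LC).
Qed.

Lemma hat_phi_adm n (P : 'rV[R]_n -> R -> G) : pth P ->
  adm Iop (fun u t => hat_phi phi (P u) t).
Proof.
move=> pP; split=> u t It; have [Q pQ QP] := path_ext u pP It.
exists (fun x => Ad phi (Q x) (Theta phi Q x (strip 0 1))).
  exact: Ad_Theta_smooth.
apply: filterS (near_near QP) => x hx Ix; apply: hat_phi_int => //.
have Ix' : \forall z \near x, Iop (time z).
  exact: (smooth_continuous (@smooth_time R n) x _ (near_Iop Ix)).
by apply: filterS2 Ix' hx => z Iz; apply; exact: IopW.
Qed.

Lemma path_Theta_linear n (P : 'rV[R]_n -> R -> G) u t : pth P ->
  linear (fun v => path_Theta phi P u v t).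
Proof. by move=> pP; exact: (Theta_linear LC u (path_slice t pP)). Qed.

Lemma path_mul_plot n (P Q : 'rV[R]_n -> R -> G) : pth P -> pth Q ->
  pth (fun u => path_mul (P u) (Q u)).
Proof.
move=> pP pQ; have [P0 Pc Ps] := pP; have [Q0 Qc Qs] := pQ; split.
- by move=> u; rewrite /path_mul P0 Q0 mulg1.
- by move=> u t; rewrite /path_mul -Pc -Qc.
- move=> x Sx; have [P' pP' PP] := Ps x Sx; have [Q' pQ' QQ] := Qs x Sx.
  exists (fun x => P' x * Q' x)%g; first exact: plotG_mul.
  by apply: filterS2 PP QQ => z Pz Qz Sz; rewrite /path_mul Pz// Qz.
Qed.

Lemma path_inv_plot n (P : 'rV[R]_n -> R -> G) : pth P ->
  pth (fun u t => (P u t)^-1%g).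
Proof.
move=> pP; have [P0 Pc Ps] := pP; split.
- by move=> u; rewrite P0 invg1.
- by move=> u t; rewrite -Pc.
- move=> x Sx; have [P' pP' PP] := Ps x Sx.
  exists (fun x => (P' x)^-1)%g; first exact: plotG_inv.
  by apply: filterS PP => z Pz Sz; rewrite Pz.
Qed.

Lemma path_comp_plot n m (P : 'rV[R]_n -> R -> G) (h : 'rV[R]_m -> 'rV[R]_n) :
  pth P -> smooth h -> pth (fun u => P (h u)).
Proof.
move=> pP sh; have [P0 Pc Ps] := pP; split.
- by move=> u; exact: P0.
- by move=> u t; exact: Pc.
- move=> x Sx; have Ix : Icl (time x) by exact: Sx.
  have [Q pQ QP] := path_ext (h (lsubmx x)) pP Ix.
  have sk : smooth (fun x : 'rV[R]_(m + 1) => strip (h (lsubmx x)) (time x)).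
    apply: smooth_strip; last exact: smooth_time.
    by apply: smooth_comp_mx => //; exact: smooth_lsubmx.
  exists (fun x => Q (strip (h (lsubmx x)) (time x))).
    exact (plotG_comp LC pQ sk).
  have := near_smooth (t := x) (P := fun z => Icl (time z) -> P (lsubmx z) (time z) = Q z) sk QP.
  apply: filterS => z; rewrite time_strip lsubmx_strip => hz Sz.
  by apply: hz; exact: Sz.
Qed.

Lemma path_Theta_mul n (P Q : 'rV[R]_n -> R -> G) u v t : pth P -> pth Q ->
  path_Theta phi (fun u => path_mul (P u) (Q u)) u v t =
  Ad phi (Q u t)^-1%g (path_Theta phi P u v t) + path_Theta phi Q u v t.
Proof.
by move=> pP pQ; exact: (Theta_mul LC u v (path_slice t pP) (path_slice t pQ)).
Qed.

Lemma hat_phi_mul n (P Q : 'rV[R]_n -> R -> G) u t : pth P -> pth Q -> Iop t ->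
  hat_phi phi (path_mul (P u) (Q u)) t =
  hat_phi phi (P u) t + Ad phi (P u t) (hat_phi phi (Q u) t).
Proof.
move=> pP pQ It.
have [P' pP' PP] := path_int u pP It; have [Q' pQ' QQ] := path_int u pQ It.
have PP1 : \forall z \near strip u t, P (lsubmx z) (time z) = P' z.
  by apply: filterS PP => z [].
have QQ1 : \forall z \near strip u t, Q (lsubmx z) (time z) = Q' z.
  by apply: filterS QQ => z [].
have PQ : \forall z \near strip u t,
    path_mul (P (lsubmx z)) (Q (lsubmx z)) (time z) = (P' z * Q' z)%g.
  by apply: filterS2 PP1 QQ1 => z e1 e2; rewrite /path_mul e1 e2.
have e1 := hat_phi_int pP' PP1; have e2 := hat_phi_int pQ' QQ1.
have e3 := hat_phi_int (P := fun u => path_mul (P u) (Q u)) (plotG_mul pP' pQ') PQ.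
have eP := nbhs_singleton PP1.
rewrite lsubmx_strip time_strip in e1 e2 e3 eP.
apply: etrans e3 _; apply: etrans (congr1 _ (Theta_mul LC _ _ pP' pQ')) _.
apply: etrans _ (esym (congr2 +%R e1 (congr2 (Ad phi) eP e2))).
have AdD g a b : Ad phi g (a + b) = Ad phi g a + Ad phi g b.
  by have := Ad_linear LC g 1 a b; rewrite !scale1r.
apply: etrans (AdD _ _ _) _.
apply: congr2; last exact (Ad_mul LC _ _ _).
by apply: etrans (Ad_mul LC _ _ _) _; exact: congr1 _ (AdVK LC _ _).
Qed.

Lemma path_maurer_cartan n (P : 'rV[R]_n -> R -> G) u v w t : pth P ->
  'D_v (fun u => path_Theta phi P u w t) u - 'D_w (fun u => path_Theta phi P u v t) u
  = - br (path_Theta phi P u v t) (path_Theta phi P u w t).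
Proof. by move=> pP; exact: (maurer_cartan LC u v w (path_slice t pP)). Qed.

(** [hat_phi] is Ad of the time component of the Maurer--Cartan form, so this is
    the Maurer--Cartan equation for one parameter direction and time. *)
Lemma derive_hat_phi n (P : 'rV[R]_n -> R -> G) u v t : pth P -> Iop t ->
  'D_v (fun u => hat_phi phi (P u) t) u =
  Ad phi (P u t) (derive1 (path_Theta phi P u v) t).
Proof.
move=> pP It; have [Q pQ PQ] := path_int u pP It.
have PQ1 : \forall z \near strip u t, P (lsubmx z) (time z) = Q z.
  by apply: filterS PQ => z [].
pose T w x := Theta phi Q x w.
have sT w : smooth (T w) by exact: (Theta_smooth LC).
have sH := Ad_Theta_smooth (strip 0 1) pQ.
have eP := nbhs_singleton PQ1; rewrite lsubmx_strip time_strip in eP.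
have E1 : 'D_v (fun u => hat_phi phi (P u) t) u =
    'D_(strip v 0) (fun x => Ad phi (Q x) (T (strip 0 1) x)) (strip u t).
  have [_ <-] := is_derive_strip_u u t v sH; apply: derive_near.
  apply: filterS (near_strip_u (near_near PQ1)) => u' h.
  by have := hat_phi_int pQ h; rewrite lsubmx_strip time_strip.
have E2 : derive1 (path_Theta phi P u v) t = 'D_(strip 0 1) (T (strip v 0)) (strip u t).
  have [_ <-] := is_derive_strip_t u t (sT (strip v 0)).
  rewrite derive1E; apply: near_eq_derive.
  apply: filterS (near_strip_t (near_near PQ1)) => t' h.
  by have := path_Theta_int v pQ h; rewrite lsubmx_strip time_strip.
rewrite E1 E2 eP.
have linA y : linear (Ad phi (Q y)) by exact: (Ad_linear LC).
have sA e : smooth (fun x => Ad phi (Q x) e) := Ad_smooth LC e pQ.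
apply: etrans (@derive_val _ _ _ _ _ _ _ (is_derive_bilin linA
  (fun e => smooth_derivable (strip u t) (strip v 0) (sA e))
  (smooth_derivable (strip u t) (strip v 0) (sT (strip 0 1))))) _.
apply: etrans (congr1 (+%R^~ _) (derive_Ad LC _ _ _ pQ)) _.
have AdD g a b : Ad phi g (a + b) = Ad phi g a + Ad phi g b.
  by have := Ad_linear LC g 1 a b; rewrite !scale1r.
apply: etrans (esym (AdD _ _ _)) _; congr (Ad phi _ _).
have := maurer_cartan LC (strip u t) (strip v 0) (strip 0 1) pQ.
move=> h; apply/eqP; rewrite addrC -subr_eq0; apply/eqP.
have h2 := congr1 (+%R^~ (br (T (strip v 0) (strip u t)) (T (strip 0 1) (strip u t)))) h.
rewrite -[RHS](addNr (br (T (strip v 0) (strip u t)) (T (strip 0 1) (strip u t)))).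
exact: etrans (addrAC _ _ _) h2.
Qed.

Lemma Theta_inv n (Q : 'rV[R]_n -> G) x w : plotG Q ->
  Theta phi (fun y => (Q y)^-1)%g x w = - Ad phi (Q x) (Theta phi Q x w).
Proof.
move=> pQ; have h := Theta_mul LC x w pQ (plotG_inv pQ).
rewrite invgK in h.
have e : (fun y => Q y * (Q y)^-1)%g = fun=> 1%g.
  by apply/funext => y; rewrite mulgV.
have h2 : 0 = Ad phi (Q x) (Theta phi Q x w) + Theta phi (fun y => (Q y)^-1)%g x w.
  apply: etrans _ h; apply: etrans (esym (Theta_cst phi 1%g x w)) _.
  by rewrite -e.
by apply/eqP; rewrite -addr_eq0 addrC -h2.
Qed.

(** [derive_Ad] for the inverse path, whose Maurer--Cartan form is
    [- Ad q (Theta q)] by [Theta_inv]. *)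
Lemma derive_t_AdV n (P : 'rV[R]_n -> R -> G) u t (f : R -> 'rV[R]_d) :
  pth P -> Iop t -> derivable f t 1 ->
  is_derive t (1 : R) (fun t => Ad phi (P u t)^-1%g (f t))
    (Ad phi (P u t)^-1%g (derive1 f t + br (f t) (hat_phi phi (P u) t))).
Proof.
move=> pP It df; have [Q pQ PQ] := path_int u pP It.
have PQ1 : \forall z \near strip u t, P (lsubmx z) (time z) = Q z.
  by apply: filterS PQ => z [].
have eP := nbhs_singleton PQ1; rewrite lsubmx_strip time_strip in eP.
have eh := hat_phi_int pQ PQ1; rewrite lsubmx_strip time_strip in eh.
have linA t' : linear (Ad phi (P u t')^-1%g) by exact: (Ad_linear LC).
have dA e : is_derive t (1 : R) (fun t' => Ad phi (P u t')^-1%g e)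
    (Ad phi (P u t)^-1%g (br e (hat_phi phi (P u) t))).
  have pV := plotG_inv pQ.
  have sA : smooth (fun x => Ad phi (Q x)^-1%g e) := Ad_smooth LC e pV.
  have [k1 k2] := is_derive_strip_t u t sA.
  have near_e : \forall t' \near t, Ad phi (P u t')^-1%g e = Ad phi (Q (strip u t'))^-1%g e.
    apply: filterS (near_strip_t PQ1) => t'.
    by rewrite lsubmx_strip time_strip => ->.
  apply: DeriveDef.
    by apply: near_eq_derivable k1; apply: filterS near_e => t' ->.
  apply: etrans (near_eq_derive (1 : R) near_e) _; apply: etrans k2 _.
  apply: etrans (derive_Ad LC (strip u t) (strip 0 1) e pV) _.
  apply: etrans _ (congr1 (fun g => Ad phi g^-1%g (br e (hat_phi phi (P u) t))) (esym eP)).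
  apply: congr1; apply: etrans (bracket_antisym LC _ _) _.
  apply: etrans (congr1 (fun z => - br e z) (Theta_inv _ _ pQ)) _.
  apply: etrans _ (congr1 (br e) (esym eh)).
  have brN a b : br a (- b) = - br a b.
    have := bracket_linear_r LC a (-1) b 0.
    rewrite scaleN1r addr0 => ->.
    have -> : br a 0 = 0.
      by have := bracket_linear_r LC a (-1) 0 0; rewrite scaler0 addr0 scaleN1r addNr.
    by rewrite addr0 scaleN1r.
  exact: etrans (congr1 -%R (brN _ _)) (opprK _).
have h := is_derive_bilin linA (fun e => @ex_derive _ _ _ _ _ _ _ (dA e)) df.
apply: is_derive_eq h _.
have AdD g a b : Ad phi g (a + b) = Ad phi g a + Ad phi g b.
  by have := Ad_linear LC g 1 a b; rewrite !scale1r.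
apply: etrans _ (esym (AdD _ _ _)); rewrite addrC.
apply: congr2; first by rewrite derive1E.
exact: (@derive_val _ _ _ _ _ _ _ (dA (f t))).
Qed.

End Paths.

(** * Algebraic identities for an invariant inner product *)

Section InvariantAlgebra.
Variables (R : realFieldType) (V : zmodType) (ip : V -> V -> R) (br : V -> V -> V).
Hypothesis ipC : forall x y, ip x y = ip y x.
Hypothesis ipD : forall x y z, ip (x + y) z = ip x z + ip y z.
Hypothesis ipN : forall x z, ip (- x) z = - ip x z.
Hypothesis rot : forall x y z, ip (br x y) z = ip (br y z) x.

(** The density of dB at one time.  Here [x_i] stands for Theta in the direction
    [v_i], [b_i] for its time derivative, [a_ij] for the derivative of [x_j] in the
    direction [v_i] and [e_ij] for the time derivative of [a_ij].  The hypotheses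
    are the Maurer--Cartan equation and its time derivative; the right-hand side is
    the time derivative of [ip (br x0 x1) x2]. *)
Lemma cyclic_cocycle (x0 x1 x2 b0 b1 b2 a01 a10 a12 a21 a02 a20
    e01 e10 e12 e21 e02 e20 : V) :
  a01 - a10 = - br x0 x1 -> a12 - a21 = - br x1 x2 -> a20 - a02 = - br x2 x0 ->
  e01 - e10 = - (br b0 x1 + br x0 b1) -> e12 - e21 = - (br b1 x2 + br x1 b2) ->
  e20 - e02 = - (br b2 x0 + br x2 b0) ->
  (ip a01 b2 + ip x1 e02 - (ip a02 b1 + ip x2 e01)) +
  (ip a12 b0 + ip x2 e10 - (ip a10 b2 + ip x0 e12)) +
  (ip a20 b1 + ip x0 e21 - (ip a21 b0 + ip x1 e20)) =
  ip (br b0 x1 + br x0 b1) x2 + ip (br x0 x1) b2.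
Proof.
move=> h1 h2 h3 h4 h5 h6.
have k1 := congr1 (ip^~ b2) h1; have k2 := congr1 (ip^~ b0) h2.
have k3 := congr1 (ip^~ b1) h3; have k4 := congr1 (ip^~ x2) h4.
have k5 := congr1 (ip^~ x0) h5; have k6 := congr1 (ip^~ x1) h6.
move: k1 k2 k3 k4 k5 k6; rewrite /= !(ipD, ipN).
rewrite !(ipC x0) !(ipC x1) !(ipC x2).
rewrite (rot b1 x2 x0) (rot x2 x0 b1) (rot x1 b2 x0) (rot b2 x0 x1).
rewrite (rot x1 x2 b0) (rot x2 b0 x1).
lra.
Qed.

Variables (A B : V -> V).
Hypothesis AD : forall x y, A (x + y) = A x + A y.
Hypothesis ipA : forall x y, ip (A x) (A y) = ip x y.
Hypothesis AB : forall x, A (B x) = x.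
Hypothesis anti : forall x y, br x y = - br y x.

(** The change of the density of B under [p |-> p q] at one time.  The letters
    [p] and [g] stand for Theta of the two paths, primes for time derivatives, [A]
    for [Ad q^-1], [B] for [Ad q] and [h] for [hat_phi q].  The factor 2 multiplies
    the density of d epsilon, and the last line is a time derivative. *)
Lemma gauge_cocycle (pv pw p'v p'w gv gw g'v g'w h dvw dwv : V) :
  dvw - dwv = - br pv pw ->
  ip (A pv + gv) (A (p'w + br pw h) + g'w) - ip (A pw + gw) (A (p'v + br pv h) + g'v) =
  (ip pv p'w - ip pw p'v) + (ip gv g'w - ip gw g'v)
  - 2 * ((ip dvw h + ip pw (B g'v)) - (ip dwv h + ip pv (B g'w)))
  + ((ip g'v (A pw) + ip gv (A (p'w + br pw h)))
     - (ip g'w (A pv) + ip gw (A (p'v + br pv h)))).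
Proof.
move=> e; have {e} := congr1 (ip^~ h) e; rewrite /= !(ipD, ipN) => e.
rewrite -(ipA pw (B g'v)) -(ipA pv (B g'w)) !AB.
have ipDr z x y : ip z (x + y) = ip z x + ip z y by rewrite !(ipC z) ipD.
rewrite !ipDr !AD !ipDr !ipA.
have r1 : ip pv (br pw h) = ip (br pv pw) h by rewrite ipC -rot.
have r2 : ip pw (br pv h) = - ip (br pv pw) h by rewrite ipC -rot anti ipN.
rewrite r1 r2 (ipC g'v) (ipC g'w).
lra.
Qed.

End InvariantAlgebra.

(** * Differential forms and alternating maps *)

Section FormAlgebra.
Context {R : realType}.
Implicit Types X Y : pspace R.

Lemma is_form_sub k X (w w' : diff_form k X) :
  is_form w -> is_form w' -> is_form (sub_form w w').
Proof.
move=> fw fw'; split.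
- move=> n P v pP; apply: smooth_add; first exact: (form_smooth fw).
  by apply: smooth_opp; exact: (form_smooth fw').
- move=> n P Q u v pP pQ PQ; rewrite /sub_form.
  by rewrite (form_local fw v pP pQ PQ) (form_local fw' v pP pQ PQ).
- move=> m n P h u v pP sh; rewrite /sub_form.
  by rewrite (form_comp fw u v pP sh) (form_comp fw' u v pP sh).
- move=> n P u v i a x y pP; rewrite /sub_form.
  by rewrite (form_linear fw)// (form_linear fw')//; ring.
- move=> n P u v i j pP ij vij; rewrite /sub_form.
  by rewrite (form_alternating fw u pP ij vij) (form_alternating fw' u pP ij vij) subrr.
Qed.

Lemma is_form_pullback k X Y (f : X -> Y) (w : diff_form k Y) :
  smooth_map f -> is_form w -> is_form (pullback f w).
Proof.
move=> sf fw; split.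
- by move=> n P v /sf pP; exact: (form_smooth fw).
- move=> n P Q u v /sf pP /sf pQ PQ; apply: (form_local fw) => //.
  by apply: filterS PQ => z /= ->.
- by move=> m n P h u v /sf pP sh; exact: (form_comp fw).
- by move=> n P u v i a x y /sf pP; exact: (form_linear fw).
- by move=> n P u v i j /sf pP; exact: (form_alternating fw).
Qed.

Lemma form_eq_is_form k X (w w' : diff_form k X) :
  (forall m n (P : 'rV[R]_n -> X) (h : 'rV[R]_m -> 'rV[R]_n),
     plot X P -> smooth h -> plot X (P \o h)) ->
  form_eq w w' -> is_form w -> is_form w'.
Proof.
move=> cX ww fw; split.
- move=> n P v pP.
  have e u : w n P u v = w' n P u v by exact: ww.
  by move=> l; exact: (Ck_ext e (form_smooth fw v pP l)).
- move=> n P Q u v pP pQ PQ; rewrite -(ww _ _ _ _ pP) -(ww _ _ _ _ pQ).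
  exact: (form_local fw).
- move=> m n P h u v pP sh; rewrite -(ww _ _ _ _ pP) -(ww _ _ _ _ (cX _ _ _ _ pP sh)).
  exact: (form_comp fw).
- by move=> n P u v i a x y pP; rewrite -!(ww _ _ _ _ pP); exact: (form_linear fw).
- by move=> n P u v i j pP ij vij; rewrite -(ww _ _ _ _ pP); exact: (form_alternating fw u pP ij vij).
Qed.

Lemma upd_eq (I : eqType) T (v : I -> T) i x : upd v i x i = x.
Proof. by rewrite /upd eqxx. Qed.
Lemma upd_neq (I : eqType) T (v : I -> T) i j x : j != i -> upd v i x j = v j.
Proof. by rewrite /upd => /negbTE ->. Qed.

Lemma ord2P (i : 'I_2) : i = ord0 \/ i = ord_max.
Proof. by case: i => [[|[|//]]] Hi; [left|right]; exact: val_inj. Qed.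

Lemma inord1_3 : (inord 1 : 'I_3) = Ordinal (isT : 1 < 3)%N.
Proof. by apply: val_inj; rewrite /= inordK. Qed.

Lemma ord3P (i : 'I_3) : [\/ i = ord0, i = inord 1 | i = ord_max].
Proof.
rewrite inord1_3; case: i => [[|[|[|//]]]] Hi;
  [constructor 1|constructor 2|constructor 3]; exact: val_inj.
Qed.

(** Turns the symmetries of the coefficients of a 2-form into the two conditions
    on its tangent vectors. *)
Lemma bilinear_alternating2 (V : lmodType R) (b : V -> V -> R) :
  (forall z a x y, b (a *: x + y) z = a * b x z + b y z) ->
  (forall x y, b x y = - b y x) ->
  (forall (v : 'I_2 -> V) i a x y,
     b (upd v i (a *: x + y) ord0) (upd v i (a *: x + y) ord_max) =
     a * b (upd v i x ord0) (upd v i x ord_max) +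
     b (upd v i y ord0) (upd v i y ord_max)) /\
  (forall (v : 'I_2 -> V) i j, i != j -> v i = v j -> b (v ord0) (v ord_max) = 0).
Proof.
move=> lin anti.
have n01 : (ord0 : 'I_2) != ord_max by [].
have b0 x : b x x = 0.
  by have := anti x x; move: (b x x) => r; lra.
split=> [v i a x y|v i j].
  have [->|->] := ord2P i.
    by rewrite !upd_eq !(upd_neq v _ (_ : ord_max != ord0)).
  rewrite !upd_eq !(upd_neq v _ n01) (anti (v ord0)) lin.
  by rewrite (anti (v ord0) x) (anti (v ord0) y) mulrN opprD.
have [->|->] := ord2P i; have [->|->] := ord2P j => //; rewrite ?eqxx// => _ e.
  by rewrite e b0.
by rewrite -e b0.
Qed.

(** The analogue for 3-forms, where cyclicity reduces linearity in all arguments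
    to the first one. *)
Lemma trilinear_alternating3 (V : lmodType R) (b : V -> V -> V -> R) :
  (forall y z a x x', b (a *: x + x') y z = a * b x y z + b x' y z) ->
  (forall x y z, b x y z = - b y x z) -> (forall x y z, b x y z = b y z x) ->
  (forall (v : 'I_3 -> V) i a x y,
     b (upd v i (a *: x + y) ord0) (upd v i (a *: x + y) (inord 1)) (upd v i (a *: x + y) ord_max) =
     a * b (upd v i x ord0) (upd v i x (inord 1)) (upd v i x ord_max) +
     b (upd v i y ord0) (upd v i y (inord 1)) (upd v i y ord_max)) /\
  (forall (v : 'I_3 -> V) i j, i != j -> v i = v j ->
     b (v ord0) (v (inord 1)) (v ord_max) = 0).
Proof.
move=> lin anti rot; rewrite inord1_3; set o1 := Ordinal _.
have b0 x y : b x x y = 0.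
  by have := anti x x y; move: (b x x y) => r; lra.
split=> [v i a x y|v i j].
  have := ord3P i; rewrite inord1_3 -/o1 => -[] ->.
  - by rewrite !upd_eq !(upd_neq v _ (_ : o1 != ord0))// !(upd_neq v _ (_ : ord_max != ord0)).
  - rewrite !upd_eq !(upd_neq v _ (_ : ord0 != o1))// !(upd_neq v _ (_ : ord_max != o1))//.
    by rewrite !(rot (v ord0)) lin.
  - rewrite !upd_eq !(upd_neq v _ (_ : ord0 != ord_max))// !(upd_neq v _ (_ : o1 != ord_max))//.
    by rewrite -!(rot _ (v ord0)) lin.
have := ord3P i; have := ord3P j; rewrite inord1_3 -/o1.
move=> [] -> [] -> => //; rewrite ?eqxx// => _ e.
- by rewrite e b0.
- by rewrite rot rot e b0.
- by rewrite e b0.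
- by rewrite rot e b0.
- by rewrite rot rot e b0.
- by rewrite rot e b0.
Qed.

(** Every permutation is a product of transpositions, so all the summands are
    equal. *)
Lemma alt_alternating k (V : Type) (f : ('I_k -> V) -> R) v :
  (forall w i j, i != j -> f (fun l => w (tperm i j l)) = - f w) ->
  alt f v = f v.
Proof.
move=> falt.
have fs (s : 'S_k) w : f (fun l => w (s l)) = (-1) ^+ s * f w.
  have [ts -> dts] := prod_tpermP s.
  elim: ts dts w => [_ w|[i j] ts IH /= /andP[ij dts] w].
    rewrite big_nil odd_perm1 mul1r; congr f; apply/funext => l.
    by rewrite perm1.
  rewrite big_cons odd_mul_tperm /= ij signr_addb expr1.
  transitivity (f (fun l => (fun l => w ((\prod_(t <- ts) tperm t.1 t.2)%g l)) (tperm i j l))).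
    by congr f; apply/funext => l; rewrite permM.
  by rewrite (falt (fun l => w ((\prod_(t <- ts) tperm t.1 t.2)%g l)))// IH// mulN1r mulNr.
rewrite /alt (eq_bigr (fun=> f v)) => [|s _]; last by rewrite fs mulrA -signr_addb addbb mul1r.
rewrite sumr_const card_Sn -[X in _ * X]mulr_natl mulrA mulVf ?mul1r//.
Qed.

Lemma alt2 (V : Type) (f : ('I_2 -> V) -> R) v :
  alt f v = 2^-1 * (f v - f (fun i => v (tperm ord0 ord_max i))).
Proof.
rewrite /alt (bigD1 (1 : 'S_2)%g)//= (bigD1 (tperm ord0 ord_max : 'S_2))/=; last first.
  by apply/eqP => /permP /(_ ord0); rewrite tpermL perm1.
rewrite big1 => [|s /andP[s1 s2]].
  rewrite odd_perm1 odd_tperm /= expr0 mul1r expr1 mulN1r addr0.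
  congr (_ * (f _ - _)); apply/funext => i; by rewrite perm1.
exfalso; have sm x : x != s ord0 -> x = s ord_max.
  have n : s ord0 != s ord_max by rewrite (inj_eq perm_inj).
  by have [-> |->] := ord2P x; have [e0|e0] := ord2P (s ord0);
     have [e1|e1] := ord2P (s ord_max); rewrite e0 e1 in n *.
have [e0|e0] := ord2P (s ord0).
  case/eqP: s1; apply/permP => x; rewrite perm1.
  have [->|->] := ord2P x; first by [].
  by apply/esym/sm; rewrite e0.
case/eqP: s2; apply/permP => x.
have [->|->] := ord2P x; first by rewrite tpermL.
by rewrite tpermR; apply/esym/sm; rewrite e0.
Qed.

End FormAlgebra.

Arguments adm_derivable_t {R n W F} u {t} _ _.
(** * The forms B, epsilon and omega *)

Section Forms.
Context {R : realType} (G : smooth_group R) (d : nat) (phi : 'rV[R]_d -> G).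
Hypothesis LC : unit_chart phi.
Variable ip : 'rV[R]_d -> 'rV[R]_d -> R.
Hypothesis hip : basic_inner_product phi ip.
Notation plotG := (@plot R (group_space G) _).
Notation br := (bracket phi).
Notation pth := (path_plot (G := G)).
Notation Th := (path_Theta phi).

Lemma adm_ip I n (F H : 'rV[R]_n -> R -> 'rV[R]_d) :
  adm I F -> adm I H -> adm I (fun u t => ip (F u t) (H u t)).
Proof. by apply: adm_ptw => f g; exact: (smooth_ip hip). Qed.

Lemma Th_adm n (P : 'rV[R]_n -> R -> G) v : pth P -> adm Iop (fun u t => Th P u v t).
Proof. by move=> pP; apply: adm_op; exact: (path_Theta_adm LC). Qed.

Lemma dTh_adm n (P : 'rV[R]_n -> R -> G) v : pth P ->
  adm Iop (fun u t => derive1 (Th P u v) t).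
Proof. by move=> pP; exact: adm_dt (Th_adm v pP). Qed.

(** Up to the factor [(8 * pi)^-1], the density of B and of the curvature of mu. *)
Definition skew_density n (P : 'rV[R]_n -> R -> G) v w u t : R :=
  ip (Th P u v t) (derive1 (Th P u w) t) - ip (Th P u w t) (derive1 (Th P u v) t).

Lemma skew_density_adm n (P : 'rV[R]_n -> R -> G) v w : pth P ->
  adm Iop (skew_density P v w).
Proof.
move=> pP; exact: adm_sub (adm_ip (Th_adm v pP) (dTh_adm w pP))
  (adm_ip (Th_adm w pP) (dTh_adm v pP)).
Qed.

Lemma adm_integral_add n (F H : 'rV[R]_n -> R -> R) u : adm Iop F -> adm Iop H ->
  path_integral (fun t => F u t + H u t) = path_integral (F u) + path_integral (H u).
Proof.
move=> aF aH; have := adm_integral_lin u 1 aF aH; rewrite mul1r => <-.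
by congr path_integral; apply/funext => t; ring.
Qed.

Lemma path_integral0 : path_integral (fun=> 0 : R) = 0.
Proof.
have := @adm_integral_lin R 0 (fun _ _ => 0) (fun _ _ => 0) 0 1 (adm_cst _ _ 0) (adm_cst _ _ 0).
have -> : (fun _ : R => 1 * 0 + 0 : R) = fun=> 0 by apply/funext => t; rewrite mul1r addr0.
rewrite mul1r.
by move=> /eqP; rewrite -subr_eq0 opprD addNKr oppr_eq0 => /eqP.
Qed.

Lemma adm_integral_scale n (F : 'rV[R]_n -> R -> R) u a : adm Iop F ->
  path_integral (fun t => a * F u t) = a * path_integral (F u).
Proof.
move=> aF; have := adm_integral_lin u a aF (adm_cst _ _ 0).
rewrite path_integral0 addr0 => <-.
by congr path_integral; apply/funext => t /=; rewrite addr0.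
Qed.

(** [(8 * pi)^-1] is the product of 1/2, from the antisymmetrisation, and
    [(4 * pi)^-1], from the normalisation of the pairing. *)
Lemma path_two_formE n (P : 'rV[R]_n -> R -> G) u v : pth P ->
  path_two_form phi ip P u v =
  (8 * pi)^-1 * path_integral (skew_density P (v ord0) (v ord_max) u).
Proof.
move=> pP; rewrite /path_two_form alt2 tpermL tpermR.
have aF x y : adm Iop (fun u t => ip (Th P u x t) (derive1 (Th P u y) t)).
  exact: adm_ip (Th_adm x pP) (dTh_adm y pP).
have E x y : path_integral (fun t => pairing ip (Th P u x t) (derive1 (Th P u y) t)) =
    (4 * pi)^-1 * path_integral (fun t => ip (Th P u x t) (derive1 (Th P u y) t)).
  rewrite -(adm_integral_scale u (4 * pi)^-1 (aF x y)).
  by congr path_integral; apply/funext => t; rewrite /pairing mulrC.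
apply: etrans (congr1 ( *%R 2^-1) (congr2 (fun a b => a - b) (E _ _) (E _ _))) _.
apply: etrans (congr1 ( *%R 2^-1) (esym (mulrBr _ _ _))) _.
have c8 : (8 * pi)^-1 = 2^-1 * (4 * pi)^-1 :> R by rewrite -invfM mulrA -natrM.
rewrite c8 -[RHS]mulrA; apply: congr1; apply: congr1.
exact: esym (path_integral_sub u u (aF _ _) (aF _ _)).
Qed.

Lemma epsilonE n (P : 'rV[R]_n -> (R -> G) * (R -> G)) u v :
  pth (fst \o P) -> pth (snd \o P) ->
  @epsilon R G d phi ip n P u v = (2 * pi)^-1 * path_integral (fun t =>
    ip (Th (fun u => (P u).1) u (v ord0) t) (hat_phi phi (P u).2 t)).
Proof.
move=> pP pQ; rewrite /epsilon.
have aF : adm Iop (fun u t => ip (Th (fun u => (P u).1) u (v ord0) t) (hat_phi phi (P u).2 t)).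
  exact: adm_ip (Th_adm (v ord0) pP) (hat_phi_adm LC pQ).
have -> : path_integral (fun t => pairing ip (Th (fun u' => (P u').1) u (v ord0) t)
     (hat_phi phi (P u).2 t)) = (4 * pi)^-1 * path_integral (fun t =>
    ip (Th (fun u => (P u).1) u (v ord0) t) (hat_phi phi (P u).2 t)).
  rewrite -(adm_integral_scale u (4 * pi)^-1 aF).
  by congr path_integral; apply/funext => t; rewrite /pairing mulrC.
rewrite mulrA; congr (_ * _).
have -> : 4 * pi = 2 * (2 * pi) :> R by rewrite mulrA -natrM.
by rewrite invfM mulrA divff ?mul1r// pnatr_eq0.
Qed.

Lemma Th_near n (P Q : 'rV[R]_n -> R -> G) u :
  (\forall u' \near u, P u' = Q u') -> Th P u = Th Q u.
Proof.
move=> PQ; apply/funext => v; apply/funext => t; apply: Theta_near.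
by apply: filterS PQ => z ->.
Qed.

Lemma Th_comp n m (P : 'rV[R]_n -> R -> G) (h : 'rV[R]_m -> 'rV[R]_n) u v :
  pth P -> smooth h -> Th (fun x => P (h x)) u v = Th P (h u) ('D_v h u).
Proof.
move=> pP sh; apply/funext => t.
exact: (Theta_comp LC u v (path_slice LC t pP) sh).
Qed.

Lemma dTh_lin n (P : 'rV[R]_n -> R -> G) u t a v w : pth P -> Iop t ->
  derive1 (Th P u (a *: v + w)) t = a *: derive1 (Th P u v) t + derive1 (Th P u w) t.
Proof.
move=> pP It.
have dv := adm_derivable_t u (Th_adm v pP) It.
have dw := adm_derivable_t u (Th_adm w pP) It.
have h := is_deriveD (is_deriveZ a (derivableP dv)) (derivableP dw).
apply: etrans (derive1E _ _) _.
apply: etrans _ (congr2 (fun x y => a *: x + y) (esym (derive1E _ _)) (esym (derive1E _ _))).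
apply: etrans _ (@derive_val _ _ _ _ _ _ _ h).
apply: (congr1 (fun f : R -> 'rV[R]_d => 'D_1 f t)); apply/funext => s.
exact (path_Theta_linear LC u s pP a v w).
Qed.

Lemma skew_pairing_lin (a : R) (x y x1 x' y' x1' z z' : 'rV[R]_d) :
  x1 = a *: x + y -> x1' = a *: x' + y' ->
  ip x1 z' - ip z x1' = a * (ip x z' - ip z x') + (ip y z' - ip z y').
Proof. by move=> -> ->; rewrite (ip_lin_l hip) (ip_lin_r hip); ring. Qed.

Lemma skew_integral_lin n (P : 'rV[R]_n -> R -> G) u z a v w : pth P ->
  path_integral (skew_density P (a *: v + w) z u) =
  a * path_integral (skew_density P v z u) + path_integral (skew_density P w z u).
Proof.
move=> pP; rewrite -(adm_integral_lin u a (skew_density_adm v z pP) (skew_density_adm w z pP)).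
apply: (adm_integral_eq (F := skew_density P (a *: v + w) z)
  (G := fun u t => a * skew_density P v z u t + skew_density P w z u t)).
  exact: adm_add (adm_mul (adm_cst Iop n a) (skew_density_adm v z pP)) (skew_density_adm w z pP).
move=> t It.
exact (skew_pairing_lin _ _ (path_Theta_linear LC u t pP a v w) (dTh_lin u a v w pP It)).
Qed.

Lemma skew_integral_anti n (P : 'rV[R]_n -> R -> G) u v w : pth P ->
  path_integral (skew_density P v w u) = - path_integral (skew_density P w v u).
Proof.
move=> pP; rewrite -mulN1r -(adm_integral_scale u (-1) (skew_density_adm w v pP)).
by congr path_integral; apply/funext => t; rewrite /skew_density mulN1r opprB.
Qed.

Lemma PG_comp n m (P : 'rV[R]_n -> PG G) (h : 'rV[R]_m -> 'rV[R]_n) :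
  plot (PG G) P -> smooth h -> plot (PG G) (P \o h).
Proof. exact: (path_comp_plot LC). Qed.

Lemma curving_is_form : is_form (curving_B phi ip : diff_form 2 (PG G)).
Proof.
have multi n (P : 'rV[R]_n -> PG G) u : plot (PG G) P -> _ :=
  fun pP => bilinear_alternating2 (fun z a x y => skew_integral_lin u z a x y pP)
    (fun x y => skew_integral_anti u x y pP).
split.
- move=> n P v pP k.
  apply: (Ck_ext (f := fun u => (8 * pi)^-1 * path_integral (skew_density P (v ord0) (v ord_max) u))).
    by move=> u; rewrite -path_two_formE.
  apply: (smooth_mul (f := fun=> (8 * pi)^-1)); first exact: smooth_cst.
  by apply: adm_integral_smooth; exact: skew_density_adm.
- move=> n P Q u v pP pQ PQ; rewrite /curving_B /path_two_form.
  by rewrite (Th_near PQ).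
- move=> m n P h u v pP sh.
  apply: etrans (path_two_formE u v (PG_comp pP sh)) _.
  apply: etrans _ (esym (path_two_formE (h u) _ pP)).
  apply: congr1; apply: congr1; apply/funext => t.
  exact (congr2 (fun f g : R -> 'rV[R]_d => ip (f t) (derive1 g t) - ip (g t) (derive1 f t))
    (Th_comp u (v ord0) pP sh) (Th_comp u (v ord_max) pP sh)).
- move=> n P u v i a x y pP; have [h _] := multi n P u pP.
  apply: etrans (path_two_formE u _ pP) _.
  apply: etrans (congr1 ( *%R (8 * pi)^-1) (h v i a x y)) _.
  apply: etrans (mulrDr _ _ _) _.
  apply: congr2; last exact: esym (path_two_formE u _ pP).
  by apply: etrans (mulrCA _ _ _) _; exact: (congr1 ( *%R a) (esym (path_two_formE u _ pP))).
- move=> n P u v i j pP ij vij; have [_ h] := multi n P u pP.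
  apply: etrans (path_two_formE u _ pP) _.
  by apply: etrans (congr1 ( *%R (8 * pi)^-1) (h v i j ij vij)) _; exact: mulr0.
Qed.

Lemma epsilon_is_form : is_form (epsilon phi ip : diff_form 1 (prod_space (PG G) (OmegaG G))).
Proof.
have F n (P : 'rV[R]_n -> prod_space (PG G) (OmegaG G)) v : plot (prod_space (PG G) (OmegaG G)) P ->
    adm Iop (fun u t => ip (Th (fun u => (P u).1) u v t) (hat_phi phi (P u).2 t)).
  move=> [pP [pQ _]].
  exact: adm_ip (Th_adm v pP) (hat_phi_adm LC pQ).
have E n (P : 'rV[R]_n -> prod_space (PG G) (OmegaG G)) u v :
    plot (prod_space (PG G) (OmegaG G)) P -> _ :=
  fun pP => @epsilonE n P u v (proj1 pP) (proj1 (proj2 pP)).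
split.
- move=> n P v pP k.
  apply: (Ck_ext (f := fun u => (2 * pi)^-1 * path_integral (fun t =>
    ip (Th (fun u => (P u).1) u (v ord0) t) (hat_phi phi (P u).2 t)))).
    by move=> u; rewrite E.
  apply: (smooth_mul (f := fun=> (2 * pi)^-1)); first exact: smooth_cst.
  by apply: adm_integral_smooth; exact: (F n P (v ord0) pP).
- move=> n P Q u v pP pQ PQ; rewrite /epsilon.
  have -> : Th (fun u' => (P u').1) u = Th (fun u' => (Q u').1) u.
    by apply: Th_near; apply: filterS PQ => z ->.
  by rewrite (nbhs_singleton PQ).
- move=> m n P h u v pP sh; have [pP1 [pP2 pP3]] := pP.
  have pPh : plot (prod_space (PG G) (OmegaG G)) (P \o h).
    split; first exact: (PG_comp (P := fun u => (P u).1)).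
    split; first exact: (PG_comp (P := fun u => (P u).2)).
    by move=> z; exact: pP3.
  apply: etrans (E _ _ u v pPh) _; apply: etrans _ (esym (E _ _ (h u) _ pP)).
  apply: congr1; apply: congr1; apply/funext => t.
  exact (congr1 (fun f : R -> 'rV[R]_d => ip (f t) (hat_phi phi (P (h u)).2 t))
    (Th_comp (P := fun u => (P u).1) u (v ord0) pP1 sh)).
- move=> n P u v i a x y pP.
  have [pP1 _] := pP; rewrite (ord1 i).
  apply: etrans (E _ _ u _ pP) _.
  apply: etrans _ (congr2 (fun p q => a * p + q) (esym (E _ _ u _ pP)) (esym (E _ _ u _ pP))).
  rewrite !upd_eq; apply: etrans _ (congr1 (+%R^~ _) (mulrCA _ _ _)).
  apply: etrans _ (mulrDr _ _ _); apply: congr1.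
  apply: etrans _ (adm_integral_lin u a (F n P x pP) (F n P y pP)).
  apply: congr1; apply/funext => t.
  apply: etrans _ (ip_lin_l hip _ _ _ _).
  exact (congr1 (ip^~ _) (path_Theta_linear LC u t pP1 a x y)).
- by move=> n P u v i j _; rewrite !ord1 eqxx.
Qed.

Lemma half_double (V : lmodType R) (x : V) : 2^-1 *: (x - - x) = x.
Proof.
have -> : x - - x = (1 + 1) *: x by rewrite opprK scalerDl !scale1r.
rewrite scalerA.
by rewrite mulVf ?scale1r// pnatr_eq0.
Qed.

(** [(24 * pi)^-1] is the product of 1/6 and the normalisation of the pairing; the
    antisymmetrisation has no effect, since [ip (br x y) z] is alternating. *)
Lemma omegaE n (Q : 'rV[R]_n -> G) u v : plotG Q ->
  omega phi ip Q u v = (24 * pi)^-1 *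
    ip (br (Theta phi Q u (v ord0)) (Theta phi Q u (v (inord 1)))) (Theta phi Q u (v ord_max)).
Proof.
move=> pQ; rewrite /omega.
have TT x y : Theta_Theta phi Q u x y = br (Theta phi Q u x) (Theta phi Q u y).
  apply: etrans (congr1 (fun z => 2^-1 *: (_ - z)) (bracket_antisym LC _ _)) _.
  exact: half_double.
set f := fun w : 'I_3 -> 'rV[R]_n => _.
have fE w : f w = (4 * pi)^-1 * ip (br (Theta phi Q u (w ord0)) (Theta phi Q u (w (inord 1))))
    (Theta phi Q u (w ord_max)).
  by rewrite /f TT /pairing mulrC.
have anti x y : br x y = - br y x := bracket_antisym LC x y.
have rot x y z : ip (br x y) z = ip (br y z) x := ip_bracket_rot LC hip x y z.
rewrite alt_alternating.
  rewrite fE mulrA -invfM; congr (_^-1 * _).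
  by rewrite mulrA -natrM.
move=> w i j ij; rewrite !fE -mulrN; congr (_ * _).
move: (rot) (anti) => {TT fE f}.
move: (br) => b rot' anti'; move: (Theta phi Q u) => T.
have flip a1 a2 a3 : ip (b a1 a2) a3 = - ip (b a2 a1) a3.
  by rewrite anti' (ipNl hip).
rewrite inord1_3; set o1 := Ordinal _.
have t1 : (tperm ord0 o1 ord_max : 'I_3) = ord_max by rewrite tpermD.
have t2 : (tperm ord0 ord_max o1 : 'I_3) = o1 by rewrite tpermD.
have t3 : (tperm o1 ord_max ord0 : 'I_3) = ord0 by rewrite tpermD.
have := ord3P i; have := ord3P j; rewrite inord1_3 -/o1.
move=> -[] ej -[] ei; move: ij; rewrite ei ej ?eqxx// => _.
- rewrite [tperm o1 ord0]tpermC tpermL tpermR t1; exact: flip.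
- rewrite [tperm ord_max ord0]tpermC tpermL tpermR t2.
  by rewrite flip; congr (- _); rewrite rot'.
- rewrite tpermL tpermR t1; exact: flip.
- rewrite [tperm ord_max o1]tpermC tpermL tpermR t3.
  by rewrite rot' flip; congr (- _); rewrite -rot'.
- rewrite tpermL tpermR t2.
  by rewrite flip; congr (- _); rewrite rot'.
- rewrite tpermL tpermR t3.
  by rewrite rot' flip; congr (- _); rewrite -rot'.
Qed.

Lemma omega_is_form : is_form (omega phi ip : diff_form 3 (group_space G)).
Proof.
pose T n (Q : 'rV[R]_n -> G) u x y z :=
  ip (br (Theta phi Q u x) (Theta phi Q u y)) (Theta phi Q u z).
have multi n (Q : 'rV[R]_n -> G) u : plotG Q -> _ := fun pQ =>
  @trilinear_alternating3 R _ (T n Q u)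
   (fun y z a x x' => etrans (congr1 (fun q => ip (br q _) _) (Theta_linear LC u pQ a x x'))
      (etrans (congr1 (ip^~ _) (bracket_linear_l LC _ a _ _)) (ip_lin_l hip _ a _ _)))
   (fun x y z => etrans (congr1 (ip^~ _) (bracket_antisym LC _ _)) (ipNl hip _ _))
   (fun x y z => ip_bracket_rot LC hip _ _ _).
split.
- move=> n Q v pQ k.
  apply: (Ck_ext (f := fun u => (24 * pi)^-1 * T n Q u (v ord0) (v (inord 1)) (v ord_max))).
    by move=> u; rewrite -omegaE.
  apply: (smooth_mul (f := fun=> (24 * pi)^-1)); first exact: smooth_cst.
  apply: (smooth_ip hip); last exact: (Theta_smooth LC).
  apply: (smooth_bilin (G := fun u y => br (Theta phi Q u (v ord0)) y)).
  + by move=> y; exact: (bracket_linear_r LC).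
  + move=> e; apply: (smooth_bilin (G := fun u y => br y e)).
    * by move=> y; exact: (bracket_linear_l LC).
    * by move=> e'; exact: smooth_cst.
    * exact: (Theta_smooth LC).
  + exact: (Theta_smooth LC).
- move=> n P Q u v pP pQ PQ.
  apply: etrans (omegaE u v pP) _; apply: etrans _ (esym (omegaE u v pQ)).
  have e w : Theta phi P u w = Theta phi Q u w := Theta_near phi w PQ.
  exact (congr1 ( *%R (24 * pi)^-1) (congr2 ip (congr2 br (e _) (e _)) (e _))).
- move=> m n P h u v pP sh.
  apply: etrans (omegaE u v (plotG_comp LC pP sh)) _.
  apply: etrans _ (esym (omegaE (h u) _ pP)).
  have e w := Theta_comp LC u w pP sh.
  exact (congr1 ( *%R (24 * pi)^-1) (congr2 ip (congr2 br (e _) (e _)) (e _))).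
- move=> n Q u v i a x y pQ; have [h _] := multi n Q u pQ.
  apply: etrans (omegaE u _ pQ) _.
  apply: etrans (congr1 ( *%R (24 * pi)^-1) (h v i a x y)) _.
  apply: etrans (mulrDr _ _ _) _.
  apply: congr2; last exact: esym (omegaE u _ pQ).
  by apply: etrans (mulrCA _ _ _) _; exact: (congr1 ( *%R a) (esym (omegaE u _ pQ))).
- move=> n Q u v i j pQ ij vij; have [_ h] := multi n Q u pQ.
  apply: etrans (omegaE u _ pQ) _.
  by apply: etrans (congr1 ( *%R (24 * pi)^-1) (h v i j ij vij)) _; exact: mulr0.
Qed.

End Forms.

(** * The identities between B, epsilon, nu and omega *)

Section Identities.
Context {R : realType} (G : smooth_group R) (d : nat) (phi : 'rV[R]_d -> G).
Hypothesis LC : unit_chart phi.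
Variable ip : 'rV[R]_d -> 'rV[R]_d -> R.
Hypothesis hip : basic_inner_product phi ip.
Notation plotG := (@plot R (group_space G) _).
Notation br := (bracket phi).
Notation pth := (path_plot (G := G)).
Notation Th := (path_Theta phi).
Notation skew := (skew_density phi ip).

Lemma is_derive_bracket (V : normedModType R) (f g : V -> 'rV[R]_d) x v df dg :
  is_derive x v f df -> is_derive x v g dg ->
  is_derive x v (fun y => br (f y) (g y)) (br df (g x) + br (f x) dg).
Proof.
move=> [f1 f2] [g1 g2].
have h1 z : is_derive x v (fun y => br (f y) z) (br df z).
  have h := is_derive_bilin (G := fun (_ : V) e => br e z) (fun=> bracket_linear_l LC z)
    (fun e => @derivable_cst _ _ _ (br e z) x v) f1.
  apply: is_derive_eq h _; apply: etrans (congr1 (+%R^~ _) (derive_cst _ _ _)) _.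
  by apply: etrans (add0r _) _; exact (congr1 (br^~ z) f2).
have h2 := is_derive_bilin (G := fun y e => br (f y) e) (fun y => bracket_linear_r LC (f y))
  (fun e => @ex_derive _ _ _ _ _ _ _ (h1 e)) g1.
apply: is_derive_eq h2 _.
exact (congr2 +%R (@derive_val _ _ _ _ _ _ _ (h1 (g x))) (congr1 (br (f x)) g2)).
Qed.

Lemma adm_bracket I n (F H : 'rV[R]_n -> R -> 'rV[R]_d) :
  adm I F -> adm I H -> adm I (fun u t => br (F u t) (H u t)).
Proof.
move=> aF aH.
apply: (adm_bilin (G := fun u t y => br (F u t) y)) aH => [u t _|e].
  exact: (bracket_linear_r LC).
apply: (adm_bilin (G := fun u t y => br y e)) aF => [u t _|e'].
  exact: (bracket_linear_l LC).
exact: adm_cst.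
Qed.

Lemma is_derive_Th_u n (P : 'rV[R]_n -> R -> G) u t z w : pth P -> Iop t ->
  is_derive u z (fun u => Th P u w t) ('D_z (fun u => Th P u w t) u).
Proof.
move=> pP It; apply: DeriveDef => //.
exact: (@adm_derivable_u R Iop n _ (fun u t => Th P u w t) u t z (Th_adm LC w pP) (IopW It) It).
Qed.

Lemma is_derive_Th_t n (P : 'rV[R]_n -> R -> G) u t w : pth P -> Iop t ->
  is_derive t (1 : R) (Th P u w) (derive1 (Th P u w) t).
Proof.
move=> pP It; apply: DeriveDef; last exact (esym (derive1E _ _)).
exact (adm_derivable_t _ (Th_adm LC w pP) It).
Qed.

Lemma is_derive_dTh_u n (P : 'rV[R]_n -> R -> G) u t z w : pth P -> Iop t ->
  is_derive u z (fun u => derive1 (Th P u w) t)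
    (derive1 (fun t => 'D_z (fun u => Th P u w t) u) t).
Proof.
move=> pP It; apply: DeriveDef.
  exact: (@adm_derivable_u R Iop n _ (fun u t => derive1 (Th P u w) t) u t z (dTh_adm LC w pP) (IopW It) It).
exact: (adm_swap u z (Th_adm LC w pP) It).
Qed.

Lemma derive_skew n (P : 'rV[R]_n -> R -> G) u t z v w : pth P -> Iop t ->
  'D_z (fun u => skew P v w u t) u =
  (ip ('D_z (fun u => Th P u v t) u) (derive1 (Th P u w) t) +
   ip (Th P u v t) (derive1 (fun t => 'D_z (fun u => Th P u w t) u) t)) -
  (ip ('D_z (fun u => Th P u w t) u) (derive1 (Th P u v) t) +
   ip (Th P u w t) (derive1 (fun t => 'D_z (fun u => Th P u v t) u) t)).
Proof.
move=> pP It.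
have k1 := is_derive_ip hip (is_derive_Th_u u z v pP It) (is_derive_dTh_u u z w pP It).
have k2 := is_derive_ip hip (is_derive_Th_u u z w pP It) (is_derive_dTh_u u z v pP It).
exact: (@derive_val _ _ _ _ _ _ _ (is_deriveB k1 k2)).
Qed.

Lemma path_maurer_cartan_t n (P : 'rV[R]_n -> R -> G) u t v w : pth P -> Iop t ->
  derive1 (fun t => 'D_v (fun u => Th P u w t) u) t -
  derive1 (fun t => 'D_w (fun u => Th P u v t) u) t =
  - (br (derive1 (Th P u v) t) (Th P u w t) + br (Th P u v t) (derive1 (Th P u w) t)).
Proof.
move=> pP It.
have aD x y : adm Iop (fun u t => 'D_x (fun u => Th P u y t) u).
  exact (adm_D _ (Th_adm LC y pP)).
have k x y : is_derive t (1 : R) (fun t => 'D_x (fun u => Th P u y t) u)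
    (derive1 (fun t => 'D_x (fun u => Th P u y t) u) t).
  apply: DeriveDef; last exact (esym (derive1E _ _)).
  exact (adm_derivable_t _ (aD x y) It).
have h1 := @derive_val _ _ _ _ _ _ _ (is_deriveB (k v w) (k w v)).
have h2 := @derive_val _ _ _ _ _ _ _ (is_deriveN
  (is_derive_bracket (is_derive_Th_t u v pP It) (is_derive_Th_t u w pP It))).
apply: etrans (esym h1) _; apply: etrans _ h2.
apply: (congr1 (fun f : R -> 'rV[R]_d => 'D_1 f t)); apply/funext => s.
exact (path_maurer_cartan LC u v w s pP).
Qed.

(** The density of dB is a total time derivative, so its integral is a
    difference of values at the end points of the interval. *)
Lemma skew_cyclic n (P : 'rV[R]_n -> R -> G) u t v0 v1 v2 : pth P -> Iop t ->
  'D_v0 (fun u => skew P v1 v2 u t) u + 'D_v1 (fun u => skew P v2 v0 u t) u +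
  'D_v2 (fun u => skew P v0 v1 u t) u =
  derive1 (fun t => ip (br (Th P u v0 t) (Th P u v1 t)) (Th P u v2 t)) t.
Proof.
move=> pP It.
have k v := is_derive_Th_t u v pP It.
have h := is_derive_ip hip (is_derive_bracket (k v0) (k v1)) (k v2).
apply: etrans _ (esym (derive1E _ _)).
apply: etrans _ (esym (@derive_val _ _ _ _ _ _ _ h)).
apply: etrans (congr2 +%R (congr2 +%R (derive_skew u v0 v1 v2 pP It)
  (derive_skew u v1 v2 v0 pP It)) (derive_skew u v2 v0 v1 pP It)) _.
exact (cyclic_cocycle (ipC hip) (ipDl hip) (ipNl hip) (ip_bracket_rot LC hip)
  (path_maurer_cartan LC u v0 v1 t pP) (path_maurer_cartan LC u v1 v2 t pP) (path_maurer_cartan LC u v2 v0 t pP)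
  (path_maurer_cartan_t u v0 v1 pP It) (path_maurer_cartan_t u v1 v2 pP It) (path_maurer_cartan_t u v2 v0 pP It)).
Qed.

Lemma Th_start n (P : 'rV[R]_n -> R -> G) u v : pth P -> Th P u v 0 = 0.
Proof.
move=> [P0 _ _]; have e : (fun u => P u 0) = fun=> 1%g by apply/funext.
by rewrite /path_Theta e; exact: Theta_cst.
Qed.

Lemma skew_integral_smooth n (P : 'rV[R]_n -> R -> G) v w : pth P ->
  smooth (fun u => path_integral (skew P v w u)).
Proof. by move=> pP; apply: adm_integral_smooth; exact (skew_density_adm LC hip v w pP). Qed.

Lemma derive_path_two_form n (P : 'rV[R]_n -> R -> G) u z (w : 'I_2 -> 'rV[R]_n) : pth P ->
  'D_z (fun u => path_two_form phi ip P u w) u = (8 * pi)^-1 *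
    'D_z (fun u => path_integral (skew P (w ord0) (w ord_max) u)) u.
Proof.
move=> pP.
have E : (fun u => path_two_form phi ip P u w) =
    (8 * pi)^-1 *: (fun u => path_integral (skew P (w ord0) (w ord_max) u)).
  by apply/funext => y; exact: (path_two_formE LC hip).
apply: etrans (congr1 (fun f : 'rV[R]_n -> R => 'D_z f u) E) _.
exact (deriveZ _ (smooth_derivable u z (skew_integral_smooth (w ord0) (w ord_max) pP))).
Qed.

Lemma derive_skew_integral_anti n (P : 'rV[R]_n -> R -> G) u z v w : pth P ->
  'D_z (fun u => path_integral (skew P v w u)) u =
  - 'D_z (fun u => path_integral (skew P w v u)) u.
Proof.
move=> pP; have E : (fun u => path_integral (skew P v w u)) =
    - (fun u => path_integral (skew P w v u)).
  by apply/funext => y; exact: (skew_integral_anti LC hip).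
apply: etrans (congr1 (fun f : 'rV[R]_n -> R => 'D_z f u) E) _.
exact (deriveN (smooth_derivable u z (skew_integral_smooth w v pP))).
Qed.

Lemma alternating_sum2 (F : 'I_2 -> R) :
  \sum_(i < 2) (-1) ^+ i * F i = F ord0 - F ord_max.
Proof.
rewrite !big_ord_recl big_ord0 /= addr0 expr0 mul1r expr1 mulN1r.
by congr (_ - F _); apply: val_inj.
Qed.

Lemma alternating_sum3 (F : 'I_3 -> R) :
  \sum_(i < 3) (-1) ^+ i * F i = F ord0 - F (inord 1) + F ord_max.
Proof.
rewrite !big_ord_recl big_ord0 /= addr0 expr0 mul1r expr1 mulN1r -addrA inord1_3.
have -> : lift ord0 (ord0 : 'I_2) = Ordinal (isT : 1 < 3)%N by apply: val_inj.
have -> : lift ord0 (lift ord0 (ord0 : 'I_1)) = ord_max :> 'I_3 by apply: val_inj.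
by rewrite sqrrN expr1n mul1r.
Qed.

Lemma third_of_sum (k x y z : R) :
  3^-1 * k * (x + y + z) = 3^-1 * (k * x - k * - y + k * z).
Proof. by ring. Qed.

Lemma gauge_arith (a b x y : R) :
  (8 * pi)^-1 * (a + b - 2 * (x - y)) - (8 * pi)^-1 * a =
  (8 * pi)^-1 * b - 2^-1 * ((2 * pi)^-1 * x - (2 * pi)^-1 * y).
Proof.
have -> : (8 * pi)^-1 = 4^-1 * (2 * pi)^-1 :> R by rewrite -invfM mulrA -natrM.
by move: (2 * pi)^-1 => k; field.
Qed.

Lemma cocycle_arith (k w x y z : R) : w + x = y + z ->
  k * y - k * w + k * z = k * x.
Proof. by move=> h; rewrite -mulrBr -mulrDr; congr (_ * _); lra. Qed.

(** The integral of [skew_cyclic] is the value of [ip (br Theta Theta) Theta] at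
    the time 2 pi, as the paths all start at 1.  The factor 1/3 in d turns
    [(8 * pi)^-1] into the [(24 * pi)^-1] of omega. *)
Lemma curving_omega n (P : 'rV[R]_n -> PG G) u v : plot (PG G) P ->
  omega phi ip (@ev R G \o P) u v = ext_d (curving_B phi ip : diff_form 2 (PG G)) P u v.
Proof.
move=> pP; set v0 := v ord0; set v1 := v (inord 1); set v2 := v ord_max.
pose c u t := ip (br (Th P u v0 t) (Th P u v1 t)) (Th P u v2 t).
have ac : adm Icl c.
  apply: (adm_ip hip); last exact: (path_Theta_adm LC v2 pP).
  exact (adm_bracket (path_Theta_adm LC v0 pP) (path_Theta_adm LC v1 pP)).
have ftc := path_integral_ftc u ac.
have c0 : c u 0 = 0.
  apply: etrans (congr1 (ip _) (Th_start u v2 pP)) _; exact: (ip0r hip).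
rewrite c0 subr0 in ftc.
have pE : plotG (@ev R G \o P) by exact (path_slice LC (2 * pi) pP).
pose bw x y u := path_integral (skew P x y u).
pose S z v w := fun u t => 'D_z (fun u => skew P v w u t) u.
have aS z x y : adm Iop (S z x y) by exact (adm_D _ (skew_density_adm LC hip x y pP)).
have sum : 'D_v0 (bw v1 v2) u + 'D_v1 (bw v2 v0) u + 'D_v2 (bw v0 v1) u = c u (2 * pi).
  have e z x y : 'D_z (bw x y) u = path_integral (S z x y u).
    exact (adm_integral_deriv u z (skew_density_adm LC hip x y pP)).
  apply: etrans (congr2 +%R (congr2 +%R (e _ _ _) (e _ _ _)) (e _ _ _)) _.
  apply: etrans _ ftc.
  apply: etrans (congr1 (+%R^~ _) (esym (adm_integral_add u (aS v0 v1 v2) (aS v1 v2 v0)))) _.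
  apply: etrans (esym (adm_integral_add (F := fun u t => S v0 v1 v2 u t + S v1 v2 v0 u t)
    u (adm_add (aS v0 v1 v2) (aS v1 v2 v0)) (aS v2 v0 v1))) _.
  apply: (adm_integral_eq (F := fun u t => S v0 v1 v2 u t + S v1 v2 v0 u t + S v2 v0 v1 u t)
    (G := fun u t => derive1 (c u) t)).
    exact (adm_dt (adm_op ac)).
  by move=> t It; exact (skew_cyclic u v0 v1 v2 pP It).
have l00 : lift (ord0 : 'I_3) (ord0 : 'I_2) = inord 1 by apply: val_inj; rewrite /= inordK.
have l01 : lift (ord0 : 'I_3) (ord_max : 'I_2) = ord_max by apply: val_inj.
have l10 : lift (inord 1 : 'I_3) (ord0 : 'I_2) = ord0.
  by rewrite inord1_3; apply: val_inj.
have l11 : lift (inord 1 : 'I_3) (ord_max : 'I_2) = ord_max.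
  by rewrite inord1_3; apply: val_inj.
have l20 : lift (ord_max : 'I_3) (ord0 : 'I_2) = ord0 by apply: val_inj.
have l21 : lift (ord_max : 'I_3) (ord_max : 'I_2) = inord 1.
  by apply: val_inj; rewrite /= inordK.
have D0 := derive_path_two_form u v0 (fun j => v (lift ord0 j)) pP.
have D1 := derive_path_two_form u v1 (fun j => v (lift (inord 1) j)) pP.
have D2 := derive_path_two_form u v2 (fun j => v (lift ord_max j)) pP.
rewrite /= l00 l01 -/v1 -/v2 in D0; rewrite /= l10 l11 -/v0 -/v2 in D1.
rewrite /= l20 l21 -/v0 -/v1 in D2.
have D1' := etrans D1 (congr1 ( *%R (8 * pi)^-1) (derive_skew_integral_anti u v1 v0 v2 pP)).
apply: etrans (omegaE LC hip u v pE) _.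
apply: etrans _ (esym (congr1 ( *%R 3^-1) (alternating_sum3 _))).
apply: etrans _ (esym (congr1 ( *%R 3^-1) (congr2 +%R (congr2 (fun a b => a - b) D0 D1') D2))).
apply: etrans (congr1 ( *%R (24 * pi)^-1) (esym sum)) _.
have -> : (24 * pi)^-1 = 3^-1 * (8 * pi)^-1 :> R by rewrite -invfM mulrA -natrM.
exact (third_of_sum _ _ _ _).
Qed.

Section Gauge.
Variables (n : nat) (P Q : 'rV[R]_n -> R -> G).
Hypotheses (pP : pth P) (pQ : pth Q) (Q1 : forall u, Q u (2 * pi) = 1%g).

Lemma Th_end u v : Th Q u v (2 * pi) = 0.
Proof.
have e : (fun u => Q u (2 * pi)) = fun=> 1%g by apply/funext.
by rewrite /path_Theta e; exact: Theta_cst.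
Qed.

Definition eps_density v u t : R := ip (Th P u v t) (hat_phi phi (Q u) t).

Lemma eps_density_adm v : adm Iop (eps_density v).
Proof. exact (adm_ip hip (Th_adm LC v pP) (hat_phi_adm LC pQ)). Qed.

Lemma derive_eps_density u t v w : Iop t ->
  'D_v (fun u => eps_density w u t) u =
  ip ('D_v (fun u => Th P u w t) u) (hat_phi phi (Q u) t) +
  ip (Th P u w t) (Ad phi (Q u t) (derive1 (Th Q u v) t)).
Proof.
move=> It.
have k : is_derive u v (fun u => hat_phi phi (Q u) t)
    (Ad phi (Q u t) (derive1 (Th Q u v) t)).
  apply: DeriveDef; last exact (derive_hat_phi LC u v pQ It).
  exact: (@adm_derivable_u R Iop n _ (fun u t => hat_phi phi (Q u) t) u t v (hat_phi_adm LC pQ) (IopW It) It).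
exact: (@derive_val _ _ _ _ _ _ _ (is_derive_ip hip (is_derive_Th_u u v w pP It) k)).
Qed.

(** The function whose time derivative is the part of the change of B that does
    not come from the curvature of mu and from epsilon.  It vanishes at both ends
    because [Q] is a family of loops based at 1. *)
Definition gauge_boundary v w u t : R :=
  ip (Th Q u v t) (Ad phi (Q u t)^-1%g (Th P u w t)) -
  ip (Th Q u w t) (Ad phi (Q u t)^-1%g (Th P u v t)).

Lemma AdV_Th_adm v : adm Icl (fun u t => Ad phi (Q u t)^-1%g (Th P u v t)).
Proof.
apply: (adm_bilin (G := fun u t y => Ad phi (Q u t)^-1%g y)) => [u t _|e|].
- exact: (Ad_linear LC).
- exact: (path_AdV_adm LC e pQ).
- exact: (path_Theta_adm LC v pP).
Qed.

Lemma gauge_boundary_adm v w : adm Icl (gauge_boundary v w).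
Proof.
exact (adm_sub (adm_ip hip (path_Theta_adm LC v pQ) (AdV_Th_adm w))
  (adm_ip hip (path_Theta_adm LC w pQ) (AdV_Th_adm v))).
Qed.

Let PQ u := path_mul (P u) (Q u).

Lemma gauge_skew u t v w : Iop t ->
  skew PQ v w u t = skew P v w u t + skew Q v w u t
   - 2 * ('D_v (fun u => eps_density w u t) u - 'D_w (fun u => eps_density v u t) u)
   + derive1 (gauge_boundary v w u) t.
Proof.
move=> It.
have dP z : derivable (Th P u z) t 1 := adm_derivable_t u (Th_adm LC z pP) It.
have kA z := derive_t_AdV LC u pQ It (dP z).
have kQ z := is_derive_Th_t u z pQ It.
have kb := is_deriveB (is_derive_ip hip (kQ v) (kA w)) (is_derive_ip hip (kQ w) (kA v)).
have eB : derive1 (gauge_boundary v w u) t = _ :=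
  etrans (derive1E _ _) (@derive_val _ _ _ _ _ _ _ kb).
have eT z : Th PQ u z t = Ad phi (Q u t)^-1%g (Th P u z t) + Th Q u z t :=
  path_Theta_mul LC u z t pP pQ.
have eD z : derive1 (Th PQ u z) t = Ad phi (Q u t)^-1%g
    (derive1 (Th P u z) t + br (Th P u z t) (hat_phi phi (Q u) t)) + derive1 (Th Q u z) t.
  apply: etrans (derive1E _ _) _; apply: etrans _ (@derive_val _ _ _ _ _ _ _ (is_deriveD (kA z) (kQ z))).
  apply: (congr1 (fun f : R -> 'rV[R]_d => 'D_1 f t)); apply/funext => s.
  exact (path_Theta_mul LC u z s pP pQ).
have AD x y : Ad phi (Q u t)^-1%g (x + y) = Ad phi (Q u t)^-1%g x + Ad phi (Q u t)^-1%g y.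
  by have := Ad_linear LC (Q u t)^-1%g 1 x y; rewrite !scale1r.
have main := gauge_cocycle (ipC hip) (ipDl hip) (ipNl hip) (ip_bracket_rot LC hip)
  AD (ipAd hip (Q u t)^-1%g) (AdK LC (Q u t)) (bracket_antisym LC)
  (derive1 (Th P u v) t) (derive1 (Th P u w) t) (Th Q u v t) (Th Q u w t)
  (derive1 (Th Q u v) t) (derive1 (Th Q u w) t) (hat_phi phi (Q u) t)
  (path_maurer_cartan LC u v w t pP).
apply: etrans (congr2 (fun a b => a - b) (congr2 ip (eT v) (eD w)) (congr2 ip (eT w) (eD v))) _.
apply: etrans main _.
apply: congr2; last exact (esym eB).
apply: congr1; apply: congr1; apply: congr1.
exact (congr2 (fun a b => a - b) (esym (derive_eps_density u v w It))
  (esym (derive_eps_density u w v It))).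
Qed.

Lemma gauge_integral u v w :
  path_integral (skew PQ v w u) =
  path_integral (skew P v w u) + path_integral (skew Q v w u) - 2 *
  ('D_v (fun u => path_integral (eps_density w u)) u -
   'D_w (fun u => path_integral (eps_density v u)) u).
Proof.
pose D z y := fun u t => 'D_z (fun u => eps_density y u t) u.
have aD z y : adm Iop (D z y) by exact (adm_D _ (eps_density_adm y)).
have aP := skew_density_adm LC hip v w pP; have aQ := skew_density_adm LC hip v w pQ.
have aF := adm_dt (adm_op (gauge_boundary_adm v w)).
have aE : adm Iop (fun u t => D v w u t - D w v u t) := adm_sub (aD v w) (aD w v).
have aS : adm Iop (fun u t => skew P v w u t + skew Q v w u t) := adm_add aP aQ.
pose T u t := -2 * (D v w u t - D w v u t) + (skew P v w u t + skew Q v w u t).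
have aT : adm Iop T := adm_add (adm_mul (adm_cst Iop n (-2 : R)) aE) aS.
have i1 : path_integral (skew PQ v w u) =
    path_integral (fun t => T u t + derive1 (gauge_boundary v w u) t).
  apply: (adm_integral_eq (F := skew PQ v w)
    (G := fun u t => T u t + derive1 (gauge_boundary v w u) t)); first exact: adm_add.
  move=> t It; apply: etrans (gauge_skew u v w It) _; rewrite /T /D.
  by apply: congr2 => //; apply: etrans (addrC _ _) _; apply: congr2 => //; rewrite mulNr.
apply: etrans i1 _; apply: etrans (adm_integral_add u aT aF) _.
have ftc := path_integral_ftc u (gauge_boundary_adm v w).
have b0 : gauge_boundary v w u 0 = 0.
  apply: etrans _ (subrr 0).
  exact (congr2 (fun a b => a - b) (etrans (congr1 (ip^~ _) (Th_start u v pQ)) (ip0l hip _))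
    (etrans (congr1 (ip^~ _) (Th_start u w pQ)) (ip0l hip _))).
have b1 : gauge_boundary v w u (2 * pi) = 0.
  apply: etrans _ (subrr 0).
  exact (congr2 (fun a b => a - b) (etrans (congr1 (ip^~ _) (Th_end u v)) (ip0l hip _))
    (etrans (congr1 (ip^~ _) (Th_end u w)) (ip0l hip _))).
rewrite b0 b1 subr0 in ftc.
apply: etrans (congr1 (+%R _) ftc) _; apply: etrans (addr0 _) _.
apply: etrans (adm_integral_lin u (-2) aE aS) _.
apply: etrans (congr2 (fun a b => -2 * a + b) (path_integral_sub u u (aD v w) (aD w v))
  (adm_integral_add u aP aQ)) _.
have e z y : path_integral (D z y u) = 'D_z (fun u => path_integral (eps_density y u)) u.
  exact (esym (adm_integral_deriv u z (eps_density_adm y))).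
apply: etrans (congr1 (fun a => -2 * a + _) (congr2 (fun a b => a - b) (e v w) (e w v))) _.
by apply: etrans (addrC _ _) _; rewrite mulNr.
Qed.

End Gauge.

Lemma derive_epsilon n (P : 'rV[R]_n -> prod_space (PG G) (OmegaG G)) u z (w : 'I_1 -> 'rV[R]_n) :
  plot (prod_space (PG G) (OmegaG G)) P ->
  'D_z (fun u => @epsilon R G d phi ip n P u w) u = (2 * pi)^-1 *
    'D_z (fun u => path_integral (eps_density (fun u => (P u).1) (fun u => (P u).2) (w ord0) u)) u.
Proof.
move=> [pP [pQ _]].
have E : (fun u => @epsilon R G d phi ip n P u w) = (2 * pi)^-1 *:
    (fun u => path_integral (eps_density (fun u => (P u).1) (fun u => (P u).2) (w ord0) u)).
  by apply/funext => y; exact (epsilonE LC hip y w pP pQ).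
apply: etrans (congr1 (fun f : 'rV[R]_n -> R => 'D_z f u) E) _.
apply: deriveZ; apply: smooth_derivable; apply: adm_integral_smooth.
exact (eps_density_adm pP pQ (w ord0)).
Qed.

(** On PG x OmegaG, where [d_0 (p, q) = p q] and [d_1 (p, q) = p], this is
    delta B = R - d epsilon, the right-hand side being the curvature of nabla. *)
Lemma curving_gauge n (P : 'rV[R]_n -> PG G) (Q : 'rV[R]_n -> OmegaG G) u v :
  plot (PG G) P -> plot (OmegaG G) Q ->
  path_two_form phi ip (fun u => path_mul (P u) (Q u)) u v - path_two_form phi ip P u v =
  path_two_form phi ip Q u v -
  ext_d (epsilon phi ip : diff_form 1 (prod_space (PG G) (OmegaG G))) (fun u => (P u, Q u)) u v.
Proof.
move=> pP pQ; have [pQ1 Q1] := pQ.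
have pPQ : plot (prod_space (PG G) (OmegaG G)) (fun u => (P u, Q u)) by split.
have B0 := path_two_formE LC hip u v (path_mul_plot pP pQ1).
have B1 := path_two_formE LC hip u v pP; have B2 := path_two_formE LC hip u v pQ1.
have g := gauge_integral pP pQ1 Q1 u (v ord0) (v ord_max).
have E : ext_d (epsilon phi ip : diff_form 1 (prod_space (PG G) (OmegaG G))) (fun u => (P u, Q u)) u v =
   2^-1 * ((2 * pi)^-1 * 'D_(v ord0) (fun u => path_integral (eps_density P Q (v ord_max) u)) u -
   (2 * pi)^-1 * 'D_(v ord_max) (fun u => path_integral (eps_density P Q (v ord0) u)) u).
  apply: etrans (congr1 ( *%R 2^-1) (alternating_sum2 _)) _.
  apply: congr1; have l0 : lift (ord0 : 'I_2) (ord0 : 'I_1) = ord_max by apply: val_inj.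
  have l1 : lift (ord_max : 'I_2) (ord0 : 'I_1) = ord0 by apply: val_inj.
  apply: congr2.
    apply: etrans (derive_epsilon u (v ord0) (fun j => v (lift ord0 j)) pPQ) _.
    by rewrite l0.
  apply: congr1.
  apply: etrans (derive_epsilon u (v ord_max) (fun j => v (lift ord_max j)) pPQ) _.
  by rewrite l1.
apply: etrans (congr2 (fun a b => a - b) (etrans B0 (congr1 _ g)) B1) _.
apply: etrans _ (esym (congr2 (fun a b => a - b) B2 E)).
exact (gauge_arith _ _ _ _).
Qed.

(** This is delta epsilon = nu: the form epsilon compensates the failure of mu to
    be multiplicative.  It holds at each time, by the product rules for Theta and
    [hat_phi] and the invariance of [ip]. *)
Lemma epsilon_cocycle n (P : 'rV[R]_n -> PG G) (Q S : 'rV[R]_n -> OmegaG G) u v :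
  plot (PG G) P -> plot (OmegaG G) Q -> plot (OmegaG G) S ->
  @epsilon R G d phi ip n (fun u => (path_mul (P u) (Q u), S u)) u v
  - @epsilon R G d phi ip n (fun u => (P u, path_mul (Q u) (S u))) u v
  + @epsilon R G d phi ip n (fun u => (P u, Q u)) u v
  = @nu R G d phi ip n (fun u => (Q u, S u)) u v.
Proof.
move=> pP [pQ _] [pS _].
have pPQ := path_mul_plot pP pQ; have pQS := path_mul_plot pQ pS.
have e1 := @epsilonE R G d phi LC ip hip n (fun u => (path_mul (P u) (Q u), S u)) u v pPQ pS.
have e2 := @epsilonE R G d phi LC ip hip n (fun u => (P u, path_mul (Q u) (S u))) u v pP pQS.
have e3 := @epsilonE R G d phi LC ip hip n (fun u => (P u, Q u)) u v pP pQ.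
have e4 := @epsilonE R G d phi LC ip hip n (fun u => (Q u, S u)) u v pQ pS.
apply: etrans (congr2 +%R (congr2 (fun a b => a - b) e1 e2) e3) _.
apply: etrans _ (esym e4); rewrite /=.
have a1 := eps_density_adm pPQ pS (v ord0).
have a2 := eps_density_adm pP pQS (v ord0).
have a3 := eps_density_adm pP pQ (v ord0).
have a4 := eps_density_adm pQ pS (v ord0).
have main : path_integral (eps_density P (fun u => path_mul (Q u) (S u)) (v ord0) u) +
   path_integral (eps_density Q S (v ord0) u) =
   path_integral (eps_density (fun u => path_mul (P u) (Q u)) S (v ord0) u) +
   path_integral (eps_density P Q (v ord0) u).
  apply: etrans (esym (adm_integral_add u a2 a4)) _.
  apply: etrans _ (adm_integral_add u a1 a3).
  apply: (adm_integral_eq (F := fun u t => eps_density P (fun u => path_mul (Q u) (S u)) (v ord0) u t +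
    eps_density Q S (v ord0) u t) (G := fun u t => eps_density (fun u => path_mul (P u) (Q u)) S (v ord0) u t
    + eps_density P Q (v ord0) u t)); first exact: adm_add.
  move=> t It.
  have h1 : eps_density P (fun u => path_mul (Q u) (S u)) (v ord0) u t =
      ip (Th P u (v ord0) t) (hat_phi phi (Q u) t) +
      ip (Th P u (v ord0) t) (Ad phi (Q u t) (hat_phi phi (S u) t)).
    apply: etrans _ (ipDr hip _ _ _).
    exact (congr1 (ip _) (hat_phi_mul LC u pQ pS It)).
  have h2 : eps_density (fun u => path_mul (P u) (Q u)) S (v ord0) u t =
      ip (Ad phi (Q u t)^-1%g (Th P u (v ord0) t)) (hat_phi phi (S u) t) +
      ip (Th Q u (v ord0) t) (hat_phi phi (S u) t).
    apply: etrans _ (ipDl hip _ _ _).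
    exact (congr1 (ip^~ _) (path_Theta_mul LC u (v ord0) t pP pQ)).
  have h3 : ip (Ad phi (Q u t)^-1%g (Th P u (v ord0) t)) (hat_phi phi (S u) t) =
      ip (Th P u (v ord0) t) (Ad phi (Q u t) (hat_phi phi (S u) t)).
    apply: etrans _ (ipAd hip (Q u t)^-1%g _ _).
    exact (congr1 (ip _) (esym (AdK LC _ _))).
  apply: etrans (congr1 (+%R^~ _) h1) _.
  apply: etrans _ (congr1 (+%R^~ _) (esym (etrans h2 (congr1 (+%R^~ _) h3)))).
  exact (etrans (esym (addrA _ _ _)) (addrC _ _)).
exact (cocycle_arith _ main).
Qed.

End Identities.

(** * The circle group *)

Section Circle.
Context {R : realType}.
Notation reC := (@complex.Re R).
Notation imC := (@complex.Im R).
Local Notation plotU := (@plot R (@U1 R) _).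

Lemma normC1P (z : R[i]) : `|z| = 1 <-> reC z ^+ 2 + imC z ^+ 2 = 1.
Proof.
rewrite normc_def; split=> [[] h|->]; last by rewrite sqrtr1.
have n0 : 0 <= reC z ^+ 2 + imC z ^+ 2 by rewrite addr_ge0// sqr_ge0.
by rewrite -(sqr_sqrtr n0) h expr1n.
Qed.

Lemma reM (z w : R[i]) : reC (z * w) = reC z * reC w - imC z * imC w.
Proof. by case: z w => [a b] [c d]. Qed.
Lemma imM (z w : R[i]) : imC (z * w) = reC z * imC w + imC z * reC w.
Proof. by case: z w => [a b] [c d]. Qed.
Lemma complexP (z w : R[i]) : reC z = reC w -> imC z = imC w -> z = w.
Proof. by case: z w => [a b] [c d] /= -> ->. Qed.

Lemma pts_U1 (z : R[i]) : pts (@U1 R) z <-> `|z| = 1.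
Proof.
split=> [[h _ _]|h]; first exact: (h 0).
by split => [_||] //; exact: smooth_cst.
Qed.

Lemma U1_neq0 (z : R[i]) : pts (@U1 R) z -> z != 0.
Proof. by move/pts_U1 => h; rewrite -normr_gt0 h ltr01. Qed.

Lemma pts_U1M (z w : R[i]) : pts (@U1 R) z -> pts (@U1 R) w -> pts (@U1 R) (z * w).
Proof. by move=> /pts_U1 hz /pts_U1 hw; apply/pts_U1; rewrite normrM hz hw mulr1. Qed.
Lemma pts_U1V (z : R[i]) : pts (@U1 R) z -> pts (@U1 R) z^-1.
Proof. by move=> /pts_U1 hz; apply/pts_U1; rewrite normfV hz invr1. Qed.
Lemma pts_U11 : pts (@U1 R) (1 : R[i]).
Proof. by apply/pts_U1; rewrite normr1. Qed.

Lemma U1_inv (z : R[i]) : pts (@U1 R) z -> reC z^-1 = reC z /\ imC z^-1 = - imC z.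
Proof.
move=> pz; have /pts_U1/normC1P n := pz.
have -> : z^-1 = (reC z -i* imC z)%C.
  apply: (mulfI (U1_neq0 pz)); rewrite divff ?U1_neq0//.
  apply: complexP; rewrite ?reM ?imM /=; first by rewrite -n; ring.
  by ring.
by [].
Qed.

Lemma plotU_mul n (z w : 'rV[R]_n -> R[i]) : plotU z -> plotU w ->
  plotU (fun u => z u * w u).
Proof.
move=> [nz az bz] [nw aw bw]; split.
- by move=> u; rewrite normrM nz nw mulr1.
- move=> k; apply: (Ck_ext (f := fun u => reC (z u) * reC (w u) + - (imC (z u) * imC (w u)))).
    by move=> u; rewrite reM.
  exact (smooth_add (smooth_mul az aw) (smooth_opp (smooth_mul bz bw)) k).
- move=> k; apply: (Ck_ext (f := fun u => reC (z u) * imC (w u) + imC (z u) * reC (w u))).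
    by move=> u; rewrite imM.
  exact (smooth_add (smooth_mul az bw) (smooth_mul bz aw) k).
Qed.

Lemma plotU_pts n (z : 'rV[R]_n -> R[i]) u : plotU z -> pts (@U1 R) (z u).
Proof. by case=> h _ _; apply/pts_U1. Qed.

Lemma plotU_inv n (z : 'rV[R]_n -> R[i]) : plotU z -> plotU (fun u => (z u)^-1).
Proof.
move=> pz; have [nz az bz] := pz; split.
- by move=> u; rewrite normfV nz invr1.
- by move=> k; apply: (Ck_ext _ (az k)) => u; have [-> _] := U1_inv (plotU_pts u pz).
- move=> k; apply: (Ck_ext _ (smooth_opp bz k)) => u.
  by have [_ ->] := U1_inv (plotU_pts u pz).
Qed.

Lemma plotU_cst n (z : R[i]) : pts (@U1 R) z -> plotU (fun _ : 'rV[R]_n => z).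
Proof. by move/pts_U1 => h; split => // *; exact: smooth_cst. Qed.

Lemma plotU_comp n m (z : 'rV[R]_n -> R[i]) (h : 'rV[R]_m -> 'rV[R]_n) :
  plotU z -> smooth h -> plotU (fun u => z (h u)).
Proof.
move=> [nz az bz] sh; split=> //.
- exact (smooth_comp az sh).
- exact (smooth_comp bz sh).
Qed.

(** The imaginary part of [conj z * dz], which is dz / (i z) on the unit circle. *)
Definition dlog n (z : 'rV[R]_n -> R[i]) (u w : 'rV[R]_n) : R :=
  reC (z u) * 'D_w (fun x => imC (z x) : R) u - imC (z u) * 'D_w (fun x => reC (z x) : R) u.

Lemma is_derive_comp1 (V : normedModType R) (g : R -> R) (f : V -> R) x v dg df :
  is_derive (f x) (1 : R) g dg -> is_derive x v f df ->
  is_derive x v (fun y => g (f y)) (dg * df).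
Proof.
move=> [g1 g2] hf.
have dgf : differentiable g (f x) := (derivable1_diffP _ _).1 g1.
apply: is_derive_eq (is_derive_chain dgf hf) _.
apply: etrans (congr1 (fun L : R -> R => L df) (deriv1E g1)) _.
by rewrite derive1E g2 mulrC.
Qed.

Lemma is_derive_cosf (V : normedModType R) (f : V -> R) x v df :
  is_derive x v f df -> is_derive x v (fun y => cos (f y)) (- sin (f x) * df).
Proof. by move=> h; apply: is_derive_comp1 h; exact: is_derive_cos. Qed.
Lemma is_derive_sinf (V : normedModType R) (f : V -> R) x v df :
  is_derive x v f df -> is_derive x v (fun y => sin (f y)) (cos (f x) * df).
Proof. by move=> h; apply: is_derive_comp1 h; exact: is_derive_sin. Qed.

Lemma smooth_cos_sin (V : normedModType R) (f : V -> R) : smooth f ->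
  smooth (fun x => cos (f x)) /\ smooth (fun x => sin (f x)).
Proof.
move=> sf.
have dc x v := is_derive_cosf (derivableP (smooth_derivable x v sf)).
have ds x v := is_derive_sinf (derivableP (smooth_derivable x v sf)).
have cc : continuous (fun x => cos (f x)).
  move=> x; apply: continuous_comp; first exact: (smooth_continuous sf x).
  exact: continuous_cos.
have cs : continuous (fun x => sin (f x)).
  move=> x; apply: continuous_comp; first exact: (smooth_continuous sf x).
  exact: continuous_sin.
suff h k : Ck k (fun x => cos (f x)) /\ Ck k (fun x => sin (f x)).
  by split=> k; have [] := h k.
elim: k => [|k [IHc IHs]]; first by split; split.
have sD v := smooth_derive v sf.
split; split => //; split=> [x v|v].
- by have [] := dc x v.
- apply: (Ck_ext (f := fun x => (-1) *: (sin (f x) * 'D_v f x))).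
    by move=> x; have [_ ->] := dc x v; rewrite scaleN1r mulNr.
  apply: Ck_scale; exact (Ck_mul IHs (sD v k)).
- by have [] := ds x v.
- apply: (Ck_ext (f := fun x => cos (f x) * 'D_v f x)).
    by move=> x; have [_ ->] := ds x v.
  exact (Ck_mul IHc (sD v k)).
Qed.

Lemma norm_expi t : `|expi t : R[i]| = 1.
Proof. by apply/normC1P; rewrite /expi /= cos2Dsin2. Qed.

Lemma pts_expi t : pts (@U1 R) (expi t).
Proof. by apply/pts_U1; exact: norm_expi. Qed.

Lemma plotU_expi n (f : 'rV[R]_n -> R) : smooth f -> plotU (fun u => expi (f u)).
Proof.
move=> sf; have [sc ss] := smooth_cos_sin sf.
by split=> // u; exact: norm_expi.
Qed.

Lemma expi0 : expi 0 = 1 :> R[i].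
Proof. by rewrite /expi cos0 sin0. Qed.

(** The primitive is written as the integral of [t * f (s * t)] over s in [0, 1],
    rescaled to [0, 2 pi], so that smoothness is an instance of the theorem on
    integrals with parameters. *)
Lemma smooth_primitive (f : 'rV[R]_1 -> R) : smooth f ->
  exists T : 'rV[R]_1 -> R, [/\ smooth T, T 0 = 0 &
    forall t, 'D_(const_mx 1) T t = f t].
Proof.
move=> sf; pose w : 'rV[R]_1 := const_mx 1.
pose c : R := (2 * pi)^-1.
pose F (t : 'rV[R]_1) (s : R) : R := c * (t 0 0 * f ((c * s) *: t)).
have sarg : smooth (fun x : 'rV[R]_(1 + 1) => (c * time x) *: lsubmx x).
  apply/smooth_mx => i j k.
  apply: (Ck_ext (f := fun x => c * time x * lsubmx x i j)); first by move=> x; rewrite [RHS]mxE.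
  have sl : smooth (fun x : 'rV[R]_(1 + 1) => lsubmx x i j).
    by have /smooth_mx := @smooth_lsubmx R 1 1; exact.
  exact (smooth_mul (smooth_mul (smooth_cst _ c) (@smooth_time R 1)) sl k).
have sfa : smooth (fun x : 'rV[R]_(1 + 1) => f ((c * time x) *: lsubmx x)).
  exact (smooth_comp sf sarg).
have sl0 : smooth (fun x : 'rV[R]_(1 + 1) => lsubmx x 0 0).
  by have /smooth_mx := @smooth_lsubmx R 1 1; exact.
have aF : adm Icl F.
  have h := adm_smooth Icl (smooth_mul (smooth_cst _ c) (smooth_mul sl0 sfa)).
  apply: (adm_eq _ h) => u t _; by rewrite time_strip lsubmx_strip.
pose K (t : 'rV[R]_1) (s : R) : R := (c * s) * f ((c * s) *: t).
have aK : adm Icl K.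
  have h := adm_smooth Icl (smooth_mul (smooth_mul (smooth_cst _ c) (@smooth_time R 1)) sfa).
  apply: (adm_eq _ h) => u t _; by rewrite time_strip lsubmx_strip.
exists (fun t => path_integral (F t)); split.
- exact: adm_integral_smooth_cl.
- transitivity (path_integral (fun=> 0 : R)); last exact: path_integral0.
  by congr path_integral; apply/funext => s; rewrite /F !mxE mul0r mulr0.
- move=> t; apply: etrans (adm_integral_deriv t w (adm_op aF)) _.
  have t0 : 2 * pi != 0 :> R by exact: lt0r_neq0 (@tau_gt0 R).
  have -> : f t = K t (2 * pi) - K t 0.
    by rewrite /K /c mulVf// mul1r scale1r mulr0 mul0r subr0.
  rewrite -(path_integral_ftc t aK).
  congr path_integral; apply/funext => s.
  have tw : t = t 0 0 *: w by apply/rowP => j; rewrite !mxE (ord1 j) mulr1.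
  pose y := (c * s) *: t.
  have df z : derivable f y z := smooth_derivable y z sf.
  have h1 : is_derive t w (fun t' : 'rV[R]_1 => t' 0 0) 1.
    have di := @derivable_id R _ t w.
    apply: DeriveDef; first exact: (derivable_coord 0 0 di).
    by rewrite -(derive_coord 0 0 di) derive_id mxE.
  have h2 : is_derive t w (fun t' : 'rV[R]_1 => f ((c * s) *: t')) ('D_((c * s) *: w) f y).
    apply: (is_derive_affine (L := fun t' : 'rV[R]_1 => (c * s) *: t')) => //.
    by move=> h; rewrite scalerDr !scalerA [h * _]mulrC.
  have h3 : is_derive s (1 : R) (fun s' : R => f ((c * s') *: t)) ('D_(c *: t) f y).
    apply: (is_derive_affine (L := fun s' : R => (c * s') *: t)) => //.
    by move=> h; rewrite [h *: 1]mulr1 mulrDr scalerDl scalerA [h * c]mulrC.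
  have h4 : is_derive s (1 : R) (fun s' : R => c * s') c.
    have := is_deriveZ c (is_derive_id s (1 : R)).
    by rewrite [c *: 1]mulr1.
  have k1 := is_deriveZ c (is_deriveM h1 h2).
  have k2 := is_deriveM h4 h3.
  apply: etrans (@derive_val _ _ _ _ _ _ _ k1) _.
  apply: etrans _ (esym (derive1E _ _)); apply: etrans _ (esym (@derive_val _ _ _ _ _ _ _ k2)).
  have [_ e1] := derivable_scale_dir (c * s) (df w).
  have [_ e2] := derivable_scale_dir (c * t 0 0) (df w).
  have -> : c *: t = (c * t 0 0) *: w by rewrite {1}tw scalerA.
  rewrite e1 e2 /GRing.scale/= -/y.
  ring.
Qed.

Lemma zero_derive_cst (p : 'rV[R]_1 -> R) : smooth p ->
  (forall t, 'D_(const_mx 1) p t = 0) -> forall t, p t = p 0.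
Proof.
move=> sp p0 t; pose w : 'rV[R]_1 := const_mx 1.
have tw : t = t 0 0 *: w by apply/rowP => j; rewrite !mxE (ord1 j) mulr1.
have dp y : derivable p y t := smooth_derivable y t sp.
have [s _ sE] := mvt_line 0 dp.
rewrite add0r in sE; apply/eqP; rewrite -subr_eq0 sE add0r.
have [_ e] := derivable_scale_dir (t 0 0) (smooth_derivable (s *: t) w sp).
have -> : 'D_t p (s *: t) = 'D_(t 0 0 *: w) p (s *: t) by rewrite -tw.
by rewrite e p0 scaler0.
Qed.

(** For a primitive [T] of the logarithmic derivative of [z], the function
    [z * expi (- T)] has zero derivative. *)
Lemma circle_log (z : 'rV[R]_1 -> R[i]) : plotU z ->
  exists T : 'rV[R]_1 -> R, [/\ smooth T, T 0 = 0,
    forall t, z t = z 0 * expi (T t) &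
    forall t, 'D_(const_mx 1) T t = dlog z t (const_mx 1)].
Proof.
move=> pz; have [nz sa sb] := pz; set w : 'rV[R]_1 := const_mx 1.
pose a t : R := reC (z t); pose b t : R := imC (z t).
have sf : smooth (fun t => dlog z t w).
  exact (smooth_add (smooth_mul sa (smooth_derive w sb))
    (smooth_opp (smooth_mul sb (smooth_derive w sa)))).
have [T [sT T0 DT]] := smooth_primitive sf.
exists T; split => //.
have [sc ss] := smooth_cos_sin sT.
have ab1 t : a t ^+ 2 + b t ^+ 2 = 1 by apply/normC1P.
have da t : is_derive t w a ('D_w a t) := derivableP (smooth_derivable t w sa).
have db t : is_derive t w b ('D_w b t) := derivableP (smooth_derivable t w sb).
have dT t : is_derive t w T (dlog z t w).
  by apply: DeriveDef; [exact: smooth_derivable|exact: DT].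
have dc t := is_derive_cosf (dT t); have ds t := is_derive_sinf (dT t).
have ab' t : a t * 'D_w a t + b t * 'D_w b t = 0.
  have h := is_deriveD (is_deriveM (da t) (da t)) (is_deriveM (db t) (db t)).
  have e : a * a + b * b = cst 1.
    by apply/funext => x /=; rewrite -(ab1 x) !expr2.
  rewrite e in h; have := @derive_val _ _ _ _ _ _ _ h.
  rewrite derive_cst /GRing.scale/= => k; lra.
pose p t := a t * cos (T t) + b t * sin (T t).
pose q t := b t * cos (T t) - a t * sin (T t).
have sp : smooth p := smooth_add (smooth_mul sa sc) (smooth_mul sb ss).
have sq : smooth q := smooth_add (smooth_mul sb sc) (smooth_opp (smooth_mul sa ss)).
have p0 : forall t, p t = p 0.
  apply: zero_derive_cst => // t.
  have h := is_deriveD (is_deriveM (da t) (dc t)) (is_deriveM (db t) (ds t)).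
  apply: etrans (@derive_val _ _ _ _ _ _ _ h) _.
  rewrite /dlog -/(a t) -/(b t) /GRing.scale/=.
  move: (ab' t) (ab1 t); move: (a t) (b t) ('D_w a t) ('D_w b t) (cos (T t)) (sin (T t)).
  move=> A B A' B' C S e1 e2.
  have -> : A * (- S * (A * B' - B * A')) + C * A' + (B * (C * (A * B' - B * A')) + S * B')
    = C * (A' * (1 - (A ^+ 2 + B ^+ 2)) + A * (A * A' + B * B'))
      + S * (B' * (1 - (A ^+ 2 + B ^+ 2)) + B * (A * A' + B * B')) by ring.
  by rewrite e1 e2 subrr !mulr0 addr0 !mulr0 addr0.
have q0 : forall t, q t = q 0.
  apply: zero_derive_cst => // t.
  have h := is_deriveB (is_deriveM (db t) (dc t)) (is_deriveM (da t) (ds t)).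
  apply: etrans (@derive_val _ _ _ _ _ _ _ h) _.
  rewrite /dlog -/(a t) -/(b t) /GRing.scale/=.
  move: (ab' t) (ab1 t); move: (a t) (b t) ('D_w a t) ('D_w b t) (cos (T t)) (sin (T t)).
  move=> A B A' B' C S e1 e2.
  have -> : B * (- S * (A * B' - B * A')) + C * B' - (A * (C * (A * B' - B * A')) + S * A')
    = C * (B' * (1 - (A ^+ 2 + B ^+ 2)) + B * (A * A' + B * B'))
      - S * (A' * (1 - (A ^+ 2 + B ^+ 2)) + A * (A * A' + B * B')) by ring.
  by rewrite e1 e2 subrr !mulr0 addr0 !mulr0 subr0.
move=> t; have cs1 := cos2Dsin2 (T t).
have pE : a t * cos (T t) + b t * sin (T t) = a 0.
  by have := p0 t; rewrite /p T0 cos0 sin0 mulr1 mulr0 addr0.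
have qE : b t * cos (T t) - a t * sin (T t) = b 0.
  by have := q0 t; rewrite /q T0 cos0 sin0 mulr1 mulr0 subr0.
apply: complexP; rewrite ?reM ?imM /= -/(a t) -/(b t) -/(a 0) -/(b 0) -pE -qE;
  move: cs1; move: (a t) (b t) (cos (T t)) (sin (T t)) => A B C S e.
  have -> : (A * C + B * S) * C - (B * C - A * S) * S = A * (C ^+ 2 + S ^+ 2) by ring.
  by rewrite e mulr1.
have -> : (A * C + B * S) * S + (B * C - A * S) * C = B * (C ^+ 2 + S ^+ 2) by ring.
by rewrite e mulr1.
Qed.

Lemma dlogM n (z w : 'rV[R]_n -> R[i]) u v : plotU z -> plotU w ->
  dlog (fun x => z x * w x) u v = dlog z u v + dlog w u v.
Proof.
move=> [nz az bz] [nw aw bw]; rewrite /dlog.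
have da := derivableP (smooth_derivable u v az); have db := derivableP (smooth_derivable u v bz).
have dc := derivableP (smooth_derivable u v aw); have dd := derivableP (smooth_derivable u v bw).
have eI : 'D_v (fun x => imC (z x * w x) : R) u = _ :=
  etrans (congr1 (fun f : _ -> R => 'D_v f u) (funext (fun x => imM (z x) (w x))))
  (@derive_val _ _ _ _ _ _ _ (is_deriveD (is_deriveM da dd) (is_deriveM db dc))).
have eR : 'D_v (fun x => reC (z x * w x) : R) u = _ :=
  etrans (congr1 (fun f : _ -> R => 'D_v f u) (funext (fun x => reM (z x) (w x))))
  (@derive_val _ _ _ _ _ _ _ (is_deriveB (is_deriveM da dc) (is_deriveM db dd))).
apply: etrans (congr2 (fun x y => _ * x - _ * y) eI eR) _.
have /normC1P := nz u; have /normC1P := nw u.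
rewrite reM imM /GRing.scale/=.
move: ('D_v (fun x => reC (z x) : R) u) ('D_v (fun x => imC (z x) : R) u) => a' b'.
move: ('D_v (fun x => reC (w x) : R) u) ('D_v (fun x => imC (w x) : R) u) => c' d'.
move: (reC (z u)) (imC (z u)) (reC (w u)) (imC (w u)) => a b c e h1 h2.
transitivity ((a * b' - b * a') * (c ^+ 2 + e ^+ 2) + (c * d' - e * c') * (a ^+ 2 + b ^+ 2)).
  ring.
by rewrite h1 h2 !mulr1.
Qed.

Lemma dlog_cst n (z : R[i]) (u v : 'rV[R]_n) : dlog (fun=> z) u v = 0.
Proof. by rewrite /dlog !derive_cst !mulr0 subrr. Qed.

Lemma dlog_near n (z w : 'rV[R]_n -> R[i]) u v :
  (\forall x \near u, z x = w x) -> dlog z u v = dlog w u v.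
Proof.
move=> zw; rewrite /dlog (nbhs_singleton zw); congr (_ * _ - _ * _); apply: near_eq_derive;
  by apply: filterS zw => x ->.
Qed.

Lemma dlogV n (z : 'rV[R]_n -> R[i]) u v : plotU z ->
  dlog (fun x => (z x)^-1) u v = - dlog z u v.
Proof.
move=> pz; have := dlogM u v pz (plotU_inv pz).
have -> : (fun x => z x * (z x)^-1) = fun=> 1.
  by apply/funext => x; rewrite divff// U1_neq0//; exact: plotU_pts.
by rewrite dlog_cst => /eqP; rewrite eq_sym addrC addr_eq0 => /eqP.
Qed.

End Circle.

(** * Principal circle bundles and their connections *)

Section Bundles.
Context {R : realType}.
Notation plotU := (@plot R (@U1 R) _).

Definition reparametrizable (X : pspace R) : Prop :=
  forall m n (P : 'rV[R]_n -> X) (h : 'rV[R]_m -> 'rV[R]_n),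
    plot X P -> smooth h -> plot X (fun u => P (h u)).

Lemma plot_pts (X : pspace R) n (P : 'rV[R]_n -> X) u :
  reparametrizable X -> plot X P -> pts X (P u).
Proof. by move=> rX pP; exact (rX 0%N n P (fun=> u) pP (smooth_cst _ u)). Qed.

Lemma plot_cst (X : pspace R) n x : reparametrizable X -> pts X x ->
  plot X (fun _ : 'rV[R]_n => x).
Proof. by move=> rX px; exact (rX n 0%N (fun=> x) (fun=> 0) px (smooth_cst _ 0)). Qed.

Lemma smooth_on_pts (X Y : pspace R) (O : set X) (f : X -> Y) x :
  smooth_on O f -> pts X x -> O x -> pts Y (f x).
Proof.
move=> sf px Ox; have [Q pQ QP] := sf 0%N (fun=> x) 0 px Ox.
rewrite /pts /=; have -> // : (fun _ : 'rV[R]_0 => f x) = Q.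
apply/funext => u; have -> : u = 0 by apply/rowP => -[].
exact: (nbhs_singleton QP).
Qed.

(** A constant plot is unchanged by composition with a constant map, whose
    derivative is 0. *)
Lemma one_form_cst (X : pspace R) (A : diff_form 1 X) n (x : X) (u : 'rV[R]_n) v :
  reparametrizable X -> is_form A -> pts _ x -> A n (fun=> x) u v = 0.
Proof.
move=> rX fA px; have pc : plot _ (fun _ : 'rV[R]_n => x) by exact: plot_cst.
have h := form_comp fA u v pc (smooth_cst _ (0 : 'rV[R]_n)).
have -> : A n (fun=> x) u v = A n (fun=> x) 0 (fun i => 'D_(v i) (fun _ : 'rV[R]_n => (0 : 'rV[R]_n)) u) by exact: h.
have -> : (fun i => 'D_(v i) (fun _ : 'rV[R]_n => (0 : 'rV[R]_n)) u) =
   upd (fun=> 0) (ord0 : 'I_1) ((-1) *: 0 + 0).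
  by apply/funext => i; rewrite (ord1 i) upd_eq scaler0 addr0 derive_cst.
by rewrite (form_linear fA)// mulN1r addNr.
Qed.

Section Principal.
Variables (M : pspace R) (E : u1_bundle M).
Hypotheses (pE : principal E) (rM : reparametrizable M) (rE : reparametrizable (Defs.total E)).

Lemma act_plot n (e : 'rV[R]_n -> Defs.total E) (z : 'rV[R]_n -> U1) :
  plot (Defs.total E) e -> plotU z -> plot (Defs.total E) (fun u => bact (e u) (z u)).
Proof. by move=> pe pz; exact (principal_act pE (P := fun u => (e u, z u)) (conj pe pz)). Qed.

Lemma act_pts (e : Defs.total E) (z : U1) : pts _ e -> pts _ z -> pts _ (bact e z).
Proof. exact: act_plot. Qed.

Lemma fibre_torsor (e e' : Defs.total E) : pts _ e -> pts _ e' -> bproj e = bproj e' ->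
  exists2 z : U1, pts _ z & e' = bact e z.
Proof.
move=> pe pe' ee'; have px : pts M (bproj e) by exact (principal_proj pE pe).
have [D [s [c [_ Ox [ss sc] _ triv]]]] := principal_trivial pE px.
have h := triv e pe Ox; have h' : bact (s (bproj e)) (c e') = e'.
  by rewrite ee'; apply: triv => //; rewrite -ee'.
have ps : pts _ (s (bproj e)) by exact: smooth_on_pts ss px Ox.
have pc : pts _ (c e) by exact: smooth_on_pts sc pe Ox.
have pc' : pts _ (c e') by apply: smooth_on_pts sc pe' _; rewrite /preimage/= -ee'.
exists ((c e : R[i])^-1 * c e'); first by apply: pts_U1M => //; exact: pts_U1V.
apply: etrans (esym h') _.
apply: etrans _ (congr1 (fun x => bact x ((c e : R[i])^-1 * c e')) h).
rewrite (principal_actM pE)//; last by apply: pts_U1M => //; exact: pts_U1V.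
by rewrite mulVKf ?U1_neq0.
Qed.

Lemma act_inj (e : Defs.total E) (z w : U1) : pts _ e -> pts _ z -> pts _ w ->
  bact e z = bact e w -> z = w.
Proof.
move=> pe pz pw ezw.
have pwV : pts (@U1 R) (w : R[i])^-1 by exact: pts_U1V.
have h : bact e ((z : R[i]) * (w : R[i])^-1) = e.
  by rewrite -(principal_actM pE)// ezw (principal_actM pE)// divff ?U1_neq0// (principal_act1 pE).
have := principal_free pE pe (pts_U1M pz pwV) h.
move=> k; apply: (mulIf (U1_neq0 pwV)).
by rewrite k divff ?U1_neq0.
Qed.

Lemma open_plot (O : set (dtop M)) n (Q : 'rV[R]_n -> M) u : open O ->
  plot M Q -> O (Q u) -> \forall u' \near u, O (Q u').
Proof.
move=> oO pQ OQ; have := oO n Q pQ => oQ.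
exact: open_nbhs_nbhs.
Qed.

(** Both plots are compared with the section of a local trivialisation. *)
Lemma fibre_difference n (e e' : 'rV[R]_n -> Defs.total E) (u : 'rV[R]_n) :
  plot _ e -> plot _ e' -> (\forall u' \near u, bproj (e u') = bproj (e' u')) ->
  exists2 z : 'rV[R]_n -> U1, plotU z & \forall u' \near u, e' u' = bact (e u') (z u').
Proof.
move=> pe pe' ee'.
have pb : plot M (fun u => bproj (e u)) by exact: (principal_proj pE pe).
have pb' : plot M (fun u => bproj (e' u)) by exact: (principal_proj pE pe').
have px := plot_pts u rM pb.
have [D [s [c [oO Ox [ss sc] _ triv]]]] := principal_trivial pE px.
have Ox' : D (bproj (e' u)) by rewrite -(nbhs_singleton ee').
have [C pC CP] := sc n e u pe Ox; have [C' pC' CP'] := sc n e' u pe' Ox'.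
exists (fun u => (C u : R[i])^-1 * C' u).
  exact (plotU_mul (plotU_inv pC) pC').
have nO := open_plot oO pb Ox; have nO' := open_plot oO pb' Ox'.
near=> w.
have b1 : bproj (e w) = bproj (e' w) by near: w.
have o1 : D (bproj (e w)) by near: w.
have o2 : D (bproj (e' w)) by near: w.
have c1 : c (e w) = C w by near: w.
have c2 : c (e' w) = C' w by near: w.
have ps : pts _ (s (bproj (e w))) by exact: smooth_on_pts ss (plot_pts w rM pb) o1.
have h1 := triv (e w) (plot_pts w rE pe) o1; have h2 := triv (e' w) (plot_pts w rE pe') o2.
have pCw := plotU_pts w pC; have pCw' := plotU_pts w pC'.
apply: etrans (esym h2) _.
apply: etrans _ (congr1 (fun x => bact x ((C w : R[i])^-1 * C' w)) h1).
rewrite -b1 c1 c2 (principal_actM pE)//; last by apply: pts_U1M => //; exact: pts_U1V.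
by rewrite mulVKf ?U1_neq0.
Unshelve. all: by end_near. Qed.

Variable A : diff_form 1 (Defs.total E).
Hypothesis cA : is_connection A.
Let fA := connection_form cA.

Lemma one_form_lin n (e : 'rV[R]_n -> Defs.total E) u a (x y : 'rV[R]_n) : plot _ e ->
  A e u (fun=> a *: x + y) = a * A e u (fun=> x) + A e u (fun=> y).
Proof.
move=> pe; have E1 (w : 'rV[R]_n) : (fun _ : 'I_1 => w) = upd (fun=> 0) (ord0 : 'I_1) w.
  by apply/funext => i; rewrite (ord1 i) upd_eq.
by have := form_linear fA u (fun=> 0) ord0 a x y pe; rewrite -!E1.
Qed.

Lemma invariant_plot n (e : 'rV[R]_n -> Defs.total E) (z : U1) u v : plot _ e -> pts _ z ->
  A (fun u => bact (e u) z) u v = A e u v.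
Proof. by move=> pe pz; exact (connection_invariant cA pz u v pe). Qed.

(** By [circle_log], [z] has a logarithm [T] along the curve.  The curve is then
    the diagonal of a map of two variables: the first one moves [e], and the second
    one moves along a fibre, where the connection is normalised. *)
Lemma gauge_curve (e : 'rV[R]_1 -> Defs.total E) (z : 'rV[R]_1 -> U1) :
  plot _ e -> plotU z ->
  A (fun t => bact (e t) (z t)) 0 (fun=> const_mx 1) =
  A e 0 (fun=> const_mx 1) + dlog z 0 (const_mx 1).
Proof.
move=> pe pz; set w : 'rV[R]_1 := const_mx 1.
have [T [sT T0 zT DT]] := circle_log pz.
pose F (x : 'rV[R]_(1 + 1)) := bact (e (lsubmx x)) ((z 0 : R[i]) * expi (time x)).
have pz0 := plotU_pts 0 pz.
have pF : plot _ F.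
  apply: act_plot; first exact (rE pe (@smooth_lsubmx R 1 1)).
  exact (plotU_mul (plotU_cst _ pz0) (plotU_expi (@smooth_time R 1))).
have sk : smooth (fun t : 'rV[R]_1 => strip t (T t)).
  by apply: smooth_strip => //; exact: smooth_id.
have -> : (fun t => bact (e t) (z t)) = F \o (fun t => strip t (T t)).
  by apply/funext => t; rewrite /F /= lsubmx_strip time_strip zT.
rewrite (form_comp fA 0 _ pF sk) /=.
have sTc : smooth (fun t => const_mx (T t) : 'rV[R]_1).
  by apply/smooth_mx => i j k; apply: (Ck_ext _ (sT k)) => t; rewrite mxE.
have -> : 'D_w (fun t : 'rV[R]_1 => strip t (T t)) 0 = dlog z 0 w *: strip 0 1 + strip w 0.
  have [_ ->] := derive_row_mx (@derivable_id _ _ 0 w) (smooth_derivable 0 w sTc).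
  rewrite derive_id stripZ stripD scaler0 add0r mulr1 addr0; congr row_mx.
  apply/rowP => j; apply: etrans (derive_coord 0 j (smooth_derivable 0 w sTc)) _.
  rewrite [RHS]mxE; apply: etrans _ (DT 0).
  apply: (congr1 (fun f : 'rV[R]_1 -> R => 'D_w f 0)).
  by apply/funext => t; rewrite mxE.
rewrite (one_form_lin _ _ _ _ pF) T0 addrC; congr (_ + _).
  have sk1 : smooth (fun t : 'rV[R]_1 => strip t 0) by exact: smooth_row_l.
  have h := form_comp fA (0 : 'rV[R]_1) (fun=> w) pF sk1.
  rewrite derive_strip in h; rewrite -h.
  apply: etrans (invariant_plot 0 (fun=> w) pe pz0).
  congr (A _ _); apply/funext => t; rewrite /F /= lsubmx_strip time_strip.
  by rewrite expi0 mulr1.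
rewrite -[RHS]mulr1; congr (_ * _).
have sk2 : smooth (fun t : 'rV[R]_1 => strip (0 : 'rV[R]_1) (t 0 0)).
  by apply: smooth_strip; [exact: smooth_cst|exact: smooth_coord].
have h := form_comp fA (0 : 'rV[R]_1) (fun=> w) pF sk2.
have D2 : 'D_w (fun t : 'rV[R]_1 => strip (0 : 'rV[R]_1) (t 0 0)) 0 = strip 0 1.
  have -> : (fun t : 'rV[R]_1 => strip (0 : 'rV[R]_1) (t 0 0)) = (fun t : 'rV[R]_1 => row_mx 0 t).
    by apply/funext => t; congr row_mx; apply/rowP => j; rewrite mxE (ord1 j).
  by rewrite derive_row_r.
rewrite D2 /= mxE in h; rewrite -h.
have pe0 := plot_pts 0 rE pe.
have pez := act_pts pe0 pz0.
rewrite -(connection_vertical cA pez).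
congr (A _ _); apply/funext => t; rewrite /F /= lsubmx_strip time_strip.
by rewrite (principal_actM pE)//; exact: pts_expi.
Qed.

(** A 1-form is determined by its values on curves, which reduces this to
    [gauge_curve] on the line through [u]. *)
Lemma gauge_plot n (e : 'rV[R]_n -> Defs.total E) (z : 'rV[R]_n -> U1) u v :
  plot _ e -> plotU z ->
  A (fun x => bact (e x) (z x)) u v = A e u v + dlog z u (v ord0).
Proof.
move=> pe pz; set w := v ord0.
have vw : v = fun=> w by apply/funext => i; rewrite (ord1 i).
pose h (t : 'rV[R]_1) := u + t 0 0 *: w.
have sh : smooth h.
  apply: smooth_add; first exact: smooth_cst.
  apply/smooth_mx => i j k; apply: (Ck_ext (f := fun t : 'rV[R]_1 => t 0 0 * w i j)).
    by move=> t; rewrite mxE.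
  exact (smooth_mul (smooth_coord 0 0) (smooth_cst _ (w i j)) k).
have h0 : h 0 = u by rewrite /h mxE scale0r addr0.
have Dh : 'D_(const_mx 1) h 0 = w.
  apply: derive_val; rewrite /h; apply: is_derive_eq.
    apply: (is_derive_affine (g := id) (w := w)); last exact: derivable_id.
    by move=> s; rewrite addr0 !mxE mulr1 scale0r addr0 addrC.
  exact: derive_id.
have pez := act_plot pe pz.
have E1 := form_comp fA (0 : 'rV[R]_1) (fun=> const_mx 1) pez sh.
have E2 := form_comp fA (0 : 'rV[R]_1) (fun=> const_mx 1) pe sh.
rewrite /= Dh h0 -vw in E1 E2.
rewrite -E1 -E2; apply: etrans (gauge_curve (rE pe sh) (plotU_comp pz sh)) _.
congr (_ + _); have [_ sa sb] := pz; rewrite /dlog h0.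
have eD (f : 'rV[R]_n -> R) : smooth f -> 'D_(const_mx 1) (fun x => f (h x)) 0 = 'D_w f u.
  move=> sf; apply: etrans (derive_chain (smooth_diff _ sf) (smooth_derivable _ _ sh)) _.
  by rewrite Dh h0.
exact (congr2 (fun x y => _ * x - _ * y) (eD _ sb) (eD _ sa)).
Qed.

End Principal.

Lemma dlog_prod n k (z : 'I_k -> 'rV[R]_n -> R[i]) u v : (forall i, plotU (z i)) ->
  dlog (fun x => \prod_(i < k) z i x) u v = \sum_(i < k) dlog (z i) u v.
Proof.
move=> pz; suff : plotU (fun x => \prod_(i < k) z i x) /\
    dlog (fun x => \prod_(i < k) z i x) u v = \sum_(i < k) dlog (z i) u v by case.
elim: k z pz => [|k IH] z pz.
  rewrite big_ord0; have -> : (fun x => \prod_(i < 0) z i x) = fun=> 1.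
    by apply/funext => x; rewrite big_ord0.
  by split; [apply: plotU_cst; exact: pts_U11|exact: dlog_cst].
have [p1 d1] := IH (fun i => z (lift ord0 i)) (fun i => pz _).
have -> : (fun x => \prod_(i < k.+1) z i x) =
    fun x => z ord0 x * \prod_(i < k) z (lift ord0 i) x.
  by apply/funext => x; rewrite big_ord_recl.
split; first exact (plotU_mul (pz _) p1).
by rewrite dlogM// d1 big_ord_recl.
Qed.

End Bundles.

(** * Tensor products and the connections induced on them *)

Section TensorClass.
Context {R : realType}.
Notation plotU := (@plot R (@U1 R) _).
Variables (X Y : pspace R) (p : Y -> X) (m : nat) (E : u1_bundle (fibre_power p m)).

(** The character of U(1)^k whose kernel is divided out in the tensor product. *)
Definition alternating_prod k (z : 'I_k -> R[i]) : R[i] :=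
  \prod_(i < k) (if odd i then (z i)^-1 else z i).

Lemma alternating_prodM k (z w : 'I_k -> R[i]) :
  alternating_prod (fun i => z i * w i) = alternating_prod z * alternating_prod w.
Proof.
rewrite /alternating_prod -big_split; apply: eq_bigr => i _ /=.
by case: odd => //; rewrite invfM.
Qed.

Lemma alternating_prod1 k : alternating_prod (fun _ : 'I_k => 1) = 1.
Proof. by rewrite /alternating_prod big1// => i _; rewrite invr1 if_same. Qed.

Lemma alternating_prodV k (z : 'I_k -> R[i]) :
  alternating_prod (fun i => (z i)^-1) = (alternating_prod z)^-1.
Proof.
rewrite /alternating_prod -prodfV; apply: eq_bigr => i _.
by case: odd.
Qed.

Lemma alternating_prod_upd k (z : 'I_k.+1 -> R[i]) c :
  alternating_prod (upd z ord0 (z ord0 * c)) = alternating_prod z * c.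
Proof.
rewrite /alternating_prod big_ord_recl [in RHS]big_ord_recl /= upd_eq.
rewrite [RHS]mulrAC; congr (_ * _).
Qed.

Local Notation tuple := ('I_m.+1 -> Defs.total E).

Definition tact (e : tuple) (z : 'I_m.+1 -> @U1 R) : tuple := fun i => bact (e i) (z i).

(** The group laws of the action at a point.  They hold at the points of a
    principal bundle and at those of the tensor products built from it, so that
    tensor products can be iterated. *)
Definition acted (x : Defs.total E) : Prop :=
  bact x (1 : R[i]) = x /\
  forall z w : @U1 R, pts (@U1 R) z -> pts (@U1 R) w ->
    bact (bact x z) w = bact x ((z : R[i]) * w).

Lemma tact_act (e : tuple) z w : (forall i, acted (e i)) -> (forall i, pts (@U1 R) (z i)) ->
  (forall i, pts (@U1 R) (w i)) ->
  tact (tact e z) w = tact e (fun i => (z i : R[i]) * w i).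
Proof.
by move=> ae pz pw; apply/funext => i; rewrite /tact (ae i).2.
Qed.

(** Moving a tuple by [z] changes its class through [alternating_prod z] only. *)
Lemma tensor_class_tact (e : tuple) (z : 'I_m.+1 -> @U1 R) : (forall i, acted (e i)) ->
  (forall i, pts (@U1 R) (z i)) ->
  tensor_class (tact e z) = [set e' | exists v : 'I_m.+1 -> @U1 R,
    [/\ forall i, pts (@U1 R) (v i), alternating_prod v = alternating_prod z & e' = tact e v]].
Proof.
move=> pe pz; apply/seteqP; split=> e' /=.
  move=> [w [pw w1 ->]]; exists (fun i => (z i : R[i]) * w i); split.
  - by move=> i; exact: pts_U1M.
  - by rewrite alternating_prodM [X in _ * X]w1 mulr1.
  - exact (tact_act pe pz pw).
move=> [v [pv vz ->]].
have pzv i : pts (@U1 R) ((z i : R[i])^-1 * v i) by apply: pts_U1M => //; exact: pts_U1V.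
exists (fun i => (z i : R[i])^-1 * v i); split => //.
- rewrite -[LHS]/(alternating_prod (fun i => (z i : R[i])^-1 * v i)).
  rewrite alternating_prodM alternating_prodV vz mulVf//.
  apply/prodf_neq0 => i _; case: odd; rewrite ?invr_eq0; exact: U1_neq0.
- rewrite -[RHS]/(tact (tact e z) (fun i => (z i : R[i])^-1 * v i)) (tact_act pe pz pzv).
  by congr tact; apply/funext => i; rewrite mulVKf ?U1_neq0.
Qed.

Lemma tact1 (e : tuple) : (forall i, acted (e i)) -> tact e (fun=> 1 : R[i]) = e.
Proof. by move=> ae; apply/funext => i; exact: (ae i).1. Qed.

Lemma tensor_class_eq (e : tuple) (z w : 'I_m.+1 -> @U1 R) : (forall i, acted (e i)) ->
  (forall i, pts (@U1 R) (z i)) -> (forall i, pts (@U1 R) (w i)) ->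
  alternating_prod z = alternating_prod w ->
  tensor_class (tact e z) = tensor_class (tact e w).
Proof. by move=> pe pz pw zw; rewrite !tensor_class_tact// zw. Qed.

Lemma tensor_class_refl (e : tuple) : (forall i, acted (e i)) -> tensor_class e e.
Proof.
move=> pe; exists (fun=> 1 : R[i]); split.
- by move=> i; exact: pts_U11.
- exact: alternating_prod1.
- exact/esym/tact1.
Qed.

Lemma upd_tact (e : tuple) (z : 'I_m.+1 -> @U1 R) (c : @U1 R) : (forall i, acted (e i)) ->
  (forall i, pts (@U1 R) (z i)) -> pts (@U1 R) c ->
  upd (tact e z) ord0 (bact (tact e z ord0) c) = tact e (upd z ord0 ((z ord0 : R[i]) * c)).
Proof.
move=> ae pz pc; apply/funext => i; rewrite /tact.
have [->|i0] := eqVneq i ord0; last by rewrite !upd_neq.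
by rewrite !upd_eq (ae ord0).2.
Qed.

Lemma pts_upd (z : 'I_m.+1 -> @U1 R) (c : @U1 R) : (forall i, pts (@U1 R) (z i)) ->
  pts (@U1 R) c -> forall i, pts (@U1 R) (upd z ord0 ((z ord0 : R[i]) * c) i).
Proof. by move=> pz pc i; rewrite /upd; case: ifP => // _; exact: pts_U1M. Qed.

Hypotheses (pE : principal E) (rY : reparametrizable Y) (rE : reparametrizable (Defs.total E)).

Lemma acted_pts (x : Defs.total E) : pts _ x -> acted x.
Proof.
by move=> px; split; [exact: (principal_act1 pE)|move=> z w; exact: (principal_actM pE)].
Qed.

Lemma delta_act (y : 'I_m.+1 -> Y) (e : tuple) (c : @U1 R) : (forall i, pts _ (e i)) ->
  pts (@U1 R) c ->
  bact (tensor_quotient (p := p) (E := E) (y, e) : Defs.total (delta_bundle E)) c =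
  tensor_quotient (p := p) (E := E) (y, upd e ord0 (bact (e ord0) c)).
Proof.
move=> pe pc; have ae i := acted_pts (pe i); rewrite /tensor_quotient /=; congr (_, _).
have p1 : forall i : 'I_m.+1, pts (@U1 R) (1 : R[i]) by move=> i; exact: pts_U11.
have e1 : upd e ord0 (bact (e ord0) c) =
    tact e (upd (fun=> 1 : R[i]) ord0 ((1 : R[i]) * c)).
  by rewrite -(upd_tact ae p1 pc) tact1.
rewrite e1 (tensor_class_tact ae (pts_upd p1 pc)) alternating_prod_upd alternating_prod1.
rewrite -[in LHS](tact1 ae) (tensor_class_tact ae p1) alternating_prod1.
apply/seteqP; split=> e' /=.
  move=> [_ [v [pv v1 ->]] <-]; exists (upd v ord0 ((v ord0 : R[i]) * c)); split.
  - exact: pts_upd.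
  - by rewrite alternating_prod_upd v1.
  - exact (upd_tact ae pv pc).
move=> [v [pv v1 ->]]; have pcV := pts_U1V pc.
exists (tact e (upd v ord0 ((v ord0 : R[i]) * (c : R[i])^-1))).
  exists (upd v ord0 ((v ord0 : R[i]) * (c : R[i])^-1)); split => //.
  - exact: pts_upd.
  - by rewrite alternating_prod_upd v1 mul1r divff// U1_neq0.
rewrite (upd_tact ae (pts_upd pv pcV) pc); congr tact.
apply/funext => i; have [->|i0] := eqVneq i ord0; last by rewrite !upd_neq.
by rewrite !upd_eq divfK// U1_neq0.
Qed.

(** In a tensor product, a scalar can be moved from one factor to another. *)
Lemma delta_act_tact (y : 'I_m.+1 -> Y) (e : tuple) (z : 'I_m.+1 -> @U1 R) (c : @U1 R) :
  (forall i, pts _ (e i)) -> (forall i, pts (@U1 R) (z i)) -> pts (@U1 R) c ->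
  alternating_prod z = c ->
  bact (tensor_quotient (p := p) (E := E) (y, e) : Defs.total (delta_bundle E)) c =
  tensor_quotient (p := p) (E := E) (y, tact e z).
Proof.
move=> pe pz pc zc; have ae i := acted_pts (pe i).
have p1 : forall i : 'I_m.+1, pts (@U1 R) (1 : R[i]) by move=> i; exact: pts_U11.
have e1 : upd e ord0 (bact (e ord0) c) =
    tact e (upd (fun=> 1 : R[i]) ord0 ((1 : R[i]) * c)).
  by rewrite -(upd_tact ae p1 pc) tact1.
rewrite delta_act// e1 /tensor_quotient; congr (_, _).
apply: (tensor_class_eq ae) => //; first exact: pts_upd.
by rewrite alternating_prod_upd alternating_prod1 mul1r zc.
Qed.

Lemma delta_actM (y : 'I_m.+1 -> Y) (e : tuple) (c c' : @U1 R) : (forall i, pts _ (e i)) ->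
  pts (@U1 R) c -> pts (@U1 R) c' ->
  let q := tensor_quotient (p := p) (E := E) (y, e) : Defs.total (delta_bundle E) in
  bact (bact q c) c' = bact q ((c : R[i]) * c').
Proof.
move=> pe pc pc' q.
have pu : forall i, pts _ (upd e ord0 (bact (e ord0) c) i).
  by move=> i; rewrite /upd; case: ifP => // _; exact: (act_pts pE).
rewrite /q (delta_act y pe pc) (delta_act y pu pc') (delta_act y pe (pts_U1M pc pc')).
congr tensor_quotient; congr (_, _); apply/funext => i.
have [->|i0] := eqVneq i ord0; last by rewrite !upd_neq.
by rewrite !upd_eq (principal_actM pE).
Qed.

Lemma delta_acted (y : 'I_m.+1 -> Y) (e : tuple) : (forall i, pts _ (e i)) ->
  let q := tensor_quotient (p := p) (E := E) (y, e) : Defs.total (delta_bundle E) in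
  bact q (1 : R[i]) = q /\
  forall z w : @U1 R, pts (@U1 R) z -> pts (@U1 R) w ->
    bact (bact q z) w = bact q ((z : R[i]) * w).
Proof.
move=> pe q; split=> [|z w pz pw]; last exact: delta_actM.
have p1 : forall i : 'I_m.+1, pts (@U1 R) (1 : R[i]) by move=> i; exact: pts_U11.
rewrite /q (delta_act_tact y pe p1 pts_U11 (alternating_prod1 _)) tact1// => i.
exact: acted_pts.
Qed.

Section Descent.
Variable A : diff_form 1 (Defs.total E).
Hypothesis cA : is_connection A.
Let fA := connection_form cA.
Notation tplot Q := (plot (tuple_space E) Q).

Definition tuple_form n (Q : 'rV[R]_n -> tuple_space E) u v : R :=
  \sum_(i < m.+1) (-1) ^+ i * A (fun u' => (Q u').2 i) u v.

(** Plots of a tensor product are images of plots of tuples only locally. *)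
Definition delta_lift n (P : 'rV[R]_n -> delta_total E) (u : 'rV[R]_n) (Q : 'rV[R]_n -> tuple_space E) :=
  tplot Q /\ \forall u' \near u, P u' = tensor_quotient (Q u').

Lemma fibre_power_reparam k : reparametrizable (fibre_power p k).
Proof.
move=> n1 n2 P h [pP cP] sh; split=> [i|u i j]; last exact: cP.
exact (rY (pP i) sh).
Qed.

Lemma tuple_reparam : reparametrizable (tuple_space E).
Proof.
move=> n1 n2 P h [p1 p2 p3] sh; split.
- exact (fibre_power_reparam p1 sh).
- by move=> i; exact (rE (p2 i) sh).
- by move=> u i; exact: p3.
Qed.

(** Two lifts differ by functions [z_i] to U(1) with alternating product 1.  By
    [gauge_plot] the sum changes by the alternating sum of the [dlog z_i], which is
    [dlog] of that product. *)
Lemma tuple_form_lift n (P : 'rV[R]_n -> delta_total E) u Q Q' v :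
  delta_lift P u Q -> delta_lift P u Q' -> tuple_form Q u v = tuple_form Q' u v.
Proof.
move=> [pQ PQ] [pQ' PQ']; have [q1 q2 q3] := pQ; have [q1' q2' q3'] := pQ'.
have eQ : \forall u' \near u, (Q u').1 = (Q' u').1 /\ tensor_class (Q u').2 = tensor_class (Q' u').2.
  near=> w; have e1 : P w = tensor_quotient (Q w) by near: w.
  have e2 : P w = tensor_quotient (Q' w) by near: w.
  by rewrite e1 in e2; case: e2.
have zex i : exists2 z : 'rV[R]_n -> @U1 R, plotU z &
    \forall u' \near u, (Q' u').2 i = bact ((Q u').2 i) (z u').
  apply: (fibre_difference pE (@fibre_power_reparam m) rE (q2 i) (q2' i)).
  by apply: filterS eQ => w [e _]; rewrite q3 q3' e.
pose z i := projT1 (cid2 (zex i)).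
have pz i : plotU (z i) by rewrite /z; case: cid2.
have zP i : \forall u' \near u, (Q' u').2 i = bact ((Q u').2 i) (z i u').
  by rewrite /z; case: cid2.
have zP' : \forall u' \near u, forall i, (Q' u').2 i = bact ((Q u').2 i) (z i u').
  exact: (near_forallI (F := nbhs u) (P := fun i u' => (Q' u').2 i = bact ((Q u').2 i) (z i u'))).
have zprod : \forall u' \near u, alternating_prod (fun i => z i u') = 1.
  apply: filterS2 eQ zP' => w [_ cl] zw.
  have pts2 i : pts _ ((Q w).2 i) := plot_pts w rE (q2 i).
  have pts2' i : pts _ ((Q' w).2 i) := plot_pts w rE (q2' i).
  have := tensor_class_refl (fun i => acted_pts (pts2' i)); rewrite -cl => -[t [pt t1 eq]].
  rewrite -t1; congr alternating_prod; apply/funext => i.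
  apply: (act_inj pE (pts2 i) (plotU_pts w (pz i)) (pt i)).
  by rewrite -zw eq.
have dz : \sum_(i < m.+1) (-1) ^+ i * dlog (z i) u (v ord0) = 0.
  have pz' (i : 'I_m.+1) : plotU (fun x => if odd i then (z i x : R[i])^-1 else z i x).
    by case: (odd i) => //; exact: plotU_inv.
  have h1 := dlog_prod u (v ord0) pz'.
  have h2 := etrans (dlog_near (w := fun=> 1) (v ord0) zprod) (dlog_cst 1 u (v ord0)).
  apply: etrans _ (etrans (esym h1) h2); apply: eq_bigr => i _; rewrite -signr_odd.
  case: (odd i); last by rewrite expr0 mul1r.
  by rewrite expr1 mulN1r dlogV.
have main i : A (fun u' => (Q' u').2 i) u v = A (fun u' => (Q u').2 i) u v + dlog (z i) u (v ord0).
  rewrite -(gauge_plot pE rE cA u v (q2 i) (pz i)).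
  apply: (form_local fA) => //.
  exact (act_plot pE (q2 i) (pz i)).
apply/esym; apply: etrans (addr0 _); apply: etrans _ (congr1 (+%R _) dz).
rewrite /tuple_form -big_split; apply: eq_bigr => i _ /=.
by rewrite main mulrDr.
Unshelve. all: by end_near. Qed.

(** The choice of the lift is immaterial by [tuple_form_lift]; the default 0
    concerns only maps that are not plots. *)
Definition descended_form : diff_form 1 (Defs.total (delta_bundle E)) :=
  fun n P u v => match pselect (exists Q, delta_lift P u Q) with
    | left h => tuple_form (projT1 (cid h)) u v
    | right _ => 0 end.

Lemma descended_formE n (P : 'rV[R]_n -> delta_total E) u v Q :
  delta_lift P u Q -> descended_form P u v = tuple_form Q u v.
Proof.
move=> PQ; rewrite /descended_form; case: pselect => [h|[]]; last by exists Q.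
by case: cid => Q' PQ' /=; exact: tuple_form_lift PQ' PQ.
Qed.

Lemma delta_lift_ex n (P : 'rV[R]_n -> delta_total E) u : plot (delta_total E) P ->
  exists Q, delta_lift P u Q.
Proof. by move=> pP; have [Q pQ PQ] := pP u; exists Q. Qed.

Lemma delta_lift_act n (P : 'rV[R]_n -> delta_total E) u Q (c : 'rV[R]_n -> @U1 R) :
  delta_lift P u Q -> plotU c ->
  delta_lift (fun u => bact (P u : Defs.total (delta_bundle E)) (c u)) u
   (fun u => ((Q u).1, upd (Q u).2 ord0 (bact ((Q u).2 ord0) (c u)))).
Proof.
move=> [pQ PQ] pc; have [q1 q2 q3] := pQ.
have pts2 w i : pts _ ((Q w).2 i) := plot_pts w rE (q2 i).
split; last first.
  apply: filterS PQ => w ->.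
  have := delta_act (Q w).1 (pts2 w) (plotU_pts w pc).
  by rewrite -surjective_pairing.
split.
- exact q1.
- move=> i; have [->|i0] := eqVneq i ord0.
    rewrite (_ : (fun u0 => _) = fun w => bact ((Q w).2 ord0) (c w)).
      exact (act_plot pE (q2 ord0) pc).
    by apply/funext => w; rewrite /= upd_eq.
  rewrite (_ : (fun u0 => _) = fun w => (Q w).2 i); first exact: q2.
  by apply/funext => w; rewrite /= upd_neq.
- move=> w i; rewrite /upd /=; case: eqP => [->|_]; last exact: q3.
  by rewrite (principal_fibre pE) ?q3//; exact: plotU_pts.
Qed.

(** Each clause is local, hence can be checked on a lift. *)
Lemma descended_connection : delta_connection A descended_form.
Proof.
split; last first.
  move=> n Q u v pQ.
  apply: (@descended_formE n (fun u => tensor_quotient (Q u)) u v Q).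
  by split => //; near=> w.
have formE n (P : 'rV[R]_n -> delta_total E) u Q : delta_lift P u Q ->
    forall v, descended_form P u v = tuple_form Q u v by move=> h v; exact: descended_formE.
split.
- split.
  + move=> n P v pP; apply: smooth_local => u.
    have [Q pQ PQ] := pP u; have [q1 q2 q3] := pQ.
    exists (fun u => tuple_form Q u v).
      apply: smooth_sum => i; apply: (smooth_mul (f := fun=> (-1) ^+ i)); first exact: smooth_cst.
      exact (form_smooth fA v (q2 i)).
    by apply: filterS (near_near PQ) => w h; apply: descended_formE; split.
  + move=> n P P' u v pP pP' PP'; have [Q pQ PQ] := pP u.
    rewrite (@formE _ P u Q)// (@formE _ P' u Q)//; split => //.
    by apply: filterS2 PP' PQ => w <-.
  + move=> k n P h u v pP sh; have [Q pQ PQ] := pP (h u); have [q1 q2 q3] := pQ.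
    have L : delta_lift (P \o h) u (fun u => Q (h u)).
      split; first exact (tuple_reparam pQ sh).
      exact: (near_smooth (P := fun z => P z = tensor_quotient (Q z)) sh PQ).
    rewrite (@formE _ P (h u) Q)// (formE _ _ _ _ L) /tuple_form.
    apply: eq_bigr => i _; congr (_ * _).
    exact (form_comp fA u v (q2 i) sh).
  + move=> n P u v i a x y pP; have [Q PQ] := delta_lift_ex u pP.
    have [[q1 q2 q3] _] := PQ.
    rewrite !(formE _ _ _ _ PQ) /tuple_form mulr_sumr -big_split; apply: eq_bigr => j _ /=.
    by rewrite (form_linear fA u v i a x y (q2 j)) mulrDr mulrCA.
  + by move=> n P u v i j _; rewrite !ord1 eqxx.
- move=> c pc n P u v pP; have [Q PQ] := delta_lift_ex u pP.
  have [[q1 q2 q3] _] := PQ.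
  have L := delta_lift_act PQ (plotU_cst n pc).
  rewrite (formE _ _ _ _ PQ); apply: etrans (formE _ _ _ _ L v) _.
  rewrite /tuple_form; apply: eq_bigr => i _; congr (_ * _).
  have [->|i0] := eqVneq i ord0.
    apply: etrans (invariant_plot cA u v (q2 ord0) pc).
    by congr (A _ _); apply/funext => w; rewrite /= upd_eq.
  by congr (A _ _); apply/funext => w; rewrite /= upd_neq.
- move=> e pe; have [Q PQ] := delta_lift_ex (0 : 'rV[R]_0) pe.
  have [[q1 q2 q3] Pe] := PQ.
  have L0 : delta_lift (fun _ : 'rV[R]_1 => e) 0 (fun=> Q 0).
    split; first exact: (plot_cst _ tuple_reparam (plot_pts 0 tuple_reparam PQ.1)).
    by near=> w; exact: nbhs_singleton Pe.
  have pexp : plotU (fun t : 'rV[R]_1 => expi (t 0 0)).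
    by apply: plotU_expi; exact: smooth_coord.
  have L := delta_lift_act L0 pexp.
  have pts2 i : pts _ ((Q 0).2 i) := plot_pts 0 rE (q2 i).
  rewrite (formE _ _ _ _ L) /tuple_form big_ord_recl expr0 mul1r big1 ?addr0.
    apply: etrans _ (connection_vertical cA (pts2 ord0)).
    by congr (A _ _); apply/funext => t; rewrite /= upd_eq.
  move=> i _; rewrite (_ : (fun u' => _) = fun=> (Q 0).2 (lift ord0 i)).
    by rewrite (one_form_cst _ _ rE fA)// mulr0.
  by apply/funext => t; rewrite /= upd_neq.
Unshelve. all: by end_near. Qed.

End Descent.
End TensorClass.

(** * The path fibration *)

Section PathFibration.
Context {R : realType} (G : smooth_group R) (d : nat) (phi : 'rV[R]_d -> G).
Hypothesis LC : unit_chart phi.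
Let hphi1 := unit_chart_unit LC.
Notation plotG := (@plot R (group_space G) _).
Notation pth := (path_plot (G := G)).
Notation tau := (2 * pi : R).

Lemma PG_reparam : reparametrizable (PG G).
Proof. by move=> m n P h; exact (path_comp_plot LC (P := P) (h := h)). Qed.

Lemma OmegaG_reparam : reparametrizable (OmegaG G).
Proof.
move=> m n P h [pP P1] sh; split; first exact (path_comp_plot LC pP sh).
by move=> u; exact: P1.
Qed.

Lemma plotG_range n (Q : 'rV[R]_n -> G) (u : 'rV[R]_n) : plotG Q -> range phi (Q u) ->
  exists2 h : 'rV[R]_n -> 'rV[R]_d, smooth h & \forall u' \near u, Q u' = phi (h u').
Proof. by case: (unit_chart_chart LC) => _ _; exact. Qed.

Lemma phi_coord g : range phi g -> phi (Defs.coord phi g) = g.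
Proof. by move=> [x _ <-]; rewrite (coordK LC). Qed.

Lemma open_range_phi n (Q : 'rV[R]_n -> G) : plotG Q -> open (Q @^-1` range phi).
Proof.
move=> pQ; rewrite openE => u /= Qu; have [h _ hP] := plotG_range pQ Qu.
by apply: filterS hP => w; rewrite /preimage/= => ->; exists (h w).
Qed.

(** Rays in the chart give paths that start at 1 and depend smoothly on their end
    points. *)
Lemma ray_plot n (h : 'rV[R]_n -> 'rV[R]_d) : smooth h ->
  pth (fun u t => phi ((clamp t / tau) *: h u)).
Proof.
move=> sh; split.
- by move=> u; rewrite (clamp_id Icl0) mul0r scale0r.
- by move=> u t; rewrite [clamp (clamp t)]clamp_id//; exact: clamp_Icl.
- move=> x Sx; exists (fun x => phi ((time x / tau) *: h (lsubmx x))).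
    apply: (plotG_comp LC (plotG_phi LC)).
    apply/smooth_mx => i j k.
    apply: (Ck_ext (f := fun x : 'rV[R]_(n + 1) => (tau^-1 * time x) * h (lsubmx x) i j)).
      by move=> z; rewrite mxE [tau^-1 * _]mulrC.
    apply: (smooth_mul (f := fun x => tau^-1 * time x)).
      apply: (smooth_mul (f := fun=> tau^-1)); first exact: smooth_cst.
      exact: smooth_time.
    apply: (smooth_comp (f := fun y : 'rV[R]_d => y i j)); first exact: smooth_coord.
    by apply: smooth_comp_mx => //; exact: smooth_lsubmx.
  by near=> z => Sz; rewrite clamp_id.
Unshelve. all: by end_near. Qed.

(** The end point of a path [p] is moved by multiplying [p] with a ray. *)
Lemma ev_submersion : submersion (@ev R G).
Proof.
split; first by move=> n P; exact (path_slice LC tau).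
move=> p pp; have pc n : pth (fun _ : 'rV[R]_n => p) := plot_cst n PG_reparam pp.
have [p0 pclamp _] := pc 0%N.
exists [set g : G | range phi ((p tau)^-1 * g)%g].
exists (fun (g : G) t => (p t * phi ((clamp t / tau) *: Defs.coord phi ((p tau)^-1 * g)))%g).
have tt : clamp tau / tau = 1.
  by rewrite (clamp_id Icl_tau) divff// gt_eqF//; exact: tau_gt0.
split.
- move=> n Q pQ; apply: (open_range_phi (Q := fun u => ((p tau)^-1 * Q u)%g)).
  by apply: plotG_mul => //; exact: (plotG_cst LC).
- by rewrite /= mulVg; exists 0.
- move=> n P u pP OP.
  have pQ : plotG (fun u => (p tau)^-1 * P u)%g.
    by apply: plotG_mul => //; exact: (plotG_cst LC).
  have [h sh hP] := plotG_range pQ OP.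
  exists (fun u t => (p t * phi ((clamp t / tau) *: h u))%g).
    exact (path_mul_plot (pc n) (ray_plot sh)).
  by apply: filterS hP => w ->; rewrite (coordK LC).
- by move=> g _ Og; rewrite /ev tt scale1r (phi_coord Og) mulKVg.
- apply/funext => t; rewrite /ev mulVg -hphi1 (coordK LC) scaler0 hphi1 mulg1 //.
Qed.

Definition reachable : set (dtop (group_space G)) :=
  [set g | exists2 p, pts (PG G) p & @ev R G p = g].

Lemma reachable_mul g h : reachable g -> reachable h -> reachable (g * h)%g.
Proof.
move=> [p pp <-] [q pq <-]; exists (path_mul p q) => //.
exact (path_mul_plot pp pq).
Qed.

Lemma reachable_inv g : reachable g -> reachable (g^-1)%g.
Proof.
move=> [p pp <-]; exists (fun t => (p t)^-1%g) => //.
exact (path_inv_plot pp).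
Qed.

Lemma reachable_phi x : reachable (phi x).
Proof.
exists (fun t => phi ((clamp t / tau) *: x)).
  exact (ray_plot (n := 0) (smooth_cst _ x)).
by rewrite /ev (clamp_id Icl_tau) divff ?scale1r// gt_eqF//; exact: tau_gt0.
Qed.

(** Nearby elements differ by an element of the chart, which is reachable along a
    ray. *)
Lemma reachable_near n (Q : 'rV[R]_n -> G) (u : 'rV[R]_n) : plotG Q ->
  \forall w \near u, reachable (Q w) <-> reachable (Q u).
Proof.
move=> pQ; have pQ' : plotG (fun w => (Q u)^-1 * Q w)%g.
  by apply: plotG_mul => //; exact: (plotG_cst LC).
have [|h sh hP] := plotG_range (u := u) pQ'; first by rewrite mulVg; exists 0.
apply: filterS hP => w e.
have E : Q w = (Q u * phi (h w))%g by rewrite -e mulKVg.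
split=> [rw|ru]; last by rewrite E; exact: reachable_mul (reachable_phi _).
have -> : Q u = (Q w * (phi (h w))^-1)%g by rewrite E mulgK.
by apply: reachable_mul rw _; apply: reachable_inv; exact: reachable_phi.
Qed.

Lemma open_reachable : open reachable.
Proof.
move=> n Q pQ; rewrite openE => u /= ru.
by apply: filterS (reachable_near u pQ) => w [_]; exact.
Qed.

Lemma closed_reachable : closed reachable.
Proof.
rewrite closedE => g; apply: contra_notP => ng.
have oC : open (~` reachable).
  move=> n Q pQ; rewrite openE => u /= ru.
  by apply: filterS (reachable_near u pQ) => w [h _] rw; apply: ru; exact: h.
have : nbhs g (~` reachable) by exact: open_nbhs_nbhs.
done.
Qed.

(** The reachable elements form a subgroup that is open and closed, hence
    everything since the group is path connected. *)
Lemma ev_surjective_submersion : simply_connected R (dtop (group_space G)) ->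
  surjective_submersion (@ev R G).
Proof.
move=> [pc _]; split; first exact: ev_submersion.
move=> x _; have [f [cf f0 f1]] := pc (1%g : G) (x : G).
have I0 : (0 : R) \in `[0, 1] by rewrite in_itv /= lexx ler01.
have I1 : (1 : R) \in `[0, 1] by rewrite in_itv /= lexx ler01.
have cI : connected (f @` [set` `[0, 1]]).
  by apply: connected_continuous_connected cf; exact: segment_connected.
have h := cI (f @` [set` `[0, 1]] `&` reachable).
have e : f @` [set` `[0, 1]] `&` reachable = f @` [set` `[0, 1]].
  apply: h.
  - exists (f 0); split; first by exists 0.
    by rewrite f0 -hphi1; exact: reachable_phi.
  - by exists reachable => //; exact: open_reachable.
  - by exists reachable => //; exact: closed_reachable.
have : (f @` [set` `[0, 1]]) (f 1) by exists 1.
by rewrite -e f1 => -[].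
Qed.

End PathFibration.

(** * The bundle of the basic gerbe *)

Section BasicBundle.
Context {R : realType} (G : smooth_group R) (d : nat) (phi : 'rV[R]_d -> G).
Hypothesis LC : unit_chart phi.
Notation tau := (2 * pi : R).
Context (H : smooth_group R) (proj : H -> (R -> G)) (iota : @U1 R -> H).
Hypothesis hext : central_extension proj iota.
Notation plotH := (@plot R (group_space H) _).
Notation EB := (extension_bundle proj iota).
Notation BB := (basic_bundle proj iota).
Let pE : principal EB := extension_principal hext.

Lemma path_mulA (p q r : R -> G) : path_mul p (path_mul q r) = path_mul (path_mul p q) r.
Proof. by apply/funext => t; rewrite /path_mul mulgA. Qed.

Lemma path_mulI (p q r : R -> G) : path_mul p q = path_mul p r -> q = r.
Proof.
move=> e; apply/funext => t; apply: (mulgI (p t)).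
exact: (congr1 (fun f => f t) e).
Qed.

Lemma path_mul_cst1 (p : R -> G) : path_mul p (fun=> 1%g) = p.
Proof. by apply/funext => t; rewrite /path_mul mulg1. Qed.

Lemma extension_reparam : reparametrizable (group_space H).
Proof. by case: (extension_frechet hext) => -[_ h _] _ _ m n P k; exact: h. Qed.

Lemma proj_unit : proj 1%g = fun=> 1%g.
Proof.
apply: (path_mulI (p := proj 1%g)); rewrite path_mul_cst1.
by rewrite -(extension_projM hext) mulg1.
Qed.

Lemma proj_iota z : pts (@U1 R) z -> proj (iota z) = fun=> 1%g.
Proof.
move=> pz; have := principal_fibre pE (group_pts (1%g : H)) pz.
by rewrite /= mul1g proj_unit.
Qed.

Lemma proj_mul_iota a z : pts (@U1 R) z -> proj (a * iota z)%g = proj a.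
Proof. by move=> pz; rewrite (extension_projM hext) proj_iota// path_mul_cst1. Qed.

Lemma proj_plot n (a : 'rV[R]_n -> H) : plotH a -> plot (OmegaG G) (fun u => proj (a u)).
Proof. exact: (principal_proj pE). Qed.

Lemma plotH_mul n (a b : 'rV[R]_n -> H) : plotH a -> plotH b -> plotH (fun u => a u * b u)%g.
Proof.
move=> pa pb; exact (@group_mul_smooth R H n (fun x => (a x, b x)) (conj pa pb)).
Qed.

Lemma ev_proj (p : R -> G) a : path_mul p (proj a) tau = p tau.
Proof.
have [_ h] := proj_plot (plot_cst 0 extension_reparam (group_pts a)).
by rewrite /path_mul h ?mulg1//; exact: (0 : 'rV[R]_0).
Qed.

Lemma tuple2_eq (T : Type) (y : 'I_2 -> T) a b : y ord0 = a -> y ord_max = b ->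
  (fun i => tnth [tuple a; b] i) = y.
Proof. by move=> <- <-; apply/funext => i; case: (ord2P i) => ->. Qed.

Lemma basic_reparam : reparametrizable (Defs.total BB).
Proof.
move=> m n P h [p1 p2] sh; split; first exact: (PG_reparam LC p1 sh).
exact: (extension_reparam p2 sh).
Qed.

Lemma basic_proj_plot n (p : 'rV[R]_n -> PG G) (a : 'rV[R]_n -> H) :
  plot (PG G) p -> plotH a ->
  plot (fibre_power (@ev R G) 2) (fun u => bproj ((p u, a u) : Defs.total BB)).
Proof.
move=> pp pa; split=> [i|u i j].
  case: (ord2P i) => -> //.
  by apply: path_mul_plot => //; case: (proj_plot pa).
have E k : ev (bproj ((p u, a u) : Defs.total BB) k) = ev (p u).
  by case: (ord2P k) => -> //; exact: ev_proj.
by rewrite !E.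
Qed.

(** The second component of the identification of PG^[2] with PG x OmegaG. *)
Definition loop_difference (y : 'I_2 -> (R -> G)) : R -> G :=
  path_mul (fun t => (y ord0 t)^-1%g) (y ord_max).

Lemma loop_differenceK y : path_mul (y ord0) (loop_difference y) = y ord_max.
Proof. by apply/funext => t; rewrite /path_mul/= mulKVg. Qed.

Lemma loop_difference_proj (e : Defs.total BB) :
  loop_difference (bproj e) = proj e.2.
Proof. by apply/funext => t; rewrite /loop_difference /path_mul /= mulKg. Qed.

Lemma loop_difference_smooth :
  smooth_map (X := fibre_power (@ev R G) 2) (Y := OmegaG G) loop_difference.
Proof.
move=> n P [pP eP]; split.
  by apply: path_mul_plot; [apply: path_inv_plot; exact: pP|exact: pP].
move=> u; rewrite /= /loop_difference /path_mul.
have -> : P u ord_max tau = P u ord0 tau by exact: eP.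
by rewrite mulVg.
Qed.

(** The bundle is the pullback of the central extension along [loop_difference],
    and inherits its local trivialisations. *)
Lemma basic_principal : principal BB.
Proof.
split.
- by move=> n P [p1 p2]; exact: basic_proj_plot.
- move=> n P [[p1 p2] pz]; split => //.
  exact (act_plot pE p2 pz).
- move=> [p a] z [pp pa] pz; rewrite /=.
  by apply: (@tuple2_eq (R -> G)); rewrite /= ?proj_mul_iota.
- by move=> [p a] _; congr (_, _); exact: (principal_act1 pE (group_pts a)).
- by move=> [p a] z w _ pz pw; congr (_, _); exact: (principal_actM pE (group_pts a) pz pw).
- by move=> [p a] z _ pz [ez]; exact: (principal_free pE (group_pts a) pz ez).
- move=> x px; have pd : pts (OmegaG G) (loop_difference x) by exact: (loop_difference_smooth px).
  have [D [s [c [oD Dx [ss sc] sD triv]]]] := principal_trivial pE pd.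
  exists [set y | D (loop_difference y)].
  exists (fun y => (y ord0, s (loop_difference y))), (fun e => c e.2).
  split => //.
  + by move=> n P pP; exact: (oD n _ (loop_difference_smooth pP)).
  + split=> n P u pP DP.
      have [Q pQ QP] := ss n _ u (loop_difference_smooth pP) DP.
      exists (fun u => (P u ord0, Q u)); first exact (conj (pP.1 ord0) pQ).
      by apply: filterS QP => w /= ->.
    have [p1 p2] := pP; apply: (sc n (fun u => (P u).2) u p2).
    by have := DP; rewrite /preimage /= -[proj _]loop_difference_proj.
  + move=> y py Dy; rewrite /=.
    apply: (@tuple2_eq (R -> G)) => //=.
    by rewrite [proj _]sD ?loop_differenceK//; exact: (loop_difference_smooth py).
  + move=> e pe; change (D (loop_difference (bproj e)) ->
        ((e.1, (s (loop_difference (bproj e)) * iota (c e.2))%g) = e)).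
    rewrite loop_difference_proj [RHS]surjective_pairing => De; congr (_, _).
    exact: (triv e.2 (group_pts e.2) De).
Qed.

End BasicBundle.

(** * The multiplication of the basic gerbe *)

Lemma face3 (T : Type) (y : 'I_3 -> T) :
  [/\ face ord0 y = (fun i => tnth [tuple y (inord 1); y ord_max] i),
      face (inord 1) y = (fun i => tnth [tuple y ord0; y ord_max] i) &
      face ord_max y = (fun i => tnth [tuple y ord0; y (inord 1)] i)].
Proof.
rewrite inord1_3; split; apply/esym/tuple2_eq; rewrite /face; congr y; exact: val_inj.
Qed.

(** The simplicial identities for the six edges of a tetrahedron. *)
Lemma face4 (T : Type) (y : 'I_4 -> T)
  (i0 := ord0 : 'I_4) (i1 := lift ord0 (ord0 : 'I_3)) (i2 := lift ord0 (lift ord0 (ord0 : 'I_2)))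
  (i3 := lift ord0 (lift ord0 (lift ord0 (ord0 : 'I_1)))) :
  [/\ face ord_max (face i3 y) = face ord_max (face i2 y),
      face ord0 (face i3 y) = face ord_max (face i0 y) &
      face (inord 1) (face i3 y) = face ord_max (face i1 y)] /\
  [/\ face ord0 (face i2 y) = face (inord 1) (face i0 y),
      face (inord 1) (face i2 y) = face (inord 1) (face i1 y) &
      face ord0 (face i1 y) = face ord0 (face i0 y)].
Proof.
rewrite inord1_3; split; split; apply/funext => k; rewrite /face; congr y;
  by case: (ord2P k) => ->; apply: val_inj.
Qed.

Lemma alternating_prod3 (R : realType) (z : 'I_3 -> R[i]) :
  alternating_prod z = z ord0 * (z (inord 1))^-1 * z ord_max.
Proof.
rewrite /alternating_prod !big_ord_recl big_ord0 /= mulr1 mulrA inord1_3.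
by congr (_ * (z _)^-1 * z _); apply: val_inj.
Qed.

Section Multiplication.
Context {R : realType} (G : smooth_group R) (d : nat) (phi : 'rV[R]_d -> G).
Hypothesis LC : unit_chart phi.
Context (H : smooth_group R) (proj : H -> (R -> G)) (iota : @U1 R -> H).
Hypothesis hext : central_extension proj iota.
Notation plotH := (@plot R (group_space H) _).
Notation EB := (extension_bundle proj iota).
Notation BB := (basic_bundle proj iota).
Notation F k := (fibre_power (@ev R G) k).
Let pE : principal EB := extension_principal hext.
Let pB : principal BB := basic_principal hext.

Lemma fibre_power_face k (i : 'I_k.+1) n (P : 'rV[R]_n -> F k.+1) :
  plot (F k.+1) P -> plot (F k) (fun u => face i (P u)).
Proof. by move=> [pP eP]; split=> [j|u j l]; [exact: pP|exact: eP]. Qed.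

(** The representative of the multiplication over [(p, p gamma, p gamma eta)]
    given by lifts [c] of gamma and [e] of eta; here [q] is [p gamma]. *)
Definition mult_tuple (p q : R -> G) (c e : H) : 'I_3 -> Defs.total BB :=
  fun i => tnth [tuple (q, e); (p, (c * e)%g); (p, c)] i.

Lemma mult_tuple_all (P : 'I_3 -> Defs.total BB -> Prop) p q c e :
  P ord0 (q, e) -> P (inord 1) (p, (c * e)%g) -> P ord_max (p, c) ->
  forall i, P i (mult_tuple p q c e i).
Proof. by rewrite inord1_3 => h0 h1 h2 i; have := ord3P i; rewrite inord1_3 => -[] ->. Qed.

Definition lifts (y : 'I_3 -> (R -> G)) (c e : H) : Prop :=
  y (inord 1) = path_mul (y ord0) (proj c) /\ y ord_max = path_mul (y (inord 1)) (proj e).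

Lemma pts_total (p : R -> G) (a : H) : pts (PG G) p -> pts (Defs.total BB) (p, a).
Proof. by move=> pp; split => //; exact: group_pts. Qed.

Lemma fibre_power_pts k (y : F k) i : pts (F k) y -> pts (PG G) (y i).
Proof. by case=> h _; exact: h. Qed.

Lemma mult_tuple_pts (y : F 3) c e : pts (F 3) y ->
  forall i, pts (Defs.total BB) (mult_tuple (y ord0) (y (inord 1)) c e i).
Proof.
move=> py; apply: (mult_tuple_all (P := fun _ => pts (Defs.total BB)));
  by apply: pts_total; exact: fibre_power_pts py.
Qed.

Lemma basic_bprojE (p q : R -> G) (a : H) : path_mul p (proj a) = q ->
  bproj ((p, a) : Defs.total BB) = (fun i => tnth [tuple p; q] i).
Proof. by move=> <-. Qed.

Lemma mult_tuple_proj (y : F 3) c e : lifts y c e ->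
  forall i, bproj (mult_tuple (y ord0) (y (inord 1)) c e i) = face i y.
Proof.
move=> [y1 y2]; have [f0 f1 f2] := face3 y.
apply: (mult_tuple_all (P := fun i x => bproj x = face i y)).
- by rewrite f0; exact: basic_bprojE.
- by rewrite f1; apply: basic_bprojE; rewrite (extension_projM hext) path_mulA -y1.
- by rewrite f2; exact: basic_bprojE.
Qed.

(** Any other lifts are [c z] and [e w] with [z] and [w] in U(1).  They move the
    tuple by [(w, z w, z)], whose alternating product is 1. *)
Lemma basic_multE (y : F 3) c e : pts (F 3) y -> lifts y c e ->
  basic_mult proj iota y =
  tensor_quotient (E := BB) (y, mult_tuple (y ord0) (y (inord 1)) c e).
Proof.
move=> py ce; have [y1 y2] := ce; congr (_, _).
have pt := mult_tuple_pts c e py.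
have ae i := acted_pts pB (pt i).
apply/seteqP; split=> x /=; last by move=> hx; exists c, e; split.
move=> [c' [e' [y1' y2' h]]].
have [z pz cz] : exists2 z : @U1 R, pts _ z & c' = (c * iota z)%g.
  apply: (fibre_torsor pE (group_pts c) (group_pts c')).
  by apply: (@path_mulI R G (y ord0)); rewrite /= -y1 -y1'.
have [w pw ew] : exists2 w : @U1 R, pts _ w & e' = (e * iota w)%g.
  apply: (fibre_torsor pE (group_pts e) (group_pts e')).
  by apply: (@path_mulI R G (y (inord 1))); rewrite /= -y2 -y2'.
pose t i : @U1 R := tnth [tuple (w : R[i]); (z : R[i]) * w; (z : R[i])] i.
have t1 : t (inord 1) = (z : R[i]) * w by rewrite inord1_3.
have pt' i : pts (@U1 R) (t i).
  by case: (ord3P i) => -> //; rewrite t1; exact: pts_U1M.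
have -> : tensor_class (mult_tuple (y ord0) (y (inord 1)) c e) =
    tensor_class (tact (mult_tuple (y ord0) (y (inord 1)) c e) t).
  rewrite -[X in tensor_class X = _](tact1 ae); apply: (tensor_class_eq ae) => //.
    by move=> _; exact: pts_U11.
  rewrite alternating_prod1 alternating_prod3 t1 /t !(tnth_nth 0) /=.
  by rewrite invfM mulrCA divff ?mulr1 ?mulVf ?U1_neq0.
suff -> : tact (mult_tuple (y ord0) (y (inord 1)) c e) t =
   (fun i => tnth [tuple (y (inord 1), e'); (y ord0, (c' * e')%g); (y ord0, c')] i) by [].
apply/funext; apply: (mult_tuple_all (P := fun i x => bact x (t i) =
  tnth [tuple (y (inord 1), e'); (y ord0, (c' * e')%g); (y ord0, c')] i)).
- by rewrite ew.
- rewrite t1 inord1_3 [RHS](tnth_nth (y ord0, c)) /= cz ew (extension_iotaM hext)//.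
  by rewrite !mulgA -[(c * iota z * e)%g]mulgA (extension_central hext)// mulgA.
- by rewrite cz.
Qed.

(** A plot of tuples has to lie over a plot of PG^[3] everywhere, while the lifts
    to the central extension exist only locally; so the plot is first replaced by
    the one that the lifts determine. *)
Lemma mult_lift n (P : 'rV[R]_n -> F 3) (u : 'rV[R]_n) : plot (F 3) P ->
  exists y : 'rV[R]_n -> F 3, exists c : 'rV[R]_n -> H, exists e : 'rV[R]_n -> H,
  [/\ plot (F 3) y, plotH c, plotH e, forall w, lifts (y w) (c w) (e w) &
      \forall w \near u, P w = y w].
Proof.
have local_lift (D : 'rV[R]_n -> OmegaG G) : plot (OmegaG G) D ->
    exists2 a : 'rV[R]_n -> H, plotH a & \forall w \near u, D w = proj (a w).
  move=> pD; have pDu : pts (OmegaG G) (D u) := plot_pts u (OmegaG_reparam LC) pD.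
  have [N [s [c [oN Nu [ss sc] sN triv]]]] := principal_trivial pE pDu.
  have [a pa aP] := ss n D u pD Nu; exists a => //.
  apply: filterS2 aP (open_plot oN pD Nu) => w <- Nw.
  by rewrite [RHS](sN (D w))//; exact: (plot_pts w (OmegaG_reparam LC) pD).
move=> pP; have [pP1 pP2] := pP.
have [c pc cP] := local_lift _ (loop_difference_smooth (fibre_power_face ord_max pP)).
have [e pe eP] := local_lift _ (loop_difference_smooth (fibre_power_face ord0 pP)).
pose y w : F 3 := fun i => tnth [tuple P w ord0; path_mul (P w ord0) (proj (c w));
  path_mul (path_mul (P w ord0) (proj (c w))) (proj (e w))] i.
exists y, c, e; split => //.
  have pc' : path_plot (fun w => path_mul (P w ord0) (proj (c w))).
    by apply: path_mul_plot; [exact: pP1|case: (proj_plot hext pc)].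
  split=> [i|w i j].
    have := ord3P i; rewrite inord1_3 => -[] ->.
    - exact: pP1.
    - exact: pc'.
    - by apply: path_mul_plot => //; case: (proj_plot hext pe).
  have E k : ev (y w k) = ev (P w ord0).
    by have := ord3P k; rewrite inord1_3 => -[] -> //; rewrite /ev /= ?[LHS](ev_proj hext).
  by rewrite !E.
- by move=> w; split; rewrite inord1_3.
- apply: filterS2 cP eP => w /= cw ew.
  have [f0 f1 f2] := face3 (P w).
  have e1 : path_mul (P w ord0) (proj (c w)) = P w (inord 1).
    by have E := loop_differenceK (face ord_max (P w)); rewrite f2 in E cw; rewrite -cw.
  have e2 : path_mul (P w (inord 1)) (proj (e w)) = P w ord_max.
    by have E := loop_differenceK (face ord0 (P w)); rewrite f0 in E ew; rewrite -ew.
  apply/funext => i; rewrite /y e1 e2.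
  by have := ord3P i; rewrite inord1_3 => -[] ->.
Qed.

End Multiplication.

(** * The axioms of a bundle gerbe *)

Section GerbeAxioms.
Context {R : realType} (G : smooth_group R) (d : nat) (phi : 'rV[R]_d -> G).
Hypothesis LC : unit_chart phi.
Context (H : smooth_group R) (proj : H -> (R -> G)) (iota : @U1 R -> H).
Hypothesis hext : central_extension proj iota.
Notation plotH := (@plot R (group_space H) _).
Notation EB := (extension_bundle proj iota).
Notation BB := (basic_bundle proj iota).
Notation F k := (fibre_power (@ev R G) k).
Let pE : principal EB := extension_principal hext.
Let pB : principal BB := basic_principal hext.

Lemma face3_entries (T : Type) (y : 'I_3 -> T) :
  [/\ face ord0 y ord0 = y (inord 1), face ord0 y ord_max = y ord_max &
      face (inord 1) y ord0 = y ord0] /\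
  [/\ face (inord 1) y ord_max = y ord_max, face ord_max y ord0 = y ord0 &
      face ord_max y ord_max = y (inord 1)].
Proof. by have [-> -> ->] := face3 y. Qed.

(** The two bracketings of the product over three consecutive edges. *)
Lemma tetrahedron (K : groupType) (x01 x12 x23 x02 x13 x03 c0 c1 c2 c3 : K) :
  (x01 * x12 = x02 * c3 -> x01 * x13 = x03 * c2 -> x02 * x23 = x03 * c1 ->
   x12 * x23 = x13 * c0 -> c3 * x23 = x23 * c3 ->
   x03 * (c2 * c0) = x03 * (c1 * c3))%g.
Proof.
move=> e3 e2 e1 e0 cc.
by rewrite !mulgA -e2 -e1 -[RHS]mulgA -cc mulgA -e3 -!mulgA e0.
Qed.

Definition mult_data n (y : 'rV[R]_n -> F 3) (c e : 'rV[R]_n -> H) : 'rV[R]_n -> tuple_space BB :=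
  fun w => (y w, mult_tuple proj iota (y w ord0) (y w (inord 1)) (c w) (e w)).

Lemma fibre_power_reparam_ev k : reparametrizable (F k).
Proof. exact: (fibre_power_reparam (PG_reparam LC)). Qed.

Lemma mult_data_plot n (y : 'rV[R]_n -> F 3) c e : plot (F 3) y -> plotH c -> plotH e ->
  (forall w, lifts proj (y w) (c w) (e w)) -> plot (tuple_space BB) (mult_data y c e).
Proof.
move=> py pc pe L; have [py1 py2] := py; split.
- exact: py.
- move=> i; have := ord3P i; rewrite inord1_3 => -[] ->.
  + by split; [exact: py1|exact: pe].
  + by split; [exact: py1|exact: (plotH_mul pc pe)].
  + by split; [exact: py1|exact: pc].
- by move=> w i; exact: (mult_tuple_proj hext (L w)).
Qed.

Lemma mult_delta_lift n (P : 'rV[R]_n -> F 3) (u : 'rV[R]_n) : plot (F 3) P ->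
  exists y : 'rV[R]_n -> F 3, exists c : 'rV[R]_n -> H, exists e : 'rV[R]_n -> H,
  [/\ plot (F 3) y, plotH c, plotH e, forall w, lifts proj (y w) (c w) (e w) &
      delta_lift (fun w => basic_mult proj iota (P w) : delta_total BB) u (mult_data y c e)].
Proof.
move=> pP; have [y [c [e [py pc pe L PL]]]] := mult_lift LC hext u pP.
exists y, c, e; split => //; split; first exact: mult_data_plot.
apply: filterS PL => w ->.
exact: (basic_multE hext (plot_pts w (@fibre_power_reparam_ev 3) py) (L w)).
Qed.

Lemma basic_mult_smooth : smooth_map (X := F 3) (Y := delta_total BB) (basic_mult proj iota).
Proof.
move=> n P pP u; have [y [c [e [_ _ _ _ [pQ QP]]]]] := mult_delta_lift u pP.
by exists (mult_data y c e).
Qed.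

Section Canonical.
Variable s : F 2 -> Defs.total BB.
Hypothesis sP : forall y, pts (F 2) y -> pts (Defs.total BB) (s y) /\ bproj (s y) = y.

Lemma section_fst y : pts (F 2) y -> (s y).1 = y ord0.
Proof. by move=> /sP[_ e]; rewrite -[in RHS]e. Qed.

Lemma section_snd y : pts (F 2) y -> path_mul (y ord0) (proj (s y).2) = y ord_max.
Proof. by move=> py; rewrite -section_fst//; have [_ e] := sP py; rewrite -[in RHS]e. Qed.

Lemma fibre_power_face_pts k (i : 'I_k.+1) (y : F k.+1) : pts (F k.+1) y -> pts (F k) (face i y).
Proof. exact: (fibre_power_face i (n := 0)). Qed.

Lemma section_lifts (y : F 3) : pts (F 3) y ->
  lifts proj y (s (face ord_max y)).2 (s (face ord0 y)).2.
Proof.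
move=> py; have [[a0 b0 a1] [b1 a2 b2]] := face3_entries y.
have h2 := section_snd (fibre_power_face_pts ord_max py).
have h0 := section_snd (fibre_power_face_pts ord0 py).
by rewrite a2 b2 in h2; rewrite a0 b0 in h0; rewrite /lifts h2 h0.
Qed.

(** The scalar [w] measures the failure of the section to be multiplicative over
    the triple. *)
Lemma section_defect (y : F 3) : pts (F 3) y -> exists2 w : @U1 R, pts _ w &
  ((s (face ord_max y)).2 * (s (face ord0 y)).2 = (s (face (inord 1) y)).2 * iota w)%g /\
  basic_mult proj iota y = bact (delta_section s y) (w : R[i])^-1.
Proof.
move=> py; have L := section_lifts py; have [L1 L2] := L.
have [[a0 b0 a1] [b1 a2 b2]] := face3_entries y.
have pf i := fibre_power_face_pts i py.
have [w pw wP] : exists2 w : @U1 R, pts _ w &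
    ((s (face ord_max y)).2 * (s (face ord0 y)).2)%g = ((s (face (inord 1) y)).2 * iota w)%g.
  apply: (fibre_torsor pE (group_pts _) (group_pts _)).
  apply: (@path_mulI R G (y ord0)); rewrite /= (extension_projM hext) path_mulA -L1 -L2.
  by have := section_snd (pf (inord 1)); rewrite a1 b1 => ->.
exists w => //; split => //.
pose z (i : 'I_3) : @U1 R := if i == inord 1 then (w : R[i]) else (1 : R[i]).
have n0 : (ord0 == inord 1 :> 'I_3) = false by rewrite inord1_3.
have n2 : (ord_max == inord 1 :> 'I_3) = false by rewrite inord1_3.
have pz i : pts (@U1 R) (z i) by rewrite /z; case: ifP => // _; exact: pts_U11.
rewrite (basic_multE hext py L) /delta_section.
rewrite (delta_act_tact pB y (z := z))//.
- congr tensor_quotient; congr (_, _); apply/funext => i.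
  have fst_s j : (s (face j y)).1 = face j y ord0 by exact: section_fst.
  rewrite /tact; apply/esym; have := ord3P i => -[] ->.
  + rewrite /z n0 (principal_act1 pB) ; last exact: (sP (pf _)).1.
    by rewrite [LHS]surjective_pairing fst_s a0.
  + rewrite /z eqxx /= -wP fst_s a1.
    by rewrite inord1_3.
  + rewrite /z n2 (principal_act1 pB) ; last exact: (sP (pf _)).1.
    by rewrite [LHS]surjective_pairing fst_s a2.
- by move=> i; have [] := sP (pf i).
- exact: pts_U1V.
- by rewrite alternating_prod3 /z n0 n2 eqxx mul1r mulr1.
Qed.

(** The two sections of delta^2 E differ by the alternating product of the defects
    of [s] over the four faces of a tetrahedron, which is 1 by associativity. *)
Lemma basic_canonical (y : F 4) : pts (F 4) y ->
  delta_section (basic_mult proj iota) y = delta_section (delta_section s) y.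
Proof.
move=> py.
have pf i := fibre_power_face_pts i py.
have wex i := section_defect (pf i).
pose w i : @U1 R := projT1 (cid2 (wex i)).
have pw i : pts (@U1 R) (w i) by rewrite /w; case: cid2.
have wP i : ((s (face ord_max (face i y))).2 * (s (face ord0 (face i y))).2 =
    (s (face (inord 1) (face i y))).2 * iota (w i))%g /\
    basic_mult proj iota (face i y) = bact (delta_section s (face i y)) (w i : R[i])^-1.
  by rewrite /w; case: cid2.
have pwV i : pts (@U1 R) (w i : R[i])^-1 := pts_U1V (pw i).
congr (_, _).
have ae i : acted (E := delta_bundle BB) (delta_section s (face i y)).
  by apply: (delta_acted pB) => j; have [] := sP (fibre_power_face_pts j (pf i)).
have -> : (fun i => basic_mult proj iota (face i y)) =
    tact (E := delta_bundle BB) (fun i => delta_section s (face i y)) (fun i => (w i : R[i])^-1).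
  by apply/funext => i; have [_ ->] := wP i.
rewrite -[RHS](congr1 _ (tact1 ae)); apply: (tensor_class_eq ae) => //.
  by move=> _; exact: pts_U11.
rewrite alternating_prod1 alternating_prodV.
rewrite /alternating_prod !big_ord_recl big_ord0 /= mulr1.
set i0 := ord0 : 'I_4; set i1 := lift _ _; set i2 := lift _ _; set i3 := lift _ _.
have [[e1 e2 e3] [e4 e5 e6]] := face4 y.
have [w0 _] := wP i0; have [w1 _] := wP i1; have [w2 _] := wP i2; have [w3 _] := wP i3.
rewrite /i0 /i1 /i2 /i3 in w0 w1 w2 w3.
rewrite e1 e2 e3 in w3; rewrite e4 e5 in w2; rewrite e6 in w1.
set x03 := (s (face (inord 1) (face (lift ord0 ord0) y))).2 in w1 w2.
have E : bact (x03 : Defs.total EB) ((w i2 : R[i]) * w i0) =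
         bact (x03 : Defs.total EB) ((w i1 : R[i]) * w i3).
  have wM i j : iota ((w i : R[i]) * w j) = (iota (w i) * iota (w j))%g.
    exact: (extension_iotaM hext (pw i) (pw j)).
  rewrite /= !wM.
  exact (tetrahedron w3 w2 w1 w0 (extension_central hext _ (pw i3))).
have := act_inj pE (group_pts x03) (pts_U1M (pw i2) (pw i0)) (pts_U1M (pw i1) (pw i3)) E.
move=> /= ww.
apply: (can_inj (@invrK _)); rewrite invrK invr1.
have n1 := U1_neq0 (pw i1); have n3 := U1_neq0 (pw i3).
rewrite mulrA mulrACA -invfM -ww [w i2 * _]mulrC divff//.
by rewrite mulf_neq0// U1_neq0.
Qed.

End Canonical.

Lemma basic_bundle_gerbe : simply_connected R (dtop (group_space G)) ->
  bundle_gerbe (basic_gerbe proj iota).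
Proof.
move=> sc; split.
- exact: (ev_surjective_submersion LC).
- exact: pB.
- exact: basic_mult_smooth.
- by [].
- by move=> s sP y py; exact: basic_canonical.
Qed.

End GerbeAxioms.

(** * Connection, curving and 3-form curvature *)

Lemma derivable_form (R : realType) k (X : pspace R) (w : diff_form k X) n
  (P : 'rV[R]_n -> X) v x (u : 'rV[R]_n) : is_form w -> plot X P -> derivable (fun u' => w n P u' v) u x.
Proof. by move=> fw pP; apply: smooth_derivable; exact: (form_smooth fw). Qed.

Arguments derivable_form {R k X w n P} v x u _ _.

Lemma ext_d_sub (R : realType) k (X : pspace R) (w w' : diff_form k X) :
  is_form w -> is_form w' ->
  form_eq (ext_d (sub_form w w')) (sub_form (ext_d w) (ext_d w')).
Proof.
move=> fw fw' n P u v pP; rewrite /ext_d /sub_form -mulrBr -sumrB; congr (_ * _).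
apply: eq_bigr => i _; rewrite -mulrBr; congr (_ * _).
exact (deriveB (derivable_form _ (v i) u fw pP) (derivable_form _ (v i) u fw' pP)).
Qed.

Lemma alternating_cancel (V : comPzRingType) (a b x p q r z : V) :
  a + b - x = z -> p - q + r = z -> (b - p) - (x - q) + (a - r) = 0.
Proof.
by move=> e1 e2; transitivity (z - z); [rewrite -{1}e1 -e2; ring|exact: subrr].
Qed.

Section GerbeConnection.
Context {R : realType} (G : smooth_group R) (d : nat) (phi : 'rV[R]_d -> G).
Hypothesis LC : unit_chart phi.
Variable ip : 'rV[R]_d -> 'rV[R]_d -> R.
Hypothesis hip : basic_inner_product phi ip.
Context (H : smooth_group R) (proj : H -> (R -> G)) (iota : @U1 R -> H).
Hypothesis hext : central_extension proj iota.
Variable mu : diff_form 1 (group_space H).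
Hypothesis hmu : extension_connection phi ip proj iota mu.
Notation plotH := (@plot R (group_space H) _).
Notation EB := (extension_bundle proj iota).
Notation BB := (basic_bundle proj iota).
Notation F k := (fibre_power (@ev R G) k).
Notation nab := (nabla phi ip proj iota mu).
Let pB : principal BB := basic_principal hext.
Let rB : reparametrizable (Defs.total BB) := basic_reparam LC hext.
Let cmu : is_connection (E := EB) mu := extension_is_connection hmu.
Let fmu : is_form mu := connection_form cmu.
Let feps : is_form (epsilon phi ip : diff_form 1 (prod_space (PG G) (OmegaG G))) :=
  epsilon_is_form LC hip.

Lemma basic_pr2_smooth : smooth_map (@basic_pr2 R G H proj iota).
Proof. by move=> n P [_]. Qed.

Lemma basic_pi_smooth : smooth_map (@basic_pi R G H proj iota).
Proof. by move=> n P [p1 p2]; split; [exact: p1|exact: (proj_plot hext p2)]. Qed.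

Lemma nabla_is_form : is_form (nab : diff_form 1 (Defs.total BB)).
Proof.
apply: is_form_sub; apply: is_form_pullback => //.
- exact: basic_pr2_smooth.
- exact: basic_pi_smooth.
Qed.

Lemma nabla_connection : is_connection (E := BB) nab.
Proof.
split; first exact: nabla_is_form.
- move=> z pz n P u v [p1 p2]; rewrite /pullback /nabla /sub_form /pullback.
  have -> : basic_pi (proj := proj) (iota := iota) \o ((fun e => bact e z) \o P) =
            basic_pi (proj := proj) (iota := iota) \o P.
    by apply/funext => w; rewrite /basic_pi /= proj_mul_iota.
  congr (_ - _); exact (connection_invariant cmu pz u v p2).
- move=> [p a] [pp pa]; rewrite /nabla /sub_form /pullback.
  have -> : basic_pi (proj := proj) (iota := iota) \o
      (fun t : 'rV[R]_1 => bact ((p, a) : Defs.total BB) (expi (t 0 0))) = fun=> (p, proj a).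
    apply/funext => w; rewrite /basic_pi /= (proj_mul_iota hext)//; exact: pts_expi.
  (* Along a fibre the path and the loop are constant, so epsilon vanishes. *)
  rewrite (one_form_cst _ _ _ feps); first last.
  - by split; [exact: pp|exact: (proj_plot hext pa)].
  - move=> m n P h [q1 q2] sh; split; first exact: (PG_reparam LC q1 sh).
    exact: (OmegaG_reparam LC q2 sh).
  rewrite subr0; exact: (connection_vertical cmu pa).
Qed.

(** On the representatives, the terms in mu combine to nu by hypothesis, and those
    in epsilon by [epsilon_cocycle]. *)
Lemma nabla_mult_data n (y : 'rV[R]_n -> F 3) c e u v : plot (F 3) y -> plotH c -> plotH e ->
  (forall w, lifts proj (y w) (c w) (e w)) ->
  tuple_form (E := BB) nab (mult_data proj iota y c e) u v = 0.
Proof.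
move=> [py _] pc pe L.
rewrite /tuple_form alternating_sum3 /nabla /sub_form /pullback.
set y0 := fun w => y w ord0.
have E1 : basic_pi (proj := proj) (iota := iota) \o (fun w => (mult_data proj iota y c e w).2 ord0) =
    (fun w => (path_mul (y0 w) (proj (c w)), proj (e w))).
  by apply/funext => w; have [h _] := L w; congr (_, _).
have E2 : basic_pi (proj := proj) (iota := iota) \o (fun w => (mult_data proj iota y c e w).2 (inord 1)) =
    (fun w => (y0 w, path_mul (proj (c w)) (proj (e w)))).
  by apply/funext => w; rewrite inord1_3 -(extension_projM hext).
have E3 : basic_pi (proj := proj) (iota := iota) \o (fun w => (mult_data proj iota y c e w).2 ord_max) =
    (fun w => (y0 w, proj (c w))) by [].
rewrite E1 E2 E3.
have M2 : basic_pr2 (proj := proj) (iota := iota) \o (fun w => (mult_data proj iota y c e w).2 (inord 1)) =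
    fun w => (c w * e w)%g by rewrite inord1_3.
have M1 : basic_pr2 (proj := proj) (iota := iota) \o (fun w => (mult_data proj iota y c e w).2 ord0) = e by [].
have M3 : basic_pr2 (proj := proj) (iota := iota) \o (fun w => (mult_data proj iota y c e w).2 ord_max) = c by [].
rewrite M1 M2 M3.
have h1 := epsilon_cocycle LC hip u v (py ord0) (proj_plot hext pc) (proj_plot hext pe).
have h2 : mu c u v + mu e u v - mu (fun w => c w * e w)%g u v =
    @nu R G d phi ip n (fun w => (proj (c w), proj (e w))) u v := extension_nu hmu u v (conj pc pe : plot (extension_square H) (fun w => (c w, e w))).
exact (alternating_cancel h2 h1).
Qed.

Lemma nabla_gerbe_connection : gerbe_connection (B := basic_gerbe proj iota) nab.
Proof.
split; first exact: nabla_connection.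
exists (descended_form (E := BB) nab).
  exact: (descended_connection pB (PG_reparam LC) rB nabla_connection).
move=> n P u v pP.
have [y [c [e [py pc pe L PL]]]] := mult_delta_lift LC hext u pP.
apply: etrans (descended_formE pB (PG_reparam LC) rB nabla_connection v PL) _.
exact: nabla_mult_data.
Qed.

Let B : diff_form 2 (PG G) := curving_B phi ip.

Lemma curving_gerbe_curving : gerbe_curving (B := basic_gerbe proj iota) nab B.
Proof.
have fB : is_form B := curving_is_form LC hip.
split; first exact fB.
have smooth_entry i : smooth_map (X := F 2) (Y := PG G) (fun y => y i).
  by move=> n P [pP _]; exact (pP i).
(* The faces of a pair are exchanged: [d_0] keeps the last entry. *)
have dE n (P : 'rV[R]_n -> F 2) u v :
    delta_form (p := @ev R G) (m := 1) (pullback (fun y : F 1 => y ord0) B) P u v =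
    B (fun w => P w ord_max) u v - B (fun w => P w ord0) u v.
  rewrite /delta_form alternating_sum2 /pullback.
  have e0 : (fun w => face ord0 (P w) ord0) = fun w => P w ord_max.
    by apply/funext => w; congr (P w _); apply: val_inj.
  have e1 : (fun w => face ord_max (P w) ord0) = fun w => P w ord0.
    by apply/funext => w; congr (P w _); apply: val_inj.
  exact (congr2 (fun a b => B a u v - B b u v) e0 e1).
split.
- apply: (form_eq_is_form (w := sub_form (pullback (fun y : F 2 => y ord_max) B)
      (pullback (fun y : F 2 => y ord0) B))).
  + by move=> m n P h pP sh; exact: (fibre_power_reparam_ev LC pP sh).
  + by move=> n P u v pP; rewrite dE.
  + by apply: is_form_sub; apply: is_form_pullback.
- move=> n P u v pP; have [p1 p2] := pP.
  apply: etrans (dE _ _ _ _) _.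
  apply: etrans (curving_gauge LC hip u v p1 (proj_plot hext p2)) _.
  apply: etrans _ (esym (ext_d_sub (is_form_pullback basic_pr2_smooth fmu)
    (is_form_pullback basic_pi_smooth feps) u v pP)).
  congr (_ - _); exact: ((extension_curvature hmu).2 n (fun w => (P w).2) u v p2).
Qed.

(** Uniqueness holds because plots of G lift locally to PG. *)
Lemma omega_three_form_curvature :
  surjective_submersion (@ev R G) ->
  three_form_curvature (B := basic_gerbe proj iota) B (omega phi ip).
Proof.
move=> [[sev sub] sur]; split.
- exact: omega_is_form.
- move=> n P u v pP; exact: (curving_omega LC hip).
- move=> H' fH' eH' n P u v pP.
  have fo := omega_is_form LC hip.
  have dG := unit_chart_diffeology LC.
  have [y py yP] := sur (P u) (group_pts _).
  have [N [s [oN Ny ss sN sy]]] := sub y py.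
  rewrite yP in Ny; have [Q pQ PQ] := ss n P u pP Ny.
  have near_ev : \forall w \near u, P w = ev (Q w).
    apply: filterS2 PQ (open_plot oN pP Ny) => w <- Nw.
    by rewrite sN//; exact: group_pts.
  have pev : plot (group_space G) (fun w => ev (Q w)) by exact: sev.
  rewrite (form_local fH' v pP pev near_ev) (form_local fo v pP pev near_ev).
  apply: etrans (eH' n Q u v pQ) _; apply/esym; exact: (curving_omega LC hip).
Qed.

End GerbeConnection.

Theorem proposition1p9 (R : realType)
  (* the compact, simple, simply-connected Lie group G *)
  (d : nat) (G : smooth_group R)
  (hG : manifold d (group_space G))
  (hcompact : compact [set: dtop (group_space G)])
  (hsc : simply_connected R (dtop (group_space G)))
  (phi : 'rV[R]_d -> G) (hphi : chart (X := group_space G) phi)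
  (hphi1 : phi 0 = 1%g)
  (hsimple : simple_lie_algebra phi)
  (ip : 'rV[R]_d -> 'rV[R]_d -> R) (hip : basic_inner_product phi ip)
  (* the central extension and its connection mu *)
  (OmegaHat : smooth_group R)
  (proj : OmegaHat -> (R -> G)) (iota : @U1 R -> OmegaHat)
  (hext : central_extension proj iota)
  (mu : diff_form 1 (group_space OmegaHat))
  (hmu : extension_connection phi ip proj iota mu) :
  [/\ bundle_gerbe (basic_gerbe proj iota),
      gerbe_connection (B := basic_gerbe proj iota) (nabla phi ip proj iota mu),
      gerbe_curving (B := basic_gerbe proj iota) (nabla phi ip proj iota mu)
        (curving_B phi ip) &
      three_form_curvature (B := basic_gerbe proj iota) (curving_B phi ip)
        (omega phi ip)].
Proof.
have [dG _ _] := hG; have LC := UnitChart dG hphi hphi1.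
split.
- exact (basic_bundle_gerbe LC hext hsc).
- exact (nabla_gerbe_connection LC hip hext hmu).
- exact (curving_gerbe_curving LC hip hext hmu).
- exact (omega_three_form_curvature LC hip proj iota (ev_surjective_submersion LC hsc)).
Qed.
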